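(* Let $\tau \in \mathcal{H}$. For any integers $k \geqslant 2$ and $k_1, k_2 \geqslant 0$ with $k = k_1+k_2+2$, and any $u, v, w \in \mathbf{C}/(\mathbf{Z}\tau+\mathbf{Z})$ with $u+v+w=0$ and $u,v,w \neq 0$, we have \[ \begin{split} & X^{k_1} Y^{k_2} [u, v]_\tau + (-X-Y)^{k_1} X^{k_2} [v, w]_\tau + Y^{k_1} (-X-Y)^{k_2} [w, u]_\tau \\ & \qquad = \frac{(-1)^{k_2+1}}{k_2+1} E^{(k)}_u(\tau) + \frac{(-1)^{k_1+1}}{k_1+1} E^{(k)}_v(\tau) + (-1)^{k_1+k_2+1} \frac{k_1!\, k_2!}{(k_1+k_2+1)!} E^{(k)}_w(\tau). \end{split} \] In particular, for any integers $k \geqslant 2$, $k_1,k_2\geqslant 0$ with $k=k_1+k_2+2$, any level $N \geqslant 1$ and any ${\boldsymbol a}, {\boldsymbol b}, {\boldsymbol c} \in (\mathbf{Z}/N\mathbf{Z})^2$ with ${\boldsymbol a}+{\boldsymbol b}+{\boldsymbol c}=0$ and ${\boldsymbol a},{\boldsymbol b},{\boldsymbol c} \neq 0$, the following identity holds in $M_k(\Gamma(N))$: \[ \begin{split} & X^{k_1} Y^{k_2} [{\boldsymbol a}, {\boldsymbol b}] + (-X-Y)^{k_1} X^{k_2} [{\boldsymbol b}, {\boldsymbol c}] + Y^{k_1} (-X-Y)^{k_2} [{\boldsymbol c}, {\boldsymbol a}] \\ & \qquad = \frac{(-1)^{k_2+1}}{k_2+1} E^{(k;N)}_{\boldsymbol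 a} + \frac{(-1)^{k_1+1}}{k_1+1} E^{(k;N)}_{\boldsymbol b} + (-1)^{k_1+k_2+1} \frac{k_1!\, k_2!}{(k_1+k_2+1)!} E^{(k;N)}_{\boldsymbol c}. \end{split} \]
   Context: $\mathcal{H}$ is the upper half-plane and $e(z)=\exp(2\pi i z)$. For an integer $k \geqslant 1$, $\tau \in \mathcal{H}$ and $z = x_1\tau + x_2 \in \mathbf{C}$ with $x_1,x_2 \in \mathbf{R}$, define the Eisenstein–Kronecker series $\mathcal{K}^{(k)}_z(\tau,s) = \sum_{(m,n) \in \mathbf{Z}^2\setminus\{(0,0)\}} \frac{e(mx_2 - nx_1)}{(m\tau+n)^k |m\tau+n|^{2s}}$, which converges for $\mathrm{Re}(s) > 1-\frac{k}{2}$ and extends to a holomorphic function of $s \in \mathbf{C}$. Set $E^{(k)}_z(\tau) = -\frac{(k-1)!}{(-2\pi i)^k}\mathcal{K}^{(k)}_z(\tau,0)$; it depends only on $z$ modulo $\mathbf{Z}\tau+\mathbf{Z}$. For integers $k_1,k_2 \geqslant 0$ and $u,v \in \mathbf{C}/(\mathbf{Z}\tau+\mathbf{Z})$, put $X^{k_1}Y^{k_2}[u,v]_\tau = E^{(k_1+1)}_u(\tau)E^{(k_2+1)}_v(\tau)$, and extend linearly to homogeneous polynomials $P(X,Y)=\sum_{k_1+k_2=\ell} c_{k_1,k_2}X^{k_1}Y^{k_2}$: $P[u,v]_\tau = \sum c_{k_1,k_2} X^{k_1}Y^{k_2}[u,v]_\tau$. For $N \geqslant 1$ and ${\boldsymbol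 a}=(a_1,a_2) \in (\mathbf{Z}/N\mathbf{Z})^2$, define $E^{(k;N)}_{\boldsymbol a}(\tau) = E^{(k)}_{(\tilde a_1\tau+\tilde a_2)/N}(\tau)$ for any integer lifts $\tilde a_1,\tilde a_2$ of $a_1,a_2$, and $X^{k_1}Y^{k_2}[{\boldsymbol a},{\boldsymbol b}] = E^{(k_1+1;N)}_{\boldsymbol a} E^{(k_2+1;N)}_{\boldsymbol b}$ (as functions of $\tau$), extended linearly to homogeneous polynomials likewise. $\Gamma(N)$ is the principal congruence subgroup of level $N$, and $M_k(\Gamma(N))$ is the space of holomorphic modular forms of weight $k$ for $\Gamma(N)$ (holomorphic at all cusps). *)

(* Defs.v *)
From HB Require Import structures.
From mathcomp Require Export all_boot all_order all_algebra finmap.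
From mathcomp Require Export generic_quotient ring_quotient.
From mathcomp Require Export all_classical all_reals all_analysis.
From mathcomp.analysis Require Export showcase.summability.
From mathcomp Require Export complex.
From mathcomp Require Import ring.
Export Order.TTheory GRing.Theory Num.Theory.
Export numFieldNormedType.Exports.

Set Implicit Arguments.
Unset Strict Implicit.
Unset Printing Implicit Defensive.

Local Open Scope classical_set_scope.
Local Open Scope complex_scope.
Local Open Scope quotient_scope.
Local Open Scope ring_scope.

(* all_algebra shadows these names with the algC-style 'Re and 'Im, which take
   values in R[i] rather than in R. *)
Local Notation Re := complex.Re.
Local Notation Im := complex.Im.

Section ComplexAnalysis.
Variable R : realType.
Local Notation C := R[i].

(* Complex differentiability at every point of U; U is meant to be open. *)
Definition holomorphic_on (U : set C) (f : C -> C) : Prop :=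
  forall z, U z -> derivable (f : C^o -> C^o) z 1.

Definition expC (z : C) : C := (expR (Re z))%:C * (cos (Im z) +i* sin (Im z)).

Definition exp2piI (z : C) : C := expC ((2 * pi)%:C * 'i%C * z).

(* r ^ s for a real r > 0 *)
Definition rpowC (r : R) (s : C) : C := expC (s * (ln r)%:C).

(* Convergence along the net of finite partial sums, i.e. unconditional
   (equivalently, absolute) summability with sum l. *)
Definition has_sum (I : choiceType) (x : I -> C) (l : C) : Prop :=
  partial_sum (x : I -> C^o) A @[A --> totally] --> (l : C^o).

Definition upper_half_plane : set C := [set tau | 0 < Im tau].

End ComplexAnalysis.

Section EisensteinKronecker.
Variable R : realType.
Local Notation C := R[i].
Implicit Types (tau z s : C) (k : nat).

(* z = coord1 tau z * tau + coord2 tau z *)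
Definition coord1 tau z : R := Im z / Im tau.
Definition coord2 tau z : R := Re z - coord1 tau z * Re tau.

Lemma coordK tau z : upper_half_plane tau ->
  z = (coord1 tau z)%:C * tau + (coord2 tau z)%:C.
Proof.
rewrite /upper_half_plane /coord2 /coord1; case: tau z => [a b] [x y] /= b_gt0.
apply/eqP; rewrite eq_complex /= !mul0r subr0 addr0 subrKC eqxx /=.
by rewrite addr0 divfK // gt_eqF.
Qed.

Definition EK_term k tau z s (mn : int * int) : C :=
  let w : C := mn.1%:~R * tau + mn.2%:~R in
  if mn == 0 then 0 else
  exp2piI (mn.1%:~R * coord2 tau z - mn.2%:~R * coord1 tau z)%:C
    / (w ^+ k * rpowC (Re `|w|) (2 * s)).

(* f is the entire function of s that extends the Eisenstein-Kronecker series *)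
Definition EK_continuation k tau z (f : C -> C) : Prop :=
  holomorphic_on setT f /\
  forall s, 1 - k%:R / 2 < Re s -> has_sum (EK_term k tau z s) (f s).

Definition EK k tau z : C -> C := xget (fun=> 0) (EK_continuation k tau z).

Definition eisenstein k tau z : C :=
  - ((k.-1)`!%:R / (- ((2 * pi)%:C * 'i%C)) ^+ k) * EK k tau z 0.

Definition lattice tau : {pred C} :=
  [pred z | `[< exists m n : int, z = m%:~R * tau + n%:~R >]].

Lemma lattice_zmod_closed tau : zmod_closed (lattice tau).
Proof.
split=> [|x y]; first by apply/asboolP; exists 0, 0; rewrite mul0r addr0.
move=> /asboolP[m [n ->]] /asboolP[p [q ->]]; apply/asboolP.
by exists (m - p), (n - q); rewrite !rmorphB /= mulrBl opprD addrACA.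
Qed.

HB.instance Definition _ tau :=
  GRing.isZmodClosed.Build C (lattice tau) (lattice_zmod_closed tau).

(* C / (Z tau + Z) *)
Definition torus tau : zmodQuotType _ (0 : C) -%R +%R :=
  Quotient.quot (lattice tau).

Definition eisenstein_torus k tau (u : torus tau) : C :=
  eisenstein k tau (repr u).

Lemma exp2piID_int (x : R) (n : int) :
  exp2piI (x + n%:~R)%:C = exp2piI x%:C.
Proof.
suff H (y : R) (m : nat) : exp2piI (y + m%:R)%:C = exp2piI y%:C.
  case: n => n; first exact: H.
  by rewrite NegzE mulrNz -[LHS](H _ n.+1) subrK.
rewrite /exp2piI /expC /= !(mul0r, mulr0, mul1r, mulr1, addr0, add0r, subr0, oppr0).
have -> : 2 * pi * (y + m%:R) = 2 * pi * y + pi *+ 2 *+ m.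
  by rewrite mulrDr mulr_natr mulr_natl.
by rewrite (periodicn (@cosD2pi R)) (periodicn (@sinD2pi R)).
Qed.

Lemma eisenstein_lattice k tau z t : upper_half_plane tau ->
  t \in lattice tau -> eisenstein k tau (z + t) = eisenstein k tau z.
Proof.
move=> tauH /asboolP[p [q ->]].
have ImE (a : int) : Im (a%:~R : C) = 0 by rewrite -(rmorph_int (real_complex R)).
have ReE (a : int) : Re (a%:~R : C) = a%:~R
  by rewrite -(rmorph_int (real_complex R)).
have c1 : coord1 tau (z + (p%:~R * tau + q%:~R)) = coord1 tau z + p%:~R.
  rewrite /coord1 !raddfD /= ImE addr0.
  have -> : Im (p%:~R * tau) = p%:~R * Im tau.
    by rewrite -(rmorph_int (real_complex R)); case: (tau) => a b /=;
       rewrite mul0r addr0.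
  by rewrite mulrDl mulfK // gt_eqF.
have c2 : coord2 tau (z + (p%:~R * tau + q%:~R)) = coord2 tau z + q%:~R.
  rewrite /coord2 c1 !raddfD /= ReE.
  have -> : Re (p%:~R * tau) = p%:~R * Re tau.
    by rewrite -(rmorph_int (real_complex R)); case: (tau) => a b /=;
       rewrite mul0r subr0.
  by rewrite mulrDl opprD; ring.
suff eT : EK_term k tau (z + (p%:~R * tau + q%:~R)) = EK_term k tau z.
  by rewrite /eisenstein /EK /EK_continuation eT.
apply/funext => s; apply/funext => -[m n]; rewrite /EK_term /=.
case: ifP => // _; congr (_ / _).
rewrite c1 c2 -[RHS](exp2piID_int _ (m * q - n * p)); congr (exp2piI _%:C).
by rewrite rmorphB !rmorphM /=; ring.
Qed.

Lemma eisenstein_torusE k tau z : upper_half_plane tau ->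
  eisenstein_torus k (\pi_(torus tau) z) = eisenstein k tau z.
Proof.
move=> tauH; rewrite /eisenstein_torus.
set z' := repr _.
have zz' : z' - z \in lattice tau.
  by rewrite (Quotient.idealrBE (lattice tau)) reprK.
by rewrite -[RHS](eisenstein_lattice _ _ tauH zz') addrC subrK.
Qed.

End EisensteinKronecker.

(* For P in the variables 'X and 'Y, P`_i`_j is the coefficient of
   'X^i * 'Y^j; E1 and E2 give the values of the weight-k series. *)
Definition bracket (K : comNzRingType) (E1 E2 : nat -> K)
    (P : {poly {poly K}}) : K :=
  \sum_(i < size P) \sum_(j < size P`_i) P`_i`_j * (E1 i.+1 * E2 j.+1).

Lemma bracketXY (K : comNzRingType) (E1 E2 : nat -> K) (i j : nat) :
  bracket E1 E2 ('X ^+ i * 'Y ^+ j) = E1 i.+1 * E2 j.+1.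
Proof.
rewrite -[(_ : {poly K})%:P ^+ j]rmorphXn /=.
have cE m : ('X ^+ i * ('X ^+ j)%:P : {poly {poly K}})`_m = if m == i then 'X^j else 0.
  by rewrite coefMC coefXn; case: eqP; rewrite ?mul1r ?mul0r.
have sz : size ('X ^+ i * ('X ^+ j)%:P : {poly {poly K}}) = i.+1.
  rewrite mulrC size_Mmonic ?monicXn ?polyC_eq0 ?monic_neq0 ?monicXn //.
  by rewrite size_polyXn size_polyC monic_neq0 ?monicXn.
rewrite /bracket sz big_ord_recr /= big1 ?add0r => [|m _]; last first.
  by rewrite cE ltn_eqF //= size_poly0 big_ord0.
rewrite cE eqxx size_polyXn big_ord_recr /= big1 ?add0r => [|m _]; last first.
  by rewrite coefXn ltn_eqF //= mul0r.
by rewrite coefXn eqxx mul1r.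
Qed.

Section Brackets.
Variable R : realType.
Local Notation C := R[i].

Definition torus_bracket (tau : C) (P : {poly {poly C}}) (u v : torus tau) : C :=
  bracket (fun k => eisenstein_torus k u) (fun k => eisenstein_torus k v) P.

(* For N >= 1 this is (Z/NZ)^2, trivial when N = 1. *)
Definition level_vect (N : nat) : zmodType := ('I_N.-1.+1 * 'I_N.-1.+1)%type.

Definition eisenstein_level (N k : nat) (a : level_vect N) (tau : C) : C :=
  eisenstein k tau (((a.1 : nat)%:R * tau + (a.2 : nat)%:R) / N%:R).

Lemma eisenstein_level_lift N k (a : level_vect N) (p q : int) (tau : C) :
  (0 < N)%N -> upper_half_plane tau ->
  (p = (a.1 : nat) %[mod N])%Z -> (q = (a.2 : nat) %[mod N])%Z ->
  eisenstein k tau ((p%:~R * tau + q%:~R) / N%:R) = eisenstein_level k a tau.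
Proof.
move=> N_gt0 tauH /eqP; rewrite eqz_mod_dvd => /dvdzP[r pE] /eqP.
rewrite eqz_mod_dvd => /dvdzP[s qE].
have N0 : N%:R != 0 :> C by rewrite pnatr_eq0 -lt0n.
rewrite -(subrK ((a.1 : nat) : int) p) pE -(subrK ((a.2 : nat) : int) q) qE.
rewrite /eisenstein_level.
have rsL : r%:~R * tau + s%:~R \in lattice tau by apply/asboolP; exists r, s.
rewrite -[RHS](eisenstein_lattice _ _ tauH rsL); congr (eisenstein k tau _).
rewrite !rmorphD !rmorphM /= -!pmulrn.
by field.
Qed.

Definition level_bracket (N : nat) (P : {poly {poly C}}) (a b : level_vect N)
    (tau : C) : C :=
  bracket (fun k => eisenstein_level k a tau)
          (fun k => eisenstein_level k b tau) P.

Definition SL2Z : set 'M[int]_2 := [set g | \det g = 1].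

Definition Gamma (N : nat) : set 'M[int]_2 :=
  [set g | SL2Z g /\ forall i j, (g i j = (1%:M : 'M[int]_2) i j %[mod N])%Z].

Definition automorphy (g : 'M[int]_2) (tau : C) : C :=
  (g 1 0)%:~R * tau + (g 1 1)%:~R.

Definition moebius (g : 'M[int]_2) (tau : C) : C :=
  ((g 0 0)%:~R * tau + (g 0 1)%:~R) / automorphy g tau.

Definition slash (k : nat) (g : 'M[int]_2) (f : C -> C) (tau : C) : C :=
  f (moebius g tau) / automorphy g tau ^+ k.

(* M_k(Gamma(N)); f matters only on the upper half-plane. The last clause says
   that at every cusp f is a holomorphic function of q = exp(2 pi i tau / N),
   extended to q = 0. *)
Definition modular_forms (k N : nat) : set (C -> C) :=
  [set f |
    [/\ holomorphic_on (@upper_half_plane R) f,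
        forall g tau, Gamma N g -> upper_half_plane tau ->
          slash k g f tau = f tau
      & forall g, SL2Z g -> exists2 F : C -> C,
          holomorphic_on [set q | `|q| < 1] F
        & forall tau, upper_half_plane tau ->
            slash k g f tau = F (exp2piI (tau / N%:R))]].

End Brackets.

Arguments modular_forms : clear implicits.

(* Main.v *)
From mathcomp Require Import ring lra zify.
Require Import Defs.

(** The lattice sum defining E^(k) is only conditionally convergent for small k.
    Multiplying a sum of chi(x) h(x), for a nontrivial character chi of the lattice,
    by a factor 1 - chi(l) replaces h(x) by the finite difference h(x) - h(x - l),
    which decays faster.  After enough differences everything converges absolutely;
    this yields the continuation in s and, at s = 0, an absolutely convergent sum
    for (1 - chi(l))^p K(tau, 0).

    The three-term relation is the partial fraction identity expressing
    A^-(k1+1) B^-(k2+1) through products of powers of (B - A, -A) and of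
    (-B, A - B), summed over pairs (A, B) of lattice vectors against the character
    chi_u(A) chi_v(B) and regularized in the same way: the unimodular substitutions
    (A, B) -> (B - A, -A) and (A, B) -> (-B, A - B) permute the characters of u, v, w.
    The pairs with A = 0, B = 0 or A = B contribute the series of weight k.

    For modularity, SL_2(Z) permutes the lattice together with the characters, and
    the absolutely convergent sums are holomorphic in tau by Weierstrass's theorem.
    They grow at most polynomially towards a cusp, so that as a function of
    q = exp(2 pi i tau / N) the series has a removable singularity at q = 0. *)

Set Implicit Arguments.
Unset Strict Implicit.
Unset Printing Implicit Defensive.

Local Open Scope classical_set_scope.
Local Open Scope complex_scope.
Local Open Scope ring_scope.

Local Notation Re := complex.Re.
Local Notation Im := complex.Im.
Local Notation nm := (@ComplexField.Normc.normc _).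
Arguments ComplexField.Normc.normc {R} : simpl never.

(** * Derivatives of complex functions *)

(** K(tau, 0) is the value of an entire function that is merely chosen, so a sum can be attached to
    it only through uniqueness of the continuation. Hence the identity theorem, and below it
    Goursat, Cauchy's formula on a square and Taylor expansions with explicit remainders; these
    remainders also give Weierstrass's theorem and the removable singularity. With 0^-1 = 0 the
    excluded index (0, 0) drops out of each lattice sum by itself, as k > 0; in exchange the partial
    fraction identity needs correction terms on the degenerate pairs, and these alone produce the
    right-hand side of the relation. At s = 0 two differences suffice: the terms then decay with
    exponent k + 2 > 2, and 2 is the rank of the lattice. Pairs of vectors need differences in
    several directions; these commute, so values regularized in different ways can be compared. The
    hypotheses u, v, w != 0 yield a vector l with chi(l) != 1, so that 1 - chi(l) can be divided
    out. The estimates are polynomial in one parameter T bounding |tau| and 1 / Im tau, so they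
    serve both holomorphy in tau and growth at the cusps. *)

Section Modulus.
Variable R : realType.
Local Notation C := R[i].
Implicit Types x y z : C.

Lemma Re_norm z : Re `|z| = nm z. Proof. by []. Qed.
Lemma norm_nm z : `|z| = (nm z)%:C. Proof. by []. Qed.
Lemma nm_ge0 z : 0 <= nm z. Proof. by case: z => a b; apply: sqrtr_ge0. Qed.
Lemma nm0 : nm (0 : C) = 0. Proof. exact: ComplexField.Normc.normc0. Qed.
Lemma nm1 : nm (1 : C) = 1. Proof. exact: ComplexField.Normc.normc1. Qed.
Lemma nmM x y : nm (x * y) = nm x * nm y. Proof. exact: ComplexField.Normc.normcM. Qed.
Lemma nmV x : nm x^-1 = (nm x)^-1. Proof. exact: ComplexField.Normc.normcV. Qed.
Lemma nmN x : nm (- x) = nm x. Proof. exact: normcN. Qed.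
Lemma nmB x y : nm (x - y) = nm (y - x). Proof. by rewrite -nmN opprB. Qed.
Lemma nmD x y : nm (x + y) <= nm x + nm y. Proof. exact: le_normcD. Qed.
Lemma nm_eq0 x : (nm x == 0) = (x == 0).
Proof.
by apply/eqP/eqP => [|->]; [exact: ComplexField.Normc.eq0_normc|exact: nm0].
Qed.
Lemma nm_gt0 x : (0 < nm x) = (x != 0).
Proof. by rewrite lt0r nm_ge0 andbT nm_eq0. Qed.
Lemma nmX x n : nm (x ^+ n) = nm x ^+ n.
Proof. by elim: n => [|n IH]; rewrite ?nm1 // !exprS nmM IH. Qed.
Lemma nm_real (a : R) : nm a%:C = `|a|.
Proof. by rewrite /ComplexField.Normc.normc /= expr0n addr0 sqrtr_sqr. Qed.
Lemma nm_nat n : nm (n%:R : C) = n%:R.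
Proof. by rewrite -(rmorph_nat (real_complex R)) nm_real ger0_norm. Qed.
Lemma nm_int (n : int) : nm (n%:~R : C) = `|n%:~R|.
Proof. by rewrite -(rmorph_int (real_complex R)) nm_real. Qed.
Lemma nm_i : nm ('i%C : C) = 1.
Proof. by rewrite /ComplexField.Normc.normc /= expr0n add0r expr1n sqrtr1. Qed.
Lemma nmJ x : nm (conjc x) = nm x.
Proof. by case: x => a b; rewrite /ComplexField.Normc.normc /= sqrrN. Qed.
Lemma nm_sqr x : nm x ^+ 2 = Re x ^+ 2 + Im x ^+ 2.
Proof.
by case: x => a b; rewrite /ComplexField.Normc.normc /= sqr_sqrtr // addr_ge0 // sqr_ge0.
Qed.
Lemma ReIm_nm (x : C) : (`|Re x| <= nm x) * (`|Im x| <= nm x).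
Proof.
by split; rewrite -(ler_pXn2r (n := 2)) ?nnegrE ?nm_ge0 // nm_sqr
  real_normK ?num_real // ?lerDl ?lerDr sqr_ge0.
Qed.
Lemma nm_ReIm x : nm x <= `|Re x| + `|Im x|.
Proof.
rewrite -(ler_pXn2r (n := 2)) ?nnegrE ?nm_ge0 ?addr_ge0 // nm_sqr.
rewrite sqrrD !real_normK ?num_real // addrAC lerDl mulrn_wge0 //.
Qed.
Lemma nm_small_eq x y : (forall e : R, 0 < e -> nm (x - y) <= e) -> x = y.
Proof.
move=> H; apply/eqP; rewrite -subr_eq0 -nm_eq0 eq_le nm_ge0 andbT.
by apply/ler_addgt0Pl => e /H; rewrite addr0.
Qed.
Lemma nm_sub_le x y : nm x - nm y <= nm (x - y).
Proof. by rewrite lerBlDr -{1}(subrK y x) nmD. Qed.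
Lemma nm_sum (I : Type) (r : seq I) (P : pred I) (F : I -> C) :
  nm (\sum_(i <- r | P i) F i) <= \sum_(i <- r | P i) nm (F i).
Proof.
elim/big_ind2: _ => [|x a y b xa yb|//]; first by rewrite nm0.
by rewrite (le_trans (nmD _ _)) // lerD.
Qed.
Lemma ReM x y : Re (x * y) = Re x * Re y - Im x * Im y.
Proof. by case: x y => a b []. Qed.
Lemma ImM x y : Im (x * y) = Re x * Im y + Im x * Re y.
Proof. by case: x y => a b [] c d /=. Qed.
Lemma ReB x y : Re (x - y) = Re x - Re y.
Proof. by case: x y => a b []. Qed.
Lemma ImB x y : Im (x - y) = Im x - Im y.
Proof. by case: x y => a b []. Qed.
Lemma complex_ext x y : Re x = Re y -> Im x = Im y -> x = y.
Proof. by case: x y => a b [c d] /= -> ->. Qed.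
End Modulus.

Section Derivative.
Variable R : realType.
Local Notation C := R[i].

(* The variable ranges over C (with i the identity) or over R (with i the
   embedding), so that both kinds of derivatives share one calculus. *)
Definition hasd (X : zmodType) (i : X -> C) (f : X -> C) (t : X) (d : C) :=
  forall e : R, 0 < e -> exists2 D : R, 0 < D &
    forall h, nm (i h) < D -> nm (f (t + h) - f t - i h * d) <= e * nm (i h).

Section Calculus.
Variables (X : zmodType) (i : X -> C).
Implicit Types (f g : X -> C) (t : X) (d : C).

Lemma hasd_cst t c : hasd i (fun=> c) t 0.
Proof.
by move=> e e0; exists 1 => // h _; rewrite subrr mulr0 subrr nm0 mulr_ge0 ?nm_ge0 // (ltW e0).
Qed.

Lemma hasd_eq f t d d' : hasd i f t d -> d = d' -> hasd i f t d'.
Proof. by move=> ? <-. Qed.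

Lemma hasd_near f g t d (r : R) : 0 < r ->
  (forall h, nm (i h) < r -> f (t + h) = g (t + h)) -> f t = g t ->
  hasd i f t d -> hasd i g t d.
Proof.
move=> r0 fg fgt H e /H[D D0 HD]; exists (Num.min D r); first by rewrite lt_min D0.
by move=> h; rewrite lt_min => /andP[hD hr]; rewrite -fg // -fgt HD.
Qed.

Lemma hasd_ext f g t d : f =1 g -> hasd i f t d -> hasd i g t d.
Proof. by move=> fg; apply: (@hasd_near _ _ _ _ 1). Qed.

Lemma hasdD f g t d d' : hasd i f t d -> hasd i g t d' ->
  hasd i (fun x => f x + g x) t (d + d').
Proof.
move=> Hf Hg e e0; have e2 : 0 < e / 2 by rewrite divr_gt0.
have [D D0 HD] := Hf _ e2; have [D' D'0 HD'] := Hg _ e2.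
exists (Num.min D D'); first by rewrite lt_min D0.
move=> h; rewrite lt_min => /andP[/HD h1 /HD' h2].
rewrite (_ : _ - _ - _ = (f (t + h) - f t - i h * d) + (g (t + h) - g t - i h * d')); last by ring.
by rewrite (le_trans (nmD _ _)) // (le_trans (lerD h1 h2)) // -mulrDl -splitr.
Qed.

Lemma hasd_bound f t d : hasd i f t d -> exists2 D : R, 0 < D &
  forall h, nm (i h) < D -> nm (f (t + h) - f t) <= (nm d + 1) * nm (i h).
Proof.
move=> /(_ 1 ltr01)[D D0 HD]; exists D => // h /HD h1.
rewrite -(subrK (i h * d) (f (t + h) - f t)) (le_trans (nmD _ _)) //.
by rewrite nmM mulrDl addrC lerD // mulrC.
Qed.

Definition conti f t := forall e : R, 0 < e -> exists2 d : R, 0 < d &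
  forall h, nm (i h) < d -> nm (f (t + h) - f t) < e.

Lemma conti_cst c t : conti (fun=> c) t.
Proof. by move=> e e0; exists 1 => // h _; rewrite subrr nm0. Qed.

Lemma contiD f g t : conti f t -> conti g t -> conti (fun x => f x + g x) t.
Proof.
move=> cf cg e e0; have e2 : 0 < e / 2 by rewrite divr_gt0.
have [d d0 Hd] := cf _ e2; have [d' d'0 Hd'] := cg _ e2.
exists (Num.min d d'); first by rewrite lt_min d0.
move=> h; rewrite lt_min => /andP[/Hd h1 /Hd' h2].
rewrite (_ : _ - _ = f (t + h) - f t + (g (t + h) - g t)); last by ring.
by apply: le_lt_trans (nmD _ _) _; lra.
Qed.

Lemma conti_near f g t (r : R) : 0 < r ->
  (forall h, nm (i h) < r -> f (t + h) = g (t + h)) -> f t = g t ->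
  conti f t -> conti g t.
Proof.
move=> r0 fg fgt H e /H[D D0 HD]; exists (Num.min D r); first by rewrite lt_min D0.
by move=> h; rewrite lt_min => /andP[hD hr]; rewrite -fg // -fgt HD.
Qed.

Lemma hasd_cont f t d : hasd i f t d -> conti f t.
Proof.
move=> /hasd_bound[D D0 HD] e e0.
have K0 : 0 < nm d + 1 by rewrite ltr_wpDl ?nm_ge0.
exists (Num.min D (e / (nm d + 1))); first by rewrite lt_min D0 divr_gt0.
move=> h; rewrite lt_min => /andP[/HD h1 h2].
by rewrite (le_lt_trans h1) // mulrC -ltr_pdivlMr.
Qed.

Lemma hasdM f g t d d' : hasd i f t d -> hasd i g t d' ->
  hasd i (fun x => f x * g x) t (d * g t + f t * d').
Proof.
move=> Hf Hg e e0; pose K := nm (f t) + nm (g t) + nm d + 1.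
have K1 : 1 <= K by rewrite /K lerDr !addr_ge0 ?nm_ge0.
have K0 : 0 < K by exact: lt_le_trans K1.
have e3 : 0 < e / (3 * K) by rewrite divr_gt0 // mulr_gt0.
have [D D0 HD] := Hf _ e3; have [D' D'0 HD'] := Hg _ e3.
have [D1 D10 HD1] := hasd_bound Hf.
have [D2 D20 HD2] := hasd_cont Hg e3.
exists (Num.min (Num.min D D') (Num.min D1 D2)); first by rewrite !lt_min D0 D'0 D10.
move=> h; rewrite !lt_min => /andP[/andP[/HD h1 /HD' h2] /andP[/HD1 h3 /HD2 h4]].
rewrite (_ : _ - _ - _ = (f (t + h) - f t - i h * d) * g t
   + f t * (g (t + h) - g t - i h * d')
   + (f (t + h) - f t) * (g (t + h) - g t)); last by ring.
rewrite (le_trans (nmD _ _)) // (le_trans (lerD (nmD _ _) (lexx _))) // !nmM.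
have Kb : [/\ nm (f t) <= K, nm (g t) <= K & nm d + 1 <= K].
  have := nm_ge0 (f t); have := nm_ge0 (g t); have := nm_ge0 d.
  by rewrite /K; split; lra.
have n0 := nm_ge0 (i h); have eK : e / (3 * K) * K = e / 3.
  by field; rewrite gt_eqF.
have -> : e * nm (i h) = e / 3 * nm (i h) + e / 3 * nm (i h) + e / 3 * nm (i h) by field.
rewrite -eK !lerD //.
- rewrite [leRHS]mulrAC; apply: ler_pM; rewrite ?nm_ge0 //; by case: Kb.
- rewrite mulrC [leRHS]mulrAC; apply: ler_pM; rewrite ?nm_ge0 //; by case: Kb.
- rewrite -mulrA mulrC; apply: ler_pM; rewrite ?nm_ge0 //; first exact: ltW.
  apply: le_trans h3 _; apply: ler_wpM2r => //; by case: Kb.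
Qed.

Lemma hasdN f t d : hasd i f t d -> hasd i (fun x => - f x) t (- d).
Proof.
move=> /(hasdM (hasd_cst t (-1))) H; apply: hasd_ext (hasd_eq H _).
  by move=> x; rewrite mulN1r.
by rewrite mul0r add0r mulN1r.
Qed.

Lemma hasdB f g t d d' : hasd i f t d -> hasd i g t d' ->
  hasd i (fun x => f x - g x) t (d - d').
Proof. by move=> Hf /hasdN; apply: hasdD. Qed.

Lemma hasdZ c f t d : hasd i f t d -> hasd i (fun x => c * f x) t (c * d).
Proof. by move=> /(hasdM (hasd_cst t c)) H; apply: hasd_eq H _; rewrite mul0r add0r. Qed.

Lemma hasdX f t d n : hasd i f t d ->
  hasd i (fun x => f x ^+ n) t (n%:R * f t ^+ n.-1 * d).
Proof.
move=> H; elim: n => [|n IH]; first by rewrite !mul0r; apply: hasd_cst.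
apply: hasd_ext (hasd_eq (hasdM H IH) _) => [x|]; first by rewrite exprS.
case: n {IH} => [|n] /=; first by rewrite !expr0; ring.
by rewrite exprS -!natr1; ring.
Qed.

Lemma hasd_comp (F : C -> C) f t d d' : hasd id F (f t) d -> hasd i f t d' ->
  hasd i (fun x => F (f x)) t (d * d').
Proof.
move=> HF Hf e e0; pose K := nm d + nm d' + 1.
have K0 : 0 < K by rewrite ltr_wpDl // addr_ge0 ?nm_ge0.
have e2 : 0 < e / (2 * K) by rewrite divr_gt0 // mulr_gt0.
have [D D0 HD] := HF _ e2; have [D' D'0 HD'] := Hf _ e2.
have [D1 D10 HD1] := hasd_bound Hf.
have [D2 D20 HD2] := hasd_cont Hf D0.
exists (Num.min D' (Num.min D1 D2)); first by rewrite !lt_min D'0 D10.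
move=> h; rewrite !lt_min => /andP[/HD' h1 /andP[/HD1 h2 /HD2/HD]].
rewrite /= subrKC => h3.
rewrite (_ : _ - _ - _ = (F (f (t + h)) - F (f t) - (f (t + h) - f t) * d)
    + (f (t + h) - f t - i h * d') * d); last by ring.
rewrite (le_trans (nmD _ _)) // nmM.
have n0 := nm_ge0 (i h); have eK : e / (2 * K) * K = e / 2.
  by field; rewrite gt_eqF.
have Kb : [/\ nm d <= K & nm d' + 1 <= K].
  by have := nm_ge0 d'; have := nm_ge0 d; rewrite /K; split; lra.
have -> : e * nm (i h) = e / 2 * nm (i h) + e / 2 * nm (i h) by field.
rewrite -eK lerD //.
  apply: le_trans h3 _; rewrite -!mulrA ler_wpM2l ?(ltW e0) // ler_wpM2l //.
    by rewrite invr_ge0 mulr_ge0 // ltW.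
  by apply: le_trans h2 _; rewrite ler_wpM2r //; case: Kb.
rewrite [leRHS]mulrAC; apply: ler_pM; rewrite ?nm_ge0 //; by case: Kb.
Qed.

End Calculus.

Lemma hasd_id (t : C) : hasd id id t 1.
Proof.
by move=> e e0; exists 1 => // h _; rewrite /= mulr1 (addrC t) addrK subrr nm0 mulr_ge0 ?nm_ge0 // (ltW e0).
Qed.

Lemma hasd_real (t : R) : hasd (real_complex R) (real_complex R) t 1.
Proof.
move=> e e0; exists 1 => // h _.
by rewrite rmorphD mulr1 (addrC t%:C) addrK subrr nm0 mulr_ge0 ?nm_ge0 // (ltW e0).
Qed.

Lemma hasdV (z : C) : z != 0 -> hasd id GRing.inv z (- z ^- 2).
Proof.
move=> z0 e e0; have n0 : 0 < nm z by rewrite nm_gt0.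
exists (Num.min (nm z / 2) (e * nm z ^+ 3 / 2)).
  by rewrite lt_min !divr_gt0 // mulr_gt0 // exprn_gt0.
move=> h; rewrite lt_min /= => /andP[h1 h2].
have zh : nm z / 2 <= nm (z + h).
  have := nm_sub_le z (- h); rewrite opprK nmN; lra.
have zh0 : z + h != 0 by rewrite -nm_gt0 (lt_le_trans _ zh) // divr_gt0.
rewrite (_ : _ - _ - _ = h * (h / (z ^+ 2 * (z + h)))); last by field; rewrite zh0 z0.
rewrite nmM mulrC ler_wpM2r ?nm_ge0 // nmM nmV nmM nmX ler_pdivrMr; last first.
  by rewrite mulr_gt0 ?exprn_gt0 // nm_gt0.
apply: le_trans (ltW h2) _; rewrite -mulrA ler_wpM2l ?(ltW e0) //.
by rewrite exprSr -mulrA ler_wpM2l // exprn_ge0 // ltW.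
Qed.

Lemma conti_comp (X : zmodType) (i : X -> C) (F : C -> C) (f : X -> C) t d :
  hasd id F (f t) d -> conti i f t -> conti i (fun x => F (f x)) t.
Proof.
move=> HF cf e e0; have [d1 d10 H1] := hasd_cont HF e0; have [d2 d20 H2] := cf _ d10.
by exists d2 => // h /H2/H1; rewrite subrKC.
Qed.

Lemma contiV (X : zmodType) (i : X -> C) (f : X -> C) t : f t != 0 -> conti i f t ->
  conti i (fun x => (f x)^-1) t.
Proof. by move=> /hasdV; exact: conti_comp. Qed.

(** Polarization: f g = ((f + g)^2 - (f - g)^2) / 4, so only sums and the differentiable maps z -> c
    z and z -> z^2 are needed. *)
Lemma contiM (X : zmodType) (i : X -> C) (f g : X -> C) t : conti i f t -> conti i g t ->
  conti i (fun x => f x * g x) t.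
Proof.
move=> cf cg; have Z c (h : X -> C) : conti i h t -> conti i (fun x => c * h x) t.
  exact: conti_comp (hasdZ c (hasd_id _)).
have S (h : X -> C) : conti i h t -> conti i (fun x => h x ^+ 2) t.
  exact: conti_comp (hasdX 2 (hasd_id _)).
have H := contiD (S _ (contiD cf cg)) (Z (-1) _ (S _ (contiD cf (Z (-1) _ cg)))).
apply: (conti_near (r := 1) _ _ _ (Z (4^-1) _ H)) => // [h _|]; by field.
Qed.

(** In the order of R[i] a positive element is real; this converts the complex radii of the topology
    on [C^o] into the real ones of [hasd]. *)
Lemma cball (e : C) : 0 < e -> 0 < Re e /\ e = (Re e)%:C.
Proof.
rewrite ltcE /= => /andP[/eqP e0 ->]; split => //.
by apply: complex_ext.
Qed.

Lemma ltC_nm (x : C) (e : C) : 0 < e -> (`|x| < e) = (nm x < Re e).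
Proof. by move=> /cball[_ ->]; rewrite norm_nm ltcR. Qed.

Lemma leC_nm (x : C) (e : C) : 0 < e -> (`|x| <= e) = (nm x <= Re e).
Proof. by move=> /cball[_ ->]; rewrite norm_nm lecR. Qed.

Lemma hasdP (f : C -> C) z :
  derivable (f : C^o -> C^o) z 1 <-> (exists d, hasd id f z d).
Proof.
split=> [/cvg_ex[d /cvgrPdist_le H]|[d H]].
  exists d => e e0; have eC : (0 : C) < e%:C by rewrite ltcR.
  have := H _ eC; move=> /nbhs_ballP[D D0 HD].
  have [D0' DE] := cball D0; exists (Re D) => // h hD.
  have [->|h0] := eqVneq h 0; first by rewrite addr0 mul0r subr0 subrr nm0 mulr0.
  have := HD h; rewrite /ball /= sub0r normrN ltC_nm // => /(_ hD h0).
  rewrite /GRing.scale /= mulr1 norm_nm lecR => Hh.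
  have -> : f (z + h) - f z - h * d = - (h * (d - h^-1 * (f (h + z) - f z))).
    by rewrite (addrC h z); field.
  by rewrite nmN nmM mulrC ler_wpM2r ?nm_ge0.
apply/cvg_ex; exists d; apply/cvgrPdist_le => e e0.
have [e0' eE] := cball e0.
have [D D0 HD] := H _ e0'.
apply/nbhs_ballP; exists D%:C => /=; first by rewrite ltcR.
move=> h; rewrite /ball /= sub0r normrN norm_nm ltcR => /HD Hh h0.
rewrite /GRing.scale /= mulr1 leC_nm //.
have -> : d - h^-1 * (f (h + z) - f z) = - (h^-1 * (f (z + h) - f z - h * d)).
  by rewrite (addrC h z); field.
by rewrite nmN nmM nmV mulrC ler_pdivrMr ?nm_gt0.
Qed.

Lemma rhasdP (f : R -> R) (t : R) (d : R) :
  is_derive t 1 f d <-> hasd (real_complex R) (fun x => (f x)%:C) t d%:C.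
Proof.
have E (l : R) h : (f (t + h))%:C - (f t)%:C - h%:C * l%:C = (f (t + h) - f t - h * l)%:C :> C.
  by rewrite !rmorphB rmorphM.
split=> [[df <-] e e0|H].
  have := df; rewrite /derivable /= => /cvg_ex[l Hl].
  have lE : 'D_1 f t = l by apply: cvg_lim Hl; exact: Rhausdorff.
  rewrite lE; move/cvgrPdist_le: Hl => /(_ _ e0).
  move=> /nbhs_ballP[D D0 HD]; exists D => // h.
  rewrite E !nm_real => hD.
  have [->|h0] := eqVneq h 0; first by rewrite addr0 mul0r subr0 subrr normr0 mulr0.
  have := HD h; rewrite /ball /= sub0r normrN => /(_ hD h0).
  rewrite /GRing.scale /= mulr1 => Hh.
  have -> : f (t + h) - f t - h * l = - (h * (l - h^-1 * (f (h + t) - f t))).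
    by rewrite (addrC h t); field.
  by rewrite normrN normrM mulrC ler_wpM2r.
have Hl : (fun h : R => h^-1 *: (f (h *: 1 + t) - f t)) @ 0^' --> d.
  apply/cvgrPdist_le => e e0; have [D D0 HD] := H _ e0.
  apply/nbhs_ballP; exists D => //= h.
  rewrite /ball /= sub0r normrN -nm_real => /HD; rewrite E !nm_real => Hh h0.
  rewrite /GRing.scale /= mulr1.
  have -> : d - h^-1 * (f (h + t) - f t) = - (h^-1 * (f (t + h) - f t - h * d)).
    by rewrite (addrC h t); field.
  by rewrite normrN normrM normrV ?unitfE // mulrC ler_pdivrMr ?normr_gt0.
by apply: DeriveDef; [apply/cvg_ex; exists d|apply: cvg_lim Hl; exact: Rhausdorff].
Qed.

Lemma rhasd_ReIm (f : R -> C) (t : R) (d : C) :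
  hasd (real_complex R) f t d <->
  is_derive t 1 (fun x => Re (f x)) (Re d) /\ is_derive t 1 (fun x => Im (f x)) (Im d).
Proof.
split=> [H|[/rhasdP H1 /rhasdP H2]].
  split; apply/rhasdP => e e0; have [D D0 HD] := H _ e0; exists D => // h /HD; apply: le_trans.
    rewrite -rmorphM -!rmorphB nm_real.
    have -> : Re (f (t + h)) - Re (f t) - h * Re d = Re (f (t + h) - f t - h%:C * d).
      by case: (f (t + h)) (f t) d {H HD} => ? ? [? ?] [? ?] /=; rewrite mul0r subr0.
    by rewrite ReIm_nm.
  rewrite -rmorphM -!rmorphB nm_real.
  have -> : Im (f (t + h)) - Im (f t) - h * Im d = Im (f (t + h) - f t - h%:C * d).
    by case: (f (t + h)) (f t) d {H HD} => ? ? [? ?] [? ?] /=; rewrite mul0r addr0.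
  by rewrite ReIm_nm.
have := hasdD H1 (hasdZ 'i%C H2); rewrite -complexE; apply: hasd_ext => x.
by rewrite -complexE.
Qed.

(** There is no mean value equality for complex values; the real theorem is applied to Re and Im
    separately, and adding the two estimates costs the factor 2. *)
Lemma mvt_le (f f' : R -> C) (a b M : R) : a <= b ->
  (forall t, a <= t <= b -> hasd (real_complex R) f t (f' t)) ->
  (forall t, a <= t <= b -> nm (f' t) <= M) ->
  nm (f b - f a) <= 2 * M * (b - a).
Proof.
move=> ab Hf HM.
have key (P : C -> R) : (forall t, a <= t <= b ->
     is_derive t 1 (fun x => P (f x)) (P (f' t))) ->
     (forall z, `|P z| <= nm z) -> `|P (f b) - P (f a)| <= M * (b - a).
  move=> HP HPn; have [||c cab ->] := @MVT_segment R (fun x => P (f x)) (fun t => P (f' t)) a b ab.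
  - by move=> x; rewrite in_itv /= => /andP[ax xb]; apply: HP; rewrite !ltW.
  - apply: derivable_within_continuous => x; rewrite in_itv /= => xab.
    by have [] := HP x xab.
  - rewrite normrM (ger0_norm (_ : 0 <= b - a)) ?subr_ge0 // ler_wpM2r ?subr_ge0 //.
    by rewrite (le_trans (HPn _)) // HM //; move: cab; rewrite in_itv.
apply: le_trans (nm_ReIm _) _; rewrite -mulrA mulr_natl mulr2n lerD //.
  rewrite ReB; apply: (key (@complex.Re R)) => [t /Hf/rhasd_ReIm[]//|z].
  by rewrite ReIm_nm.
rewrite ImB; apply: (key (@complex.Im R)) => [t /Hf/rhasd_ReIm[]//|z]; by rewrite ReIm_nm.
Qed.

Lemma mvt_sym (f f' : R -> C) (a b M : R) :
  (forall t, Num.min a b <= t <= Num.max a b -> hasd (real_complex R) f t (f' t)) ->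
  (forall t, Num.min a b <= t <= Num.max a b -> nm (f' t) <= M) ->
  nm (f b - f a) <= 2 * M * `|b - a|.
Proof.
have [ab|ba] := leP a b => Hf HM.
  by rewrite ger0_norm ?subr_ge0 //; apply: (mvt_le ab Hf).
by rewrite nmB distrC ger0_norm ?subr_ge0 ?(ltW ba) //; apply: (mvt_le (ltW ba) Hf).
Qed.

End Derivative.

(** * The complex exponential and its derivative *)

Section ComplexExponential.
Variable R : realType.
Local Notation C := R[i].
Implicit Types x y z : C.

Lemma expCD x y : expC (x + y) = expC x * expC y.
Proof.
rewrite /expC !raddfD /= expRD cosD sinD rmorphM.
rewrite mulrACA; congr (_ * _); apply: complex_ext; rewrite ?ReM ?ImM /=; ring.
Qed.

Lemma expC0 : expC (0 : C) = 1.
Proof. by rewrite /expC /= expR0 cos0 sin0 mul1r. Qed.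

Lemma nm_expC z : nm (expC z) = expR (Re z).
Proof.
rewrite /expC nmM nm_real ger0_norm ?expR_ge0 //.
by rewrite /ComplexField.Normc.normc cos2Dsin2 sqrtr1 mulr1.
Qed.

Lemma expC_neq0 z : expC z != 0.
Proof. by rewrite -nm_gt0 nm_expC expR_gt0. Qed.

Lemma expCN z : expC (- z) = (expC z)^-1.
Proof.
apply: (mulIf (expC_neq0 z)); rewrite -expCD addrC subrr expC0.
by rewrite mulVf ?expC_neq0.
Qed.

Lemma expC_real (a : R) : expC a%:C = (expR a)%:C.
Proof. by rewrite /expC /= cos0 sin0 mulr1. Qed.

(** The derivative at 0 is assembled from the real derivatives of t -> exp t and t -> exp(i t); the
    addition formula then carries it to every z. *)
Lemma hasd_expC z : hasd id (@expC R) z (expC z).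
Proof.
have px : hasd (real_complex R) (fun t => expC t%:C) 0 1.
  apply: hasd_ext (hasd_eq (proj1 (rhasdP _ _ _) (is_derive_expR 0)) _) => [t|].
    by rewrite expC_real.
  by rewrite expR0.
have py : hasd (real_complex R) (fun t => expC ('i%C * t%:C)) 0 'i%C.
  apply: (hasd_ext (f := fun t => cos t +i* sin t)) => [t|].
    have -> : 'i%C * t%:C = 0 +i* t by apply: complex_ext; rewrite ?ReM ?ImM /=; ring.
    by rewrite /expC /= expR0 mul1r.
  apply/rhasd_ReIm => /=; split.
    by rewrite -[0 in X in is_derive _ _ _ X]oppr0 -{2}sin0; exact: is_derive_cos.
  by rewrite -[1 in X in is_derive _ _ _ X]cos0; exact: is_derive_sin.
have H0 : hasd id (@expC R) 0 1.
  move=> e e0; pose e' := Num.min 1 (e / 4).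
  have e'0 : 0 < e' by rewrite lt_min ltr01 divr_gt0.
  have [e'1 e'e] : e' <= 1 /\ e' <= e / 4 by rewrite !ge_min !lexx orbT.
  have [d d0 Hd] := px _ e'0; have [d' d'0 Hd'] := py _ e'0.
  exists (Num.min (e / 8) (Num.min d d')); first by rewrite !lt_min d0 d'0 divr_gt0.
  move=> h; rewrite !lt_min add0r expC0 => /and3P[h8 hd hd'].
  have n0 := nm_ge0 h; have e'h : e' * nm h <= nm h by rewrite ler_piMl.
  have e'h' : e' * nm h <= e / 4 * nm h by rewrite ler_wpM2r.
  pose u := expC (Re h)%:C - 1; pose v := expC ('i%C * (Im h)%:C) - 1.
  have U : nm (u - (Re h)%:C) <= e' * nm h.
    have rh := (ReIm_nm h).1; have := Hd (Re h); rewrite add0r expC0 mulr1 nm_real.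
    by move=> /(_ (le_lt_trans rh hd)) /le_trans; apply; rewrite ler_wpM2l // ltW.
  have V : nm (v - 'i%C * (Im h)%:C) <= e' * nm h.
    have ih := (ReIm_nm h).2; have := Hd' (Im h); rewrite add0r rmorph0 mulr0 expC0 (mulrC _%:C) nm_real.
    by move=> /(_ (le_lt_trans ih hd')) /le_trans; apply; rewrite ler_wpM2l // ltW.
  have U2 : nm u <= 2 * nm h.
    by have := nm_sub_le u (Re h)%:C; rewrite nm_real; have := (ReIm_nm h).1; lra.
  have V2 : nm v <= 2 * nm h.
    have := nm_sub_le v ('i%C * (Im h)%:C); rewrite nmM nm_i mul1r nm_real.
    by have := (ReIm_nm h).2; lra.
  (* With exp h = (1 + u)(1 + v), the cross term u v is quadratic in h, and the other two terms are
     the errors of the two one-variable derivatives. *)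
  have -> : expC h - 1 - id h * 1 = u * v + (u - (Re h)%:C) + (v - 'i%C * (Im h)%:C).
    by rewrite {1 2}(complexE h) expCD /u /v; ring.
  apply: le_trans (nmD _ _) _; have := nmD (u * v) (u - (Re h)%:C); rewrite nmM.
  have := ler_pM (nm_ge0 u) (nm_ge0 v) U2 V2.
  have : nm h * nm h <= e / 8 * nm h by rewrite ler_wpM2r // ltW.
  lra.
move=> e e0; have e1 : 0 < e / nm (expC z) by rewrite divr_gt0 // nm_gt0 expC_neq0.
have [D D0 HD] := H0 _ e1; exists D => // h /= /HD.
rewrite add0r expC0 expCD mulr1 => Hh.
have -> : expC z * expC h - expC z - h * expC z = expC z * (expC h - 1 - h) by ring.
by rewrite nmM mulrC -ler_pdivlMr ?nm_gt0 ?expC_neq0 // mulrAC.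
Qed.

End ComplexExponential.

(** * Line integrals *)

Section LineIntegral.
Variable R : realType.
Local Notation C := R[i].
Local Notation rderiv := (hasd (real_complex R)).

(** The fundamental theorem gives a primitive to the right of each point -(n + 1). Where two of them
    are defined they differ by a constant, so after subtracting their values at 0 they glue. *)
Lemma antiderivative (f : R -> R) : continuous f ->
  exists F : R -> R, forall x : R, is_derive x 1 F (f x).
Proof.
move=> cf; pose F n y : R := (\int[lebesgue_measure]_(t in `[- n.+1%:R, y]) f t)%R.
have HF n (x : R) : - n.+1%:R < x -> is_derive x 1 (F n) (f x).
  move=> nx; have xx : x < x + 1 by rewrite ltrDl.
  have [|dF F'] := @continuous_FTC1_closed R f (- n.+1%:R) x (x + 1) xx _ nx (cf x).
    apply: continuous_compact_integrable; first exact: segment_compact.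
    exact: continuous_subspaceT.
  by apply: DeriveDef; [exact: dF|rewrite -derive1E; exact: F'].
clearbody F; have key n m x : `|x| < n.+1%:R -> (n <= m)%N -> F m x - F m 0 = F n x - F n 0.
  move=> xn nm; have nmR : (n.+1%:R : R) <= m.+1%:R by rewrite ler_nat.
  have n0 : (0 : R) < n.+1%:R by [].
  have btw t : Num.min 0 x <= t <= Num.max 0 x -> - n.+1%:R < t.
    by move: xn; rewrite ltr_norml; case: (leP 0 x) => ? /andP[? ?] /andP[? ?]; lra.
  have := @mvt_sym _ (fun t => (F m t)%:C - (F n t)%:C) (fun t => 0) 0 x 0.
  rewrite mulr0 mul0r => H; apply/eqP; rewrite -subr_eq0 -(inj_eq (@complexI R)) -nm_eq0.
  rewrite eq_le nm_ge0 andbT.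
  rewrite (_ : (_ - _)%:C = (F m x)%:C - (F n x)%:C - ((F m 0)%:C - (F n 0)%:C)); last by rewrite !rmorphB /=; ring.
  apply: H => t /btw ht; last by rewrite nm0.
  have d1 : rderiv (fun y => (F m y)%:C) t (f t)%:C.
    by apply/rhasdP/HF; apply: le_lt_trans ht; rewrite lerN2.
  have d2 : rderiv (fun y => (F n y)%:C) t (f t)%:C by exact/rhasdP/HF.
  exact: hasd_eq (hasdB d1 d2) (subrr _).
pose G x := F (Num.truncn `|x|) x - F (Num.truncn `|x|) 0.
(* One more than the truncation of |x|, so that the single primitive [F m] computes [G] on the whole
   interval of radius 1 about x. *)
exists G => x; apply/rhasdP; pose m := (Num.truncn `|x|).+1.
have nx : `|x| < m%:R by rewrite real_truncnS_gt ?num_real.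
have GE y : `|y - x| < 1 -> G y = F m y - F m 0.
  move=> yx; have n1 : `|y| < (Num.truncn `|y|).+1%:R by rewrite real_truncnS_gt ?num_real.
  rewrite /G -(key _ m) // -ltnS truncn_lt_nat //.
  have := ler_normD (y - x) x; rewrite subrK -natr1; lra.
apply: (@hasd_near _ _ _ (fun y => (F m y)%:C - (F m 0)%:C) _ _ _ 1) => //.
- by move=> h; rewrite nm_real => h1; rewrite GE ?rmorphB // addrC addKr.
- by rewrite GE ?subrr ?normr0 // rmorphB.
- rewrite -[(f x)%:C]subr0; apply: hasdB; last exact: hasd_cst.
  apply/rhasdP/HF; move: nx; rewrite ltr_norml => /andP[+ _]; apply: lt_trans.
  by rewrite ltrN2 ltr_nat.
Qed.

Definition rcont (f : R -> C) := forall t, conti (real_complex R) f t.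

Lemma rcontP f : rcont f <-> forall t (e : R), 0 < e ->
  exists2 d : R, 0 < d & forall h : R, `|h| < d -> nm (f (t + h) - f t) < e.
Proof.
by split=> H t e e0; have [d d0 Hd] := H t e e0; exists d => // h hd;
  apply: Hd; move: hd; rewrite nm_real.
Qed.

Lemma rcont_antiderivative (f : R -> C) : rcont f ->
  exists F : R -> C, forall t, rderiv F t (f t).
Proof.
move=> /rcontP cf.
have cP (P : C -> R) : (forall x y, P (x - y) = P x - P y) ->
    (forall z, `|P z| <= nm z) -> continuous (fun t => P (f t)).
  move=> PB Pn t; apply/cvgrPdist_lt => e e0.
  have [d d0 Hd] := cf t e e0; apply/nbhs_ballP; exists d => //= y.
  rewrite /ball /= distrC => /Hd; rewrite subrKC => /(le_lt_trans (Pn _)).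
  by rewrite PB distrC.
have [F1 H1] := antiderivative (cP (@complex.Re R) (@ReB R) (fun z => (ReIm_nm z).1)).
have [F2 H2] := antiderivative (cP (@complex.Im R) (@ImB R) (fun z => (ReIm_nm z).2)).
by exists (fun t => F1 t +i* F2 t) => t; apply/rhasd_ReIm; split; [exact: H1|exact: H2].
Qed.

Definition antider (f : R -> C) : R -> C :=
  xget (fun=> 0) [set F | forall t, rderiv F t (f t)].

Lemma antiderP (f : R -> C) t : rcont f -> rderiv (antider f) t (f t).
Proof.
move=> /rcont_antiderivative[F HF]; rewrite /antider.
by case: xgetP => [G _ HG|/(_ F)]; [exact: HG|case].
Qed.

(** The increment of a globally chosen primitive: additivity in the endpoints then needs no order
    between them. *)
Definition lint (f : R -> C) (a b : R) : C := antider f b - antider f a.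

Lemma lintE (f F : R -> C) a b : a <= b -> rcont f ->
  (forall t, a <= t <= b -> rderiv F t (f t)) -> lint f a b = F b - F a.
Proof.
move=> ab cf HF.
have := @mvt_le _ (fun t => antider f t - F t) (fun=> 0) a b 0 ab.
rewrite mulr0 mul0r => H; apply/eqP; rewrite -subr_eq0 -nm_eq0 eq_le nm_ge0 andbT.
rewrite (_ : lint f a b - _ = antider f b - F b - (antider f a - F a)); last by rewrite /lint; ring.
apply: H => t ht; last by rewrite nm0.
by rewrite -(subrr (f t)); apply: hasdB; [exact: antiderP|exact: HF].
Qed.

Lemma lint_split f a m b : lint f a b = lint f a m + lint f m b.
Proof. by rewrite /lint; ring. Qed.

Lemma lint_le f a b M : a <= b -> rcont f ->
  (forall t, a <= t <= b -> nm (f t) <= M) -> nm (lint f a b) <= 2 * M * (b - a).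
Proof. by move=> ab cf; apply: mvt_le => // t _; exact: antiderP. Qed.

Lemma lint_lin f g c a b : a <= b -> rcont f -> rcont g -> rcont (fun t => f t + c * g t) ->
  lint (fun t => f t + c * g t) a b = lint f a b + c * lint g a b.
Proof.
move=> ab cf cg cfg.
rewrite (lintE ab cfg (F := fun t => antider f t + c * antider g t)); first by rewrite /lint; ring.
by move=> t _; apply: hasdD; [exact: antiderP|apply: hasdZ; exact: antiderP].
Qed.

Lemma eq_lint f g a b : a <= b -> rcont f -> rcont g ->
  (forall t, a <= t <= b -> f t = g t) -> lint f a b = lint g a b.
Proof. by move=> ab cf cg fg; apply: lintE => // t ht; rewrite fg //; exact: antiderP. Qed.

Lemma rcont_cst c : rcont (fun=> c).
Proof. by move=> t; exact: conti_cst. Qed.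

Lemma rcontD f g : rcont f -> rcont g -> rcont (fun t => f t + g t).
Proof. by move=> cf cg t; exact: contiD. Qed.

Lemma rcontM f g : rcont f -> rcont g -> rcont (fun t => f t * g t).
Proof. by move=> cf cg t; exact: contiM. Qed.

Lemma rcontV f : (forall t, f t != 0) -> rcont f -> rcont (fun t => (f t)^-1).
Proof. by move=> f0 cf t; exact: contiV. Qed.

Lemma rcont_bounded f a b : a <= b -> rcont f ->
  exists M, forall t, a <= t <= b -> nm (f t) <= M.
Proof.
move=> ab /rcontP cf; have [|c _ Hc] := @EVT_max R (fun t => nm (f t)) a b ab.
  apply: continuous_subspaceT => t; apply/cvgrPdist_lt => e e0.
  have [d d0 Hd] := cf t e e0; apply/nbhs_ballP; exists d => //= y.
  rewrite /ball /= distrC => /Hd; rewrite subrKC; apply: le_lt_trans.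
  have := nm_sub_le (f t) (f y); have := nm_sub_le (f y) (f t).
  by rewrite (nmB (f t)) ler_norml => ? ?; apply/andP; split; lra.
by exists (nm (f c)) => t ht; apply: Hc; rewrite in_itv.
Qed.

End LineIntegral.

(** * Goursat's theorem *)

Section Goursat.
Variable R : realType.
Local Notation C := R[i].
Local Notation rderiv := (hasd (real_complex R)).
Implicit Types (f g : C -> C) (a b c d : R).

Definition hline f (y : R) : R -> C := fun t => f (t%:C + 'i%C * y%:C).
Definition vline f (x : R) : R -> C := fun t => f (x%:C + 'i%C * t%:C).

(** The integral of f(z) dz counterclockwise around the boundary of [a, b] x [c, d]; dz is dt on
    horizontal sides and i dt on vertical ones. *)
Definition rect f a b c d : C :=
  lint (hline f c) a b + 'i%C * lint (vline f b) c d
  - lint (hline f d) a b - 'i%C * lint (vline f a) c d.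

Lemma rect_splitx f a m b c d : rect f a b c d = rect f a m c d + rect f m b c d.
Proof. by rewrite /rect (lint_split (hline f c) a m b) (lint_split (hline f d) a m b); ring. Qed.

Lemma rect_splity f a b c m d : rect f a b c d = rect f a b c m + rect f a b m d.
Proof. by rewrite /rect (lint_split (vline f a) c m d) (lint_split (vline f b) c m d); ring. Qed.

Definition bcont f a b c d :=
  [/\ rcont (hline f c), rcont (hline f d), rcont (vline f a) & rcont (vline f b)].

Lemma rect_le f a b c d M : a <= b -> c <= d -> bcont f a b c d ->
  (forall t, a <= t <= b -> nm (hline f c t) <= M /\ nm (hline f d t) <= M) ->
  (forall t, c <= t <= d -> nm (vline f a t) <= M /\ nm (vline f b t) <= M) ->
  nm (rect f a b c d) <= 4 * M * ((b - a) + (d - c)).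
Proof.
move=> ab cd [h1 h2 h3 h4] Hh Hv; rewrite /rect.
have k1 := lint_le ab h1 (fun t ht => (Hh t ht).1).
have k2 := lint_le ab h2 (fun t ht => (Hh t ht).2).
have k3 := lint_le cd h3 (fun t ht => (Hv t ht).1).
have k4 := lint_le cd h4 (fun t ht => (Hv t ht).2).
apply: le_trans (nmD _ _) _; rewrite nmN nmM nm_i mul1r.
have := nmD (lint (hline f c) a b + 'i%C * lint (vline f b) c d) (- lint (hline f d) a b).
have := nmD (lint (hline f c) a b) ('i%C * lint (vline f b) c d).
rewrite nmN nmM nm_i mul1r; lra.
Qed.

Lemma rect_lin f g k a b c d : a <= b -> c <= d -> bcont f a b c d -> bcont g a b c d ->
  rect (fun z => f z + k * g z) a b c d = rect f a b c d + k * rect g a b c d.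
Proof.
move=> ab cd [f1 f2 f3 f4] [g1 g2 g3 g4].
have K (u v : R -> C) : rcont u -> rcont v -> rcont (fun t => u t + k * v t).
  by move=> cu cv; apply: rcontD => //; apply: rcontM => //; exact: rcont_cst.
rewrite /rect /hline /vline !lint_lin //; try exact: K; ring.
Qed.

Lemma rect_prim F f a b c d : a <= b -> c <= d -> bcont f a b c d ->
  (forall t, a <= t <= b -> hasd id F (t%:C + 'i%C * c%:C) (hline f c t)
     /\ hasd id F (t%:C + 'i%C * d%:C) (hline f d t)) ->
  (forall t, c <= t <= d -> hasd id F (a%:C + 'i%C * t%:C) (vline f a t)
     /\ hasd id F (b%:C + 'i%C * t%:C) (vline f b t)) ->
  rect f a b c d = 0.
Proof.
move=> ab cd [h1 h2 h3 h4] Hh Hv.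
have H y t : hasd id F (t%:C + 'i%C * y%:C) (hline f y t) -> rderiv (hline F y) t (hline f y t).
  move=> H; apply: hasd_eq (hasd_comp (f := fun t : R => t%:C + 'i%C * y%:C) H _) (mulr1 _).
  exact: hasd_eq (hasdD (hasd_real t) (hasd_cst _ t _)) (addr0 _).
have V x t : hasd id F (x%:C + 'i%C * t%:C) (vline f x t) ->
    rderiv (fun t => - 'i%C * vline F x t) t (vline f x t).
  move=> H'; apply: hasd_eq (hasdZ (- 'i%C) (hasd_comp (f := fun t : R => x%:C + 'i%C * t%:C) H' (d' := 'i%C) _)) _.
    apply: hasd_eq (hasdD (hasd_cst _ t _) (hasdZ 'i%C (hasd_real t))) _.
    by rewrite mulr1 add0r.
  by rewrite mulrCA mulNr -expr2 sqr_i opprK mulr1.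
rewrite /rect (lintE ab h1 (fun t ht => H _ _ (Hh t ht).1)).
rewrite (lintE ab h2 (fun t ht => H _ _ (Hh t ht).2)).
rewrite (lintE cd h3 (fun t ht => V _ _ (Hv t ht).1)).
rewrite (lintE cd h4 (fun t ht => V _ _ (Hv t ht).2)).
rewrite -!mulrBr !mulrA mulrN -expr2 sqr_i opprK !mul1r /hline /vline; ring.
Qed.

Definition ccont f := forall z, conti id f z.

Lemma ccont_lines f y : ccont f -> rcont (hline f y) /\ rcont (vline f y).
Proof.
move=> cf; split=> t e e0.
  have [d d0 Hd] := cf (t%:C + 'i%C * y%:C) _ e0; exists d => // h /Hd.
  by rewrite /hline rmorphD addrAC.
have [d d0 Hd] := cf (y%:C + 'i%C * t%:C) _ e0; exists d => // h hd.
have := Hd ('i%C * h%:C); rewrite /= nmM nm_i mul1r => /(_ hd).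
by rewrite /vline rmorphD mulrDr addrA.
Qed.

Lemma ccont_bcont f a b c d : ccont f -> bcont f a b c d.
Proof. by move=> cf; split; apply: (ccont_lines _ cf).1 || apply: (ccont_lines _ cf).2. Qed.

Lemma in_rect_dist a b c d (z w : C) : a <= Re z <= b -> c <= Im z <= d ->
  a <= Re w <= b -> c <= Im w <= d -> nm (z - w) <= (b - a) + (d - c).
Proof.
move=> /andP[? ?] /andP[? ?] /andP[? ?] /andP[? ?]; apply: le_trans (nm_ReIm _) _.
by rewrite lerD // ?ReB ?ImB ler_norml; apply/andP; split; lra.
Qed.

Lemma ReIm_pt (x y : R) : (Re (x%:C + 'i%C * y%:C : C) = x) * (Im (x%:C + 'i%C * y%:C : C) = y).
Proof. by split => /=; ring. Qed.

Lemma ccontB f g : ccont f -> ccont g -> ccont (fun z => f z - g z).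
Proof.
move=> cf cg z; apply: (@conti_near _ _ id (fun z => f z + (-1) * g z) _ _ 1) => //.
- by move=> h _; rewrite mulN1r.
- by rewrite mulN1r.
- by apply: contiD => //; apply: contiM => //; exact: conti_cst.
Qed.

Lemma hasd_affine (p l z w : C) : hasd id (fun w => p + (w - z) * l) w l.
Proof.
have := hasdD (hasd_cst id w p) (hasdM (hasdB (hasd_id w) (hasd_cst id w z)) (hasd_cst id w l)).
by move/hasd_eq; apply; ring.
Qed.

Lemma ccont_affine (p l z : C) : ccont (fun w => p + (w - z) * l).
Proof. by move=> w; exact: hasd_cont (hasd_affine p l z w). Qed.

Lemma rect_affine (p l z : C) a b c d : a <= b -> c <= d ->
  rect (fun w => p + (w - z) * l) a b c d = 0.
Proof.
move=> ab cd.
have HF w : hasd id (fun w => (w - z) * p + (w - z) ^+ 2 * (l / 2)) w (p + (w - z) * l).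
  have := hasdD (hasdM (hasdB (hasd_id w) (hasd_cst id w z)) (hasd_cst id w p))
    (hasdM (hasdX 2 (hasdB (hasd_id w) (hasd_cst id w z))) (hasd_cst id w (l / 2))).
  by move/hasd_eq; apply; rewrite /=; field.
apply: (rect_prim ab cd) => [|t _|t _]; [|split; exact: HF|split; exact: HF].
exact/ccont_bcont/ccont_affine.
Qed.

(** The affine approximation at z has a primitive, so it integrates to 0. What is left is at most e
    times the half-perimeter S, over a boundary of length 2 S; the other factor 2 is that of
    [lint_le]. *)
Lemma rect_local f z l e D a b c d : a <= b -> c <= d -> ccont f -> 0 <= e ->
  a <= Re z <= b -> c <= Im z <= d -> (b - a) + (d - c) < D ->
  (forall h, nm h < D -> nm (f (z + h) - f z - h * l) <= e * nm h) ->
  nm (rect f a b c d) <= 4 * e * ((b - a) + (d - c)) ^+ 2.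
Proof.
move=> ab cd cf e0 zx zy SD HD.
pose A w : C := f z + (w - z) * l.
have cA : ccont A by exact: ccont_affine.
have RA : rect A a b c d = 0 := rect_affine (f z) l z ab cd.
have AE w : f w - A w = f w - f z - (w - z) * l by rewrite /A opprD addrA.
clearbody A; have -> : rect f a b c d = rect (fun w => f w - A w) a b c d.
  have -> : (fun w => f w - A w) = (fun w => f w + (-1) * A w).
    by apply: funext => w; rewrite mulN1r.
  have H := @rect_lin f A (-1) a b c d ab cd (ccont_bcont _ _ _ _ cf) (ccont_bcont _ _ _ _ cA).
  by apply: esym; apply: etrans H _; rewrite RA mulr0 addr0.
have small w : a <= Re w <= b -> c <= Im w <= d -> nm (f w - A w) <= e * ((b - a) + (d - c)).
  move=> hx hy; have dist := in_rect_dist hx hy zx zy.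
  have := HD (w - z) (le_lt_trans dist SD); rewrite subrKC => H.
  rewrite AE; apply: le_trans H _; by rewrite ler_wpM2l.
rewrite expr2 mulrA -[4 * e * _]mulrA; apply: rect_le => //.
- by apply: ccont_bcont; exact: ccontB.
- by move=> t ht; rewrite /hline; split; apply: small; rewrite !ReIm_pt // lexx cd.
- by move=> t ht; rewrite /vline; split; apply: small; rewrite !ReIm_pt // lexx ab.
Qed.

Definition quad := (R * R * R * R)%type.
Definition qrect f (q : quad) := rect f q.1.1.1 q.1.1.2 q.1.2 q.2.

Definition quarter (q : quad) (i j : bool) : quad :=
  let: (a, b, c, d) := q in
  ((if i then (a + b) / 2 else a), (if i then b else (a + b) / 2),
   (if j then (c + d) / 2 else c), (if j then d else (c + d) / 2)).

Lemma qrect_quarter f q : qrect f q =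
  qrect f (quarter q false false) + qrect f (quarter q true false)
  + (qrect f (quarter q false true) + qrect f (quarter q true true)).
Proof.
case: q => [[[a b] c] d]; rewrite /qrect /=.
by rewrite (rect_splity f a b c ((c + d) / 2)) !(rect_splitx f a ((a + b) / 2) b).
Qed.

Lemma quarter_large f q : exists ij : bool * bool,
  nm (qrect f q) <= 4 * nm (qrect f (quarter q ij.1 ij.2)).
Proof.
apply: contrapT => H.
have K i j : 4 * nm (qrect f (quarter q i j)) < nm (qrect f q).
  by rewrite ltNge; apply/negP => Hij; apply: H; exists (i, j).
have := nmD (qrect f (quarter q false false) + qrect f (quarter q true false))
  (qrect f (quarter q false true) + qrect f (quarter q true true)).
rewrite -qrect_quarter.
have := nmD (qrect f (quarter q false false)) (qrect f (quarter q true false)).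
have := nmD (qrect f (quarter q false true)) (qrect f (quarter q true true)).
have := K false false; have := K false true; have := K true true; have := K true false.
lra.
Qed.

Lemma le_scaled_sqr_contra (N S : R) : 0 < N ->
  ~ (forall e : R, 0 < e -> N <= 4 * e * S ^+ 2).
Proof.
move=> N0 H; have S0 := sqr_ge0 S.
have S1 : 0 < 8 * (S ^+ 2 + 1) by lra.
have := H _ (divr_gt0 N0 S1); rewrite -[_ * S ^+ 2]mulrA mulrCA => H1.
have : N * (8 * (S ^+ 2 + 1)) <= N * (4 * S ^+ 2).
  rewrite -ler_pdivlMr //; apply: le_trans H1 _; rewrite le_eqVlt; apply/orP; left; apply/eqP; ring.
by rewrite ler_pM2l //; lra.
Qed.

Lemma pow2_small (S D : R) : 0 < D -> exists n : nat, S / 2 ^+ n < D.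
Proof.
move=> D0; exists (Num.truncn (S / D)).+1; rewrite ltr_pdivrMr ?exprn_gt0 // mulrC -ltr_pdivrMr //.
apply: lt_trans (real_truncnS_gt (num_real _)) _.
by rewrite -natrX ltr_nat ltn_expl.
Qed.

(** Bisection: some quarter keeps at least 1/4 of the modulus of the integral, while the
    half-perimeter S is halved. At the point common to all the rectangles the local estimate bounds
    the integral over the n-th one by 4 e S^2 / 4^n, hence the original one by 4 e S^2 for every e >
    0. *)
Theorem goursat f a b c d : a <= b -> c <= d -> ccont f ->
  (forall z, a <= Re z <= b -> c <= Im z <= d -> exists l, hasd id f z l) ->
  rect f a b c d = 0.
Proof.
move=> ab cd cf Hf; apply: contrapT => /eqP; rewrite -nm_gt0.
move NE : (nm _) => N e0.
have [pick Hpick] := choice (quarter_large f).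
pose qn n : quad := iter n (fun q => quarter q (pick q).1 (pick q).2) (a, b, c, d).
pose an n := (qn n).1.1.1; pose bn n := (qn n).1.1.2; pose cn n := (qn n).1.2; pose dn n := (qn n).2.
have Hn n : N <= 4 ^+ n * nm (qrect f (qn n)).
  elim: n => [|n IH]; first by rewrite expr0 mul1r -NE.
  apply: le_trans IH _; rewrite exprSr -mulrA ler_wpM2l ?exprn_ge0 //; exact: Hpick.
have step n : [/\ an n <= an n.+1, bn n.+1 <= bn n, cn n <= cn n.+1 & dn n.+1 <= dn n] /\
   (an n <= bn n /\ cn n <= dn n) /\
   (bn n - an n = (b - a) / 2 ^+ n /\ dn n - cn n = (d - c) / 2 ^+ n).
  have E m : (qn m.+1) = quarter (qn m) (pick (qn m)).1 (pick (qn m)).2 by [].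
  have base : (an n <= bn n /\ cn n <= dn n) /\
       (bn n - an n = (b - a) / 2 ^+ n /\ dn n - cn n = (d - c) / 2 ^+ n).
    elim: n => [|n [[h1 h2] [h3 h4]]]; first by rewrite expr0 !divr1.
    move: h1 h2 h3 h4; rewrite /an /bn /cn /dn E exprSr invfM !mulrA.
    case: (qn n) => [[[x y] u] v] /=; case: (pick _) => [[] []] /= h1 h2 <- <-; (split; split; lra).
  split=> //; move: base; rewrite /an /bn /cn /dn E.
  case: (qn n) => [[[x y] u] v] /=; case: (pick _) => [[] []] /= [[h1 h2] _]; (split; lra).
have {}Hn n : N <= 4 ^+ n * nm (rect f (an n) (bn n) (cn n) (dn n)) := Hn n.
clear NE; have [a0 b0 c0 d0] : [/\ an 0%N = a, bn 0%N = b, cn 0%N = c & dn 0%N = d] by [].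
clearbody an bn cn dn.
have mono n m : (n <= m)%N -> [/\ an n <= an m, bn m <= bn n, cn n <= cn m & dn m <= dn n].
  elim: m => [|m IH]; first by rewrite leqn0 => /eqP ->.
  rewrite leq_eqVlt => /orP[/eqP->//|]; rewrite ltnS => /IH[h1 h2 h3 h4].
  by have [[k1 k2 k3 k4] _] := step m; split; lra.
(* Nested intervals: the supremum of the left ends lies in all of them. *)
have lub (u v : nat -> R) : (forall n m, (n <= m)%N -> u n <= u m /\ v m <= v n) ->
    (forall n, u n <= v n) -> exists x, forall n, u n <= x <= v n.
  move=> muv uv; have uv' n m : u n <= v m.
    have [/muv[h _]|/ltnW/muv[_ h]] := leqP n m; first exact: le_trans h (uv m).
    exact: le_trans (uv n) h.
  exists (sup (range u)) => n; apply/andP; split.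
    by apply: ub_le_sup; [exists (v 0%N) => _ [m _ <-]|exists n].
  by apply: ge_sup; [exists (u 0%N), 0%N|move=> _ [m _ <-]].
have [|n|x Hx] := lub an bn; [by move=> n m /mono[]|by have [_ [[]]] := step n|].
have [|n|y Hy] := lub cn dn; [by move=> n m /mono[]|by have [_ [[]]] := step n|].
pose z := x%:C + 'i%C * y%:C : C.
have [zx zy] : Re z = x /\ Im z = y by rewrite !ReIm_pt.
have [l Hl] : exists l, hasd id f z l
  by apply: Hf; [have := Hx 0%N; rewrite zx a0 b0|have := Hy 0%N; rewrite zy c0 d0].
have [S SE0] : exists S : R, S = (b - a) + (d - c) := ex_intro _ _ erefl.
apply: (@le_scaled_sqr_contra N S e0) => e ep.
have [D D0 HD] := Hl e ep.
have [n nD] := pow2_small S D0.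
have [_ [[abn cdn] [abE cdE]]] := step n.
have SE : bn n - an n + (dn n - cn n) = S / 2 ^+ n by rewrite abE cdE -mulrDl -SE0.
apply: le_trans (Hn n) _.
have := @rect_local f z l e D (an n) (bn n) (cn n) (dn n) abn cdn cf (ltW ep).
rewrite zx zy SE => /(_ (Hx n) (Hy n) nD HD) H.
have p2 : (2 : R) ^+ n != 0 by rewrite expf_neq0.
have -> : 4 * e * S ^+ 2 = 4 ^+ n * (4 * e * (S / 2 ^+ n) ^+ 2).
  rewrite (_ : 4 ^+ n = 2 ^+ n * 2 ^+ n :> R); last by rewrite -exprMn -natrM.
  by clear -p2; field.
by apply: ler_wpM2l H; exact: exprn_ge0.
Qed.

End Goursat.

(** * Cauchy's formula on a square *)

Section Cauchy.
Variable R : realType.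
Local Notation C := R[i].
Implicit Types (f g : C -> C).

Local Notation q := (1 / 2 : R).

Definition sqint f : C := rect f (- q) q (- q) q.
Definition sqcont f := bcont f (- q) q (- q) q.
Definition in_square (z : C) := `|Re z| <= q /\ `|Im z| <= q.
Definition on_square (z : C) := in_square z /\ (`|Re z| = q \/ `|Im z| = q).

Lemma hasd_kernel (z w : C) : z - w != 0 -> hasd id (fun z => (z - w)^-1) z (- (z - w) ^- 2).
Proof.
move=> zw; have H := hasdB (hasd_id z) (hasd_cst id z w).
have := hasd_comp (f := fun z => z - w) (hasdV zw) H.
by move/hasd_eq; apply; rewrite subr0 mulr1.
Qed.

Lemma sqcont_cst c : sqcont (fun=> c).
Proof. by split; exact: rcont_cst. Qed.

Lemma sqcontM f g : sqcont f -> sqcont g -> sqcont (fun z => f z * g z).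
Proof. by move=> [? ? ? ?] [? ? ? ?]; split; exact: rcontM. Qed.

Lemma sqcontD f g : sqcont f -> sqcont g -> sqcont (fun z => f z + g z).
Proof. by move=> [? ? ? ?] [? ? ? ?]; split; exact: rcontD. Qed.

Lemma sqcontX f n : sqcont f -> sqcont (fun z => f z ^+ n).
Proof.
move=> cf; elim: n => [|n IH].
  rewrite (_ : (fun z => f z ^+ 0) = fun=> 1); first exact: sqcont_cst.
  by apply: funext => z; rewrite expr0.
rewrite (_ : (fun z => f z ^+ n.+1) = fun z => f z * f z ^+ n); first exact: sqcontM.
by apply: funext => z; rewrite exprS.
Qed.

Lemma ccont_id : ccont (id : C -> C).
Proof. by move=> z; exact: hasd_cont (hasd_id z). Qed.

Lemma sqcont_kernel (w : C) : `|Re w| < q -> `|Im w| < q -> sqcont (fun z => (z - w)^-1).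
Proof.
rewrite !ltr_norml => /andP[w1 w2] /andP[w3 w4].
have [k1 k2 k3 k4] : sqcont (fun z => z - w).
  by apply: ccont_bcont; apply: ccontB; [exact: ccont_id|move=> z; exact: conti_cst].
have ne (z : C) : (Re z != Re w) || (Im z != Im w) -> z - w != 0.
  by rewrite -negb_and subr_eq0; apply: contra => /eqP ->; rewrite !eqxx.
split; rewrite /hline /vline; apply: rcontV => //.
- by move=> t; apply: ne; rewrite !ReIm_pt (lt_eqF w3) orbT.
- by move=> t; apply: ne; rewrite !ReIm_pt (gt_eqF w4) orbT.
- by move=> t; apply: ne; rewrite !ReIm_pt (lt_eqF w1).
- by move=> t; apply: ne; rewrite !ReIm_pt (gt_eqF w2).
Qed.

Lemma on_square_lines t : - q <= t <= q ->
  [/\ on_square (t%:C + 'i%C * (- q)%:C), on_square (t%:C + 'i%C * q%:C),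
      on_square ((- q)%:C + 'i%C * t%:C) & on_square (q%:C + 'i%C * t%:C)].
Proof.
move=> ht; have q0 : 0 <= q by rewrite divr_ge0.
have tq : `|t| <= q by rewrite ler_norml.
by split; (split; [split|]); rewrite !ReIm_pt ?normrN ?(ger0_norm q0) //; (left + right).
Qed.

Lemma qq : - q <= q. Proof. lra. Qed.

Lemma sqint_le f M : sqcont f -> (forall z, on_square z -> nm (f z) <= M) ->
  nm (sqint f) <= 8 * M.
Proof.
move=> cf HM; have -> : 8 * M = 4 * M * ((q - - q) + (q - - q)) by field.
apply: rect_le; [exact: qq|exact: qq|exact: cf| |].
- by move=> t /on_square_lines[? ? ? ?]; split; exact: HM.
- by move=> t /on_square_lines[? ? ? ?]; split; exact: HM.
Qed.

Lemma sqint_lin f g k : sqcont f -> sqcont g ->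
  sqint (fun z => f z + k * g z) = sqint f + k * sqint g.
Proof. by move=> cf cg; apply: rect_lin => //; exact: qq. Qed.

Lemma sqint_prim f F : sqcont f -> (forall z, on_square z -> hasd id F z (f z)) -> sqint f = 0.
Proof.
move=> cf HF; apply: (rect_prim (F := F)); [exact: qq|exact: qq|exact: cf| |].
- by move=> t /on_square_lines[? ? ? ?]; split; exact: HF.
- by move=> t /on_square_lines[? ? ? ?]; split; exact: HF.
Qed.

Lemma eq_sqint f g : sqcont f -> sqcont g -> (forall z, on_square z -> f z = g z) ->
  sqint f = sqint g.
Proof.
move=> [f1 f2 f3 f4] [g1 g2 g3 g4] fg; rewrite /sqint /rect.
rewrite (eq_lint qq f1 g1) ?(eq_lint qq f2 g2) ?(eq_lint qq f3 g3) ?(eq_lint qq f4 g4) // => t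
  /on_square_lines[? ? ? ?]; exact: fg.
Qed.

(* Integrates around a small square about w: the rest of the unit square splits into
   four rectangles avoiding w. *)
Lemma sqint_punctured g (w : C) : `|Re w| < q -> `|Im w| < q -> ccont g ->
  (forall z, in_square z -> z != w -> exists l, hasd id g z l) -> sqint g = 0.
Proof.
rewrite !ltr_norml => /andP[w1 w2] /andP[w3 w4] cg Hg.
have gz (a b c d : R) : a <= b -> c <= d -> - q <= a -> b <= q -> - q <= c -> d <= q ->
    [|| Re w < a, b < Re w, Im w < c | d < Im w] -> rect g a b c d = 0.
  move=> ab cd a1 b1 c1 d1 out; apply: goursat => // z /andP[z1 z2] /andP[z3 z4].
  apply: Hg; first by split; rewrite ler_norml; apply/andP; split; lra.
  by apply/eqP => zE; move: out; rewrite -zE !ltNge z1 z2 z3 z4.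
have small (d : R) : 0 < d -> d < Re w + q -> d < q - Re w -> d < Im w + q -> d < q - Im w ->
    sqint g = rect g (Re w - d) (Re w + d) (Im w - d) (Im w + d).
  move=> d0 d1 d2 d3 d4; rewrite /sqint.
  have e1 : rect g (- q) (Re w - d) (- q) q = 0.
    by apply: gz; [lra|lra|lra|lra|lra|lra|apply/or4P; constructor 2; lra].
  have e2 : rect g (Re w + d) q (- q) q = 0.
    by apply: gz; [lra|lra|lra|lra|lra|lra|apply/or4P; constructor 1; lra].
  have e3 : rect g (Re w - d) (Re w + d) (- q) (Im w - d) = 0.
    by apply: gz; [lra|lra|lra|lra|lra|lra|apply/or4P; constructor 4; lra].
  have e4 : rect g (Re w - d) (Re w + d) (Im w + d) q = 0.
    by apply: gz; [lra|lra|lra|lra|lra|lra|apply/or4P; constructor 3; lra].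
  rewrite (rect_splitx g (- q) (Re w - d) q) e1 add0r (rect_splitx g _ (Re w + d) q) e2 addr0.
  by rewrite (rect_splity g _ _ (- q) (Im w - d) q) e3 add0r (rect_splity g _ _ _ (Im w + d) q) e4 addr0.
apply: nm_small_eq => e e0; rewrite subr0.
have [D D0 HD] := cg w 1 ltr01.
pose m := Num.min (Num.min (Re w + q) (q - Re w)) (Num.min (Im w + q) (q - Im w)).
pose M := nm (g w) + 1.
have M0 : 0 < M by rewrite ltr_wpDl ?nm_ge0.
have m0 : 0 < m by rewrite !lt_min; apply/andP; split; apply/andP; split; lra.
(* The square of half-side d about w stays inside the unit square and within D of w, where |g| <= M;
   its integral is at most 4 M (2 d + 2 d) = 16 M d <= e. *)
pose d := Num.min (m / 2) (Num.min (D / 3) (e / (16 * M))).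
have d0 : 0 < d by rewrite !lt_min !divr_gt0 // mulr_gt0.
have dm : d < m by apply: (@le_lt_trans _ _ (m / 2)); [rewrite ge_min lexx|lra].
have dD : d <= D / 3 by rewrite !ge_min lexx orbT.
have de : d * (16 * M) <= e by rewrite -ler_pdivlMr ?mulr_gt0 // !ge_min lexx !orbT.
move: dm; rewrite !lt_min => /andP[/andP[d1 d2] /andP[d3 d4]].
rewrite (small d) //.
have gM (z : C) : Re w - d <= Re z <= Re w + d -> Im w - d <= Im z <= Im w + d -> nm (g z) <= M.
  move=> /andP[z1 z2] /andP[z3 z4]; have zw : nm (z - w) < D.
    apply: le_lt_trans (nm_ReIm _) _; rewrite ReB ImB.
    have : `|Re z - Re w| <= d by rewrite ler_norml; apply/andP; split; lra.
    have : `|Im z - Im w| <= d by rewrite ler_norml; apply/andP; split; lra.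
    lra.
  have := HD (z - w) zw; rewrite subrKC => H.
  by have := nm_sub_le (g z) (g w); rewrite /M; lra.
apply: (@le_trans _ _ (4 * M * ((Re w + d - (Re w - d)) + (Im w + d - (Im w - d))))).
  have hx : Re w - d <= Re w + d by lra. have hy : Im w - d <= Im w + d by lra.
  apply: rect_le => //; [exact: ccont_bcont| |];
    by move=> t ht; split; apply: gM; rewrite !ReIm_pt ?ht ?lexx ?hx ?hy.
apply: le_trans de; rewrite le_eqVlt; apply/orP; left; apply/eqP; ring.
Qed.

(* It is 2 pi i, but only its non-vanishing matters. *)
Definition winding : C := sqint (fun z => z^-1).

Lemma on_square_nm (z : C) : on_square z -> q <= nm z.
Proof. by move=> [_ [<-|<-]]; rewrite ReIm_nm. Qed.

Lemma sqcont_inv : sqcont GRing.inv.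
Proof.
have q0 : 0 < q by rewrite divr_gt0.
have /sqcont_kernel : `|Re (0 : C)| < q by rewrite normr0.
move=> /(_ _)[|]; first by rewrite normr0.
by under eq_fun do rewrite subr0.
Qed.

Lemma Im_lint_gt0 (f : R -> C) a b : a < b -> rcont f ->
  (forall t, 0 < Im (f t)) -> 0 < Im (lint f a b).
Proof.
move=> ab cf f0; rewrite /lint ImB.
have D t := (antiderP t cf : hasd _ _ _ _).
have [||c _ ->] := @MVT_segment R (fun t => Im (antider f t)) (fun t => Im (f t)) a b (ltW ab).
- by move=> t _; have /rhasd_ReIm[] := D t.
- by apply: derivable_within_continuous => t _; have /rhasd_ReIm[_ []] := D t.
- by rewrite mulr_gt0 // subr_gt0.
Qed.

(** On every side, taken counterclockwise, dz / z has imaginary part q / (t^2 + q^2) dt with q = 1 /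
    2. This is positive, hence so is the imaginary part of the whole integral. *)
Lemma winding_neq0 : winding != 0.
Proof.
have [c1 c2 c3 c4] := sqcont_inv.
have lintZ (k : C) (f : R -> C) : rcont f -> lint (fun t => k * f t) (- q) q = k * lint f (- q) q.
  move=> cf; rewrite (lintE qq (F := fun t => k * antider f t)).
  - by rewrite /lint mulrBr.
  - by apply: rcontM => //; exact: rcont_cst.
  - by move=> t _; apply: hasdZ; exact: antiderP.
have qq' : - q < q by lra.
suff : 0 < Im winding by apply: contraTneq => ->; rewrite /= ltxx.
have -> : winding = lint (hline GRing.inv (- q)) (- q) q
  + lint (fun t => 'i%C * vline GRing.inv q t) (- q) q
  + lint (fun t => (- 1) * hline GRing.inv q t) (- q) q
  + lint (fun t => (- 'i%C) * vline GRing.inv (- q) t) (- q) q.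
  by rewrite /winding /sqint /rect !lintZ //; ring.
have S t : 0 < q / (t ^+ 2 + q ^+ 2).
  by rewrite divr_gt0 ?divr_gt0 // ltr_wpDl ?sqr_ge0 // exprn_gt0 // divr_gt0.
have E (x y : R) : Im (x +i* y)^-1 = - (y / (x ^+ 2 + y ^+ 2)) by [].
have E' (x y : R) : Re (x +i* y)^-1 = x / (x ^+ 2 + y ^+ 2) by [].
have P (x y : R) : x%:C + 'i%C * y%:C = x +i* y :> C.
  by apply: complex_ext; rewrite ReIm_pt.
have ImN (x : C) : - Im x = Im (- x) by case: x.
have ImD (x y : C) : Im (x + y) = Im x + Im y by case: x y => ? ? [].
have rz (k : C) (f : R -> C) : rcont f -> rcont (fun t => k * f t).
  by move=> cf; apply: rcontM => //; exact: rcont_cst.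
rewrite 3!ImD; apply: addr_gt0; [apply: addr_gt0; [apply: addr_gt0|]|].
- by apply: Im_lint_gt0 => // t; rewrite /hline P E sqrrN mulNr opprK.
- apply: Im_lint_gt0 => [//||t]; first exact: rz.
  by rewrite mulrC ImiRe /vline P E' addrC.
- apply: Im_lint_gt0 => [//||t]; first exact: rz.
  by rewrite mulN1r /hline P -ImN E opprK.
- apply: Im_lint_gt0 => [//||t]; first exact: rz.
  by rewrite mulNr -ImN mulrC ImiRe /vline P E' sqrrN mulNr opprK addrC.
Qed.

(** The difference quotient of f at w, completed by the derivative there, is continuous on the plane
    and differentiable on the square off w, so [sqint_punctured] gives it integral 0. *)
Lemma cauchy_kernel f (w : C) : `|Re w| < q -> `|Im w| < q -> ccont f ->
  (forall z, in_square z -> exists l, hasd id f z l) ->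
  sqint (fun z => f z * (z - w)^-1) = f w * sqint (fun z => (z - w)^-1).
Proof.
move=> w1 w2 cf df; have [l Hl] : exists l, hasd id f w l by apply: df; split; exact: ltW.
pose g z := if z == w then l else (f z - f w) * (z - w)^-1.
have gne z : z != w -> g z = (f z - f w) * (z - w)^-1 by rewrite /g => /negbTE ->.
have gnear z h : z != w -> nm h < nm (z - w) -> (f (z + h) - f w) * (z + h - w)^-1 = g (z + h).
  move=> zw hz; rewrite gne //; apply: contraTneq hz => zh.
  by rewrite -leNgt -zh opprD addrA subrr sub0r nmN.
have cg : ccont g.
  move=> z; have [->|zw] := eqVneq z w.
    move=> e e0; have e2 : 0 < e / 2 by rewrite divr_gt0.
    have [D D0 HD] := Hl _ e2; exists D => // h /HD /= Hh.
    have gw : g w = l by rewrite /g eqxx.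
    have [->|h0] := eqVneq h 0; first by rewrite addr0 subrr nm0.
    rewrite gw gne; last by rewrite -subr_eq0 addrC addKr.
    have -> : (f (w + h) - f w) / (w + h - w) - l = (f (w + h) - f w - h * l) / h.
      by rewrite (addrC w) addrK; field.
    rewrite nmM nmV ltr_pdivrMr ?nm_gt0 //; apply: le_lt_trans Hh _.
    by rewrite ltr_pM2r ?nm_gt0 //; lra.
  apply: (@conti_near _ _ id (fun z => (f z - f w) * (z - w)^-1) _ _ (nm (z - w))).
  - by rewrite nm_gt0 subr_eq0.
  - by move=> h; exact: gnear.
  - by rewrite gne.
  - have cs c : conti id (fun z : C => z - c) z.
      by apply: contiD; [exact: ccont_id|exact: conti_cst].
    apply: contiM; last by apply: contiV; [rewrite subr_eq0|exact: cs].
    by apply: contiD; [exact: cf|exact: conti_cst].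
have : sqint g = 0.
  apply: (sqint_punctured w1 w2 cg) => z /df[l' Hl'] zw.
  have H1 := hasdB Hl' (hasd_cst id z (f w)).
  have H2 : hasd id (fun z => (z - w)^-1) z (- (z - w) ^- 2).
    by apply: hasd_kernel; rewrite subr_eq0.
  eexists; apply: (hasd_near (r := nm (z - w)) _ _ _ (hasdM H1 H2)).
  - by rewrite nm_gt0 subr_eq0.
  - by move=> h; apply: gnear.
  - by rewrite gne.
have k := sqcont_kernel w1 w2.
have kf : sqcont (fun z => f z * (z - w)^-1) by apply: sqcontM => //; exact: ccont_bcont.
have kc : sqcont (fun z => f z * (z - w)^-1 + (- f w) * (z - w)^-1).
  by apply: sqcontD => //; apply: sqcontM => //; exact: sqcont_cst.
rewrite (eq_sqint (ccont_bcont _ _ _ _ cg) kc); last first.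
  move=> z [_ hz]; rewrite gne; first by rewrite mulrBl mulNr.
  by apply: contraPneq hz => ->; case=> E; [rewrite E ltxx in w1|rewrite E ltxx in w2].
by rewrite sqint_lin // mulNr => /eqP; rewrite subr_eq0 => /eqP.
Qed.

Lemma on_square_kernel (z w : C) (r : R) : on_square z -> nm w <= r -> q - r <= nm (z - w).
Proof.
by move=> /on_square_nm zq wr; have := nm_sub_le z w; lra.
Qed.

Lemma sqcont_kernel_nm (w : C) : nm w < q -> sqcont (fun z => (z - w)^-1).
Proof.
by move=> wq; apply: sqcont_kernel; apply: le_lt_trans wq; rewrite ReIm_nm.
Qed.

(** The pole is moved from 0 to w along t w. The integrand (z - t w)^-1 has t-derivative w (z - t
    w)^-2, which has a primitive along the boundary, so the integral has derivative 0 in t. *)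
Lemma winding_const (w : C) : nm w <= 1 / 4 -> sqint (fun z => (z - w)^-1) = winding.
Proof.
move=> wq; pose W (t : R) : C := sqint (fun z => (z - t%:C * w)^-1).
have dW t : 0 <= t <= 1 -> hasd (real_complex R) W t 0.
  move=> /andP[t0 t1] e e0.
  have tw : nm (t%:C * w) <= 1 / 4.
    rewrite nmM nm_real ger0_norm //; apply: le_trans wq.
    by rewrite ler_piMl ?nm_ge0.
  (* The bound 1 / 8 keeps the moved pole within 3 / 8 of 0, so on the boundary the two kernels are
     at most 4 and 8. The remainder kernel is then at most 4 * 4 * 8 = 128, and its integral at most
     8 * 128 = 1024. *)
  exists (Num.min (1 / 8) (e / 1024)).
    by rewrite lt_min; apply/andP; split; lra.
  move=> s; rewrite lt_min => /andP[s1 s2]; rewrite mulr0 subr0 /W.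
  set w1 := t%:C * w in tw *; set h := s%:C * w.
  have hs : nm h <= nm s%:C by rewrite nmM ler_piMr ?nm_ge0 //; lra.
  have h8 : nm h < 1 / 8 by lra.
  have whE : (t + s)%:C * w = w1 + h by rewrite rmorphD mulrDl.
  have wh : nm (w1 + h) <= 3 / 8 by have := nmD w1 h; lra.
  rewrite whE; have c1 : sqcont (fun z => (z - w1)^-1) by apply: sqcont_kernel_nm; lra.
  have c2 : sqcont (fun z => (z - (w1 + h))^-1) by apply: sqcont_kernel_nm; lra.
  have I0 : sqint (fun z => (z - w1)^-1 * (z - w1)^-1) = 0.
    apply: (sqint_prim (F := fun z => - (z - w1)^-1)); first exact: sqcontM.
    move=> z hz; have zw : z - w1 != 0 by rewrite -nm_gt0; have := on_square_kernel hz tw; lra.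
    by apply: hasd_eq (hasdN (hasd_kernel zw)) _; field.
  have -> : sqint (fun z => (z - (w1 + h))^-1) - sqint (fun z => (z - w1)^-1)
     = h ^+ 2 * sqint (fun z => (z - w1)^-1 * (z - w1)^-1 * (z - (w1 + h))^-1).
    have c3 := sqcontM (sqcontM c1 c1) c2.
    have c5 := sqcontD c1 (sqcontM (sqcont_cst h) (sqcontM c1 c1)).
    have c4 := sqcontD c5 (sqcontM (sqcont_cst (h ^+ 2)) c3).
    transitivity (sqint (fun z => ((z - w1)^-1 + h * ((z - w1)^-1 * (z - w1)^-1))
       + h ^+ 2 * ((z - w1)^-1 * (z - w1)^-1 * (z - (w1 + h))^-1)) - sqint (fun z => (z - w1)^-1)).
      congr (_ - _); apply: (eq_sqint c2 c4).
      move=> z hz; have zw : z - w1 != 0 by rewrite -nm_gt0; have := on_square_kernel hz tw; lra.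
      have zwh : z - (w1 + h) != 0 by rewrite -nm_gt0; have := on_square_kernel hz wh; lra.
      by field; rewrite zw opprD addrA in zwh *; rewrite zwh.
    by rewrite (sqint_lin _ c5 c3) (sqint_lin _ c1 (sqcontM c1 c1)) I0; ring.
  have := @sqint_le (fun z => (z - w1)^-1 * (z - w1)^-1 * (z - (w1 + h))^-1) 128.
  move=> /(_ (sqcontM (sqcontM c1 c1) c2)) Hb.
  have {}Hb : nm (sqint (fun z => (z - w1)^-1 * (z - w1)^-1 * (z - (w1 + h))^-1)) <= 8 * 128.
    apply: Hb => z hz; have k1 := on_square_kernel hz tw; have k2 := on_square_kernel hz wh.
    rewrite !nmM !nmV.
    have l1 : (nm (z - w1))^-1 <= 4 by rewrite -[4]invrK lef_pV2 ?posrE; lra.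
    have l2 : (nm (z - (w1 + h)))^-1 <= 8 by rewrite -[8]invrK lef_pV2 ?posrE; lra.
    have -> : 128 = 4 * 4 * 8 :> R by ring.
    by do 2 (apply: ler_pM; rewrite ?mulr_ge0 ?invr_ge0 ?nm_ge0 //).
  rewrite nmM nmX expr2.
  have s0 := nm_ge0 (s%:C : C).
  apply: (@le_trans _ _ ((nm s%:C * (e / 1024)) * (8 * 128))); last by rewrite le_eqVlt; apply/orP; left; apply/eqP; field.
  apply: ler_pM; rewrite ?mulr_ge0 ?nm_ge0 //.
  by apply: ler_pM; rewrite ?nm_ge0 //; lra.
have := @mvt_le _ W (fun=> 0) 0 1 0 ler01 dW.
rewrite mulr0 mul0r => /(_ (fun t _ => _)) H.
have {}H : nm (W 1 - W 0) <= 0 by apply: H; rewrite nm0.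
have : W 1 = W 0.
  by apply/eqP; rewrite -subr_eq0 -nm_eq0 eq_le nm_ge0 H.
rewrite /W /winding; under [in RHS]eq_fun do rewrite rmorph0 mul0r subr0.
by move=> <-; congr sqint; apply: funext => z; rewrite mul1r.
Qed.

Definition taylor_coef f (j : nat) : C := sqint (fun z => f z * z^-1 ^+ j.+1) / winding.

(** Iterating 1 / (z - h) = 1 / z + h / (z (z - h)) in Cauchy's formula leaves after n steps the
    remainder h^n times [r n]. On the boundary |1 / z| <= 2 and |1 / (z - h)| <= 4; with the factor
    8 of [sqint_le] this gives 32 M 2^n. *)
Theorem taylor_square f (M : R) : ccont f ->
  (forall z, in_square z -> exists l, hasd id f z l) ->
  (forall z, on_square z -> nm (f z) <= M) ->
  forall n (h : C), nm h <= 1 / 4 ->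
  nm (f h - \sum_(j < n) taylor_coef f j * h ^+ j) <= 32 / nm winding * M * (2 * nm h) ^+ n.
Proof.
move=> cf df HM n h hq.
have cf' : sqcont f by exact: ccont_bcont.
have ck : sqcont (fun z => (z - h)^-1) by apply: sqcont_kernel_nm; lra.
have ci := sqcont_inv.
pose r m := sqint (fun z => f z * z^-1 ^+ m * (z - h)^-1).
have cr m : sqcont (fun z => f z * z^-1 ^+ m * (z - h)^-1).
  by apply: sqcontM => //; apply: sqcontM => //; exact: sqcontX.
have W0 := winding_neq0.
have rS m : r m = taylor_coef f m * winding + h * r m.+1.
  rewrite /taylor_coef divfK // /r -sqint_lin //; last by apply: sqcontM => //; exact: sqcontX.
  apply: eq_sqint => //.
    apply: sqcontD; first by apply: sqcontM => //; exact: sqcontX.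
    by apply: sqcontM => //; exact: sqcont_cst.
  move=> z hz; have z0 : z != 0 by rewrite -nm_gt0; have := on_square_nm hz; lra.
  have zh : z - h != 0 by rewrite -nm_gt0; have := on_square_kernel hz hq; lra.
  by rewrite exprS; field; rewrite z0 zh.
have E m : f h * winding = \sum_(j < m) taylor_coef f j * h ^+ j * winding + h ^+ m * r m.
  elim: m => [|m IH]; last by rewrite IH big_ord_recr /= rS exprS; ring.
  rewrite big_ord0 add0r expr0 mul1r /r -(winding_const hq) -cauchy_kernel //.
  - by congr sqint; apply: funext => z; rewrite expr0 mulr1.
  - by apply: le_lt_trans (ReIm_nm _).1 _; lra.
  - by apply: le_lt_trans (ReIm_nm _).2 _; lra.
have -> : f h - \sum_(j < n) taylor_coef f j * h ^+ j = h ^+ n * r n / winding.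
  apply: (mulIf W0); rewrite divfK // mulrBl (E n) mulr_suml; ring.
have M0 : 0 <= M.
  have hq' : - q <= q <= q by apply/andP; split; lra.
  by have [/HM + _ _ _] := on_square_lines hq'; apply: le_trans; exact: nm_ge0.
have rb : nm (r n) <= 8 * (M * 2 ^+ n * 4).
  apply: sqint_le => // z hz; rewrite !nmM nmX !nmV.
  have k1 := on_square_nm hz; have k2 := on_square_kernel hz hq.
  apply: ler_pM; rewrite ?mulr_ge0 ?exprn_ge0 ?invr_ge0 ?nm_ge0 //.
    apply: ler_pM; rewrite ?exprn_ge0 ?invr_ge0 ?nm_ge0 //; first exact: HM.
    apply: lerXn2r; rewrite ?nnegrE ?invr_ge0 ?nm_ge0 //.
    by rewrite -[2]invrK lef_pV2 ?posrE; lra.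
  by rewrite -[4]invrK lef_pV2 ?posrE; lra.
rewrite !nmM nmX nmV exprMn.
have -> : 32 / nm winding * M * (2 ^+ n * nm h ^+ n) = nm h ^+ n * (8 * (M * 2 ^+ n * 4)) / nm winding.
  by field; rewrite nm_eq0.
by rewrite ler_wpM2r ?invr_ge0 ?nm_ge0 // ler_wpM2l // exprn_ge0 // nm_ge0.
Qed.

End Cauchy.

(** * Unconditional sums *)

Section Summation.
Local Open Scope fset_scope.
Local Open Scope ring_scope.
Variable R : realType.
Local Notation C := R[i].
Implicit Types I J : choiceType.

Lemma sum_fsetU (V : nmodType) I (A B : {fset I}) (x : I -> V) : A `<=` B ->
  \sum_(i <- B) x i = \sum_(i <- A) x i + \sum_(i <- B `\` A) x i.
Proof.
move=> AB; rewrite (big_fsetID _ (mem A)) /=; congr (_ + _); apply: perm_big.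
  apply: uniq_perm; rewrite ?fset_uniq // => i; rewrite !inE /=.
  by apply/andP/idP => [[]//|iA]; split=> //; apply: (fsubsetP AB).
by apply: uniq_perm; rewrite ?fset_uniq // => i; rewrite !inE /= andbC.
Qed.

Lemma has_sumP I (x : I -> C) (l : C) : has_sum x l <->
  forall e : R, 0 < e -> exists A : {fset I}, forall B : {fset I}, A `<=` B ->
    nm (\sum_(i <- B) x i - l) < e.
Proof.
have E (B : {fset I}) : partial_sum (x : I -> C^o) B = \sum_(i <- B) x i.
  by rewrite /partial_sum big_seq_fsetE.
split=> [/cvgrPdist_lt H e e0|H].
  have eC : (0 : C) < e%:C by rewrite ltcR.
  have [A _ HA] := H (@filter_filter _ _ (@totally_filter I)) _ eC; exists A => B AB.
  by have := HA B AB; rewrite /= E norm_nm ltcR nmB.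
apply/(cvgrPdist_lt (FF := @filter_filter _ _ (@totally_filter I))) => e e0; have [e0' eE] := cball e0.
have [A HA] := H _ e0'; exists A => // B /= /HA.
by rewrite E ltC_nm // nmB.
Qed.

Definition summable_by I (x : I -> C) (M : R) :=
  forall A : {fset I}, \sum_(i <- A) nm (x i) <= M.

Definition abs_summable I (x : I -> C) := exists M, summable_by x M.

Lemma summable_by_ge0 I (x : I -> C) M : summable_by x M -> 0 <= M.
Proof. by move=> /(_ fset0); rewrite big_seq_fset0. Qed.

Lemma has_sum_unique I (x : I -> C) l l' : has_sum x l -> has_sum x l' -> l = l'.
Proof.
move=> /has_sumP H /has_sumP H'; apply: nm_small_eq => e e0; have e2 : 0 < e / 2 by rewrite divr_gt0.
have [A {}H] := H _ e2; have [A' {}H'] := H' _ e2.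
have := H (A `|` A') (fsubsetUl _ _); have := H' (A `|` A') (fsubsetUr _ _).
set S := \sum_(i <- _) _ => k1 k2.
have -> : l - l' = (S - l') - (S - l) by ring.
by apply: le_trans (nmD _ _) _; rewrite nmN; lra.
Qed.

Lemma has_sumD I (x y : I -> C) l l' : has_sum x l -> has_sum y l' ->
  has_sum (fun i => x i + y i) (l + l').
Proof.
move=> /has_sumP H /has_sumP H'; apply/has_sumP => e e0; have e2 : 0 < e / 2 by rewrite divr_gt0.
have [A {}H] := H _ e2; have [A' {}H'] := H' _ e2.
exists (A `|` A') => B; rewrite fsubUset => /andP[/H k1 /H' k2]; rewrite big_split /=.
have -> (a b : C) : a + b - (l + l') = (a - l) + (b - l') by ring.
by apply: le_lt_trans (nmD _ _) _; lra.
Qed.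

Lemma has_sumZ I (c : C) (x : I -> C) l : has_sum x l -> has_sum (fun i => c * x i) (c * l).
Proof.
move=> /has_sumP H; apply/has_sumP => e e0.
have c1 : 0 < nm c + 1 by rewrite ltr_wpDl ?nm_ge0.
have [A {}H] := H _ (divr_gt0 e0 c1); exists A => B /H k.
rewrite -mulr_sumr -mulrBr nmM.
have := ler_wpM2l (nm_ge0 c) (ltW k); move: k; rewrite ltr_pdivlMr //.
set S := nm (_ - _) => k _; have := nm_ge0 (\sum_(i <- B) x i - l); rewrite -/S; lra.
Qed.

Lemma has_sumN I (x : I -> C) l : has_sum x l -> has_sum (fun i => - x i) (- l).
Proof.
by move=> H; have := @has_sumZ I (-1) x l H; rewrite mulN1r; under eq_fun do rewrite mulN1r.
Qed.

Lemma ge0_has_sum I (y : I -> R) (M : R) : (forall i, 0 <= y i) ->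
  (forall A : {fset I}, \sum_(i <- A) y i <= M) -> exists l, has_sum (fun i => (y i)%:C) l.
Proof.
move=> y0 yM; pose S := [set \sum_(i <- A) y i | A in [set: {fset I}]].
have Sn : S !=set0 by exists (\sum_(i <- (fset0 : {fset I})) y i), fset0.
have Su : has_ubound S by exists M => _ [A _ <-].
exists (sup S)%:C; apply/has_sumP => e e0.
have [|_ [A _ <-] HA] := @sup_adherent R S e e0; first by split.
exists A => B AB; have BS : \sum_(i <- B) y i <= sup S by apply: ub_le_sup => //; exists B.
have : \sum_(i <- A) y i <= \sum_(i <- B) y i.
  by rewrite (sum_fsetU _ AB) lerDl sumr_ge0.
by rewrite -(rmorph_sum (real_complex R)) -rmorphB nm_real ltr_norml => ?; apply/andP; split; lra.
Qed.

(** The real and imaginary parts p(x) are differences of the nonnegative summable families |x| +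
    p(x) and |x|, to which the supremum argument applies. *)
Lemma abs_summable_ex I (x : I -> C) : abs_summable x -> exists l, has_sum x l.
Proof.
move=> [M HM].
have P (p : C -> R) : (forall z, `|p z| <= nm z) -> exists l, has_sum (fun i => (nm (x i) + p (x i))%:C) l.
  move=> pn; apply: (@ge0_has_sum _ _ (M + M)) => [i|A].
    by have := pn (x i); rewrite ler_norml => /andP[]; lra.
  rewrite big_split lerD //; apply: le_trans (HM A); apply: ler_sum => i _.
  exact: le_trans (ler_norm _) (pn _).
have [n Hn] := ge0_has_sum (fun i => nm_ge0 (x i)) HM.
have [a Ha] := P _ (fun z => (ReIm_nm z).1); have [b Hb] := P _ (fun z => (ReIm_nm z).2).
exists (a - n + 'i%C * (b - n)).
have := has_sumD (has_sumD Ha (has_sumN Hn)) (@has_sumZ _ 'i%C _ _ (has_sumD Hb (has_sumN Hn))).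
congr (has_sum _ _); apply: funext => i; rewrite !rmorphD /= [RHS]complexE.
by congr (_ + _ * _); rewrite addrC addKr.
Qed.

Lemma has_sum_le I (x : I -> C) l M : summable_by x M -> has_sum x l -> nm l <= M.
Proof.
move=> HM /has_sumP H; apply/ler_addgt0Pl => e e0; have [A HA] := H _ e0.
have k := HA A (fsubset_refl _); have := le_trans (nm_sum _ _ _) (HM A).
have := nm_sub_le l (\sum_(i <- A) x i); rewrite nmB; lra.
Qed.

Lemma summable_by_le I (x : I -> C) (y : I -> R) (M : R) :
  (forall i, nm (x i) <= y i) -> (forall A : {fset I}, \sum_(i <- A) y i <= M) -> summable_by x M.
Proof. by move=> xy HM A; apply: le_trans (HM A); apply: ler_sum => i _. Qed.

Lemma sum_reindex (V : nmodType) I J (f : I -> J) (g : J -> I) (x : J -> V) (A : {fset I}) :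
  cancel f g -> \sum_(i <- A) x (f i) = \sum_(j <- f @` A) x j.
Proof.
move=> fK; rewrite big_imfset //= => i j _ _; exact: (can_inj fK).
Qed.

Lemma has_sum_reindex I J (f : I -> J) (g : J -> I) (x : J -> C) l :
  cancel f g -> cancel g f -> has_sum x l -> has_sum (fun i => x (f i)) l.
Proof.
move=> fK gK /has_sumP H; apply/has_sumP => e e0; have [A HA] := H _ e0.
exists (g @` A) => B AB; rewrite (sum_reindex x B fK); apply: HA.
apply/fsubsetP => j jA; apply/imfsetP; exists (g j); rewrite ?gK //=.
by apply: (fsubsetP AB); apply/imfsetP; exists j.
Qed.

Lemma has_sum_fset I (x : I -> C) (A : {fset I}) :
  (forall i, i \notin A -> x i = 0) -> has_sum x (\sum_(i <- A) x i).
Proof.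
move=> H; apply/has_sumP => e e0; exists A => B AB.
rewrite (sum_fsetU _ AB) addrAC subrr add0r big_seq_cond big1 ?nm0 // => i.
by rewrite andbT inE => /andP[/H].
Qed.

(** Every finite set of pairs lies in the box of its two projections, over which the sum factors. *)
Lemma sum_fset_pair I J (x : I -> R) (y : J -> R) (M M' : R) (A : {fset I * J}) :
  (forall i, 0 <= x i) -> (forall j, 0 <= y j) ->
  (forall A : {fset I}, \sum_(i <- A) x i <= M) ->
  (forall A : {fset J}, \sum_(j <- A) y j <= M') ->
  \sum_(p <- A) (x p.1 * y p.2) <= M * M'.
Proof.
move=> x0 y0 HM HM'; set B1 := [fset p.1 | p in A]; set B2 := [fset p.2 | p in A].
pose B := B1 `*` B2.
have AB : A `<=` B.
  apply/fsubsetP => -[i j] ijA; rewrite in_fsetM /=; apply/andP; split.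
    by apply/imfsetP; exists (i, j).
  by apply/imfsetP; exists (i, j).
apply: (@le_trans _ _ (\sum_(p <- B) (x p.1 * y p.2))).
  by rewrite (sum_fsetU _ AB) lerDl sumr_ge0 // => p _; rewrite mulr_ge0.
rewrite /B big_imfset2 /=; last by move=> [? ?] [? ?] _ _ [-> ->].
have -> : \sum_(i <- B1) \sum_(j <- B2) (x i * y j) = (\sum_(i <- B1) x i) * (\sum_(j <- B2) y j).
  by rewrite mulr_suml; apply: eq_bigr => i _; rewrite mulr_sumr.
by apply: ler_pM => //; apply: sumr_ge0.
Qed.

Lemma summable_by_pair I J (x : I -> C) (y : J -> C) M M' :
  summable_by x M -> summable_by y M' ->
  summable_by (fun p : I * J => x p.1 * y p.2) (M * M').
Proof.
move=> HM HM' A; under eq_bigr do rewrite nmM.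
by apply: (sum_fset_pair (x := fun i => nm (x i)) (y := fun j => nm (y j))) => // ?; exact: nm_ge0.
Qed.

(** Some sum s exists by absolute summability, so it is enough to compare it with l l' on one finite
    box containing the sets that approximate l, l' and s; over a box the partial sum is a
    product. *)
Lemma has_sum_pair I J (x : I -> C) (y : J -> C) l l' : abs_summable x -> abs_summable y ->
  has_sum x l -> has_sum y l' -> has_sum (fun p : I * J => x p.1 * y p.2) (l * l').
Proof.
move=> [M HM] [M' HM'] Hx Hy.
have [s Hs] : exists s, has_sum (fun p : I * J => x p.1 * y p.2) s.
  by apply: abs_summable_ex; exists (M * M'); exact: summable_by_pair.
suff -> : l * l' = s by [].
have lM := has_sum_le HM Hx; have M'0 := summable_by_ge0 HM'.
apply: nm_small_eq => e e0.
pose K := nm l + M' + 1.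
have K0 : 0 < K by rewrite /K; have := nm_ge0 l; lra.
have e3 : 0 < e / (3 * K) by rewrite divr_gt0 // mulr_gt0.
have e3' : 0 < e / 3 by rewrite divr_gt0.
move/has_sumP: Hx => /(_ _ e3)[A HA]; move/has_sumP: Hy => /(_ _ e3)[B HB].
move/has_sumP: Hs => /(_ _ e3')[D HD].
pose A' := A `|` [fset p.1 | p in D]; pose B' := B `|` [fset p.2 | p in D].
pose E := A' `*` B'.
have DE : D `<=` E.
  apply/fsubsetP => -[i j] ijD; rewrite in_fsetM /=; apply/andP; split.
    by rewrite inE; apply/orP; right; apply/imfsetP; exists (i, j).
  by rewrite inE; apply/orP; right; apply/imfsetP; exists (i, j).
have := HD _ DE; have := HA A' (fsubsetUl _ _); have := HB B' (fsubsetUl _ _).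
have -> : \sum_(p <- E) (x p.1 * y p.2) = (\sum_(i <- A') x i) * (\sum_(j <- B') y j).
  rewrite /E big_imfset2 /=; last by move=> [? ?] [? ?] _ _ [-> ->].
  by rewrite mulr_suml; apply: eq_bigr => i _; rewrite mulr_sumr.
have bB : nm (\sum_(j <- B') y j) <= M' by apply: le_trans (nm_sum _ _ _) (HM' _).
move: bB; set a := \sum_(i <- A') _; set b := \sum_(i <- B') _ => bB kb ka ks.
have -> : l * l' - s = (a * b - s) - (a - l) * b - l * (b - l') by ring.
have := nmD (a * b - s - (a - l) * b) (- (l * (b - l'))).
have := nmD (a * b - s) (- ((a - l) * b)); rewrite !nmN !nmM.
have p1 : nm (a - l) * nm b <= e / (3 * K) * K.
  by apply: ler_pM; rewrite ?nm_ge0 ?(ltW ka) // /K; have := nm_ge0 l; lra.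
have p2 : nm l * nm (b - l') <= K * (e / (3 * K)).
  by apply: ler_pM; rewrite ?nm_ge0 ?(ltW kb) // /K; have := nm_ge0 l; lra.
have E3 : e / (3 * K) * K = e / 3 by field; rewrite gt_eqF.
rewrite (mulrC K) E3 in p2; rewrite E3 in p1; lra.
Qed.

End Summation.

(** * Taylor expansions and series of holomorphic functions *)

Section Holomorphic.
Variable R : realType.
Local Notation C := R[i].
Implicit Types (f g : C -> C) (c : C) (r : R).

Definition derivable_on_ball f c r := forall z : C, nm (z - c) < r -> exists l, hasd id f z l.

(** The value 6 / 10 exceeds 1 / 2, so clamping is the identity near the closed square; and 2 (6 /
    10)^2 < 1, so clamped points lie in the open unit disc. *)
Definition clamp1 (x : R) : R := Num.max (- (6 / 10)) (Num.min x (6 / 10)).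
(* [ccont] asks for continuity on the whole plane: composing with the clamp extends a
   function continuous on the unit disc, and does not change it on the square. *)
Definition clamp (z : C) : C := clamp1 (Re z) +i* clamp1 (Im z).

Lemma clamp1_id x : `|x| <= 6 / 10 -> clamp1 x = x.
Proof. by rewrite ler_norml /clamp1 => /andP[h1 h2]; rewrite (min_idPl h2) (max_idPr h1). Qed.

Lemma clamp1_le x : `|clamp1 x| <= 6 / 10.
Proof.
rewrite /clamp1 ler_norml le_max ge_max ge_min !lexx /= orbT andbT.
by lra.
Qed.

Lemma clamp1_lip x y : `|clamp1 x - clamp1 y| <= `|x - y|.
Proof.
rewrite ler_norml; have := ler_norm (x - y); have := ler_norm (y - x); rewrite (distrC y x) /clamp1.
have h : - (6 / 10) <= 6 / 10 :> R by lra.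
by case: (leP x (6 / 10)) => ?; case: (leP y (6 / 10)) => ?; rewrite ?(max_r h);
  case: (leP (- (6 / 10)) x) => ?; case: (leP (- (6 / 10)) y) => *; apply/andP; split; lra.
Qed.

Lemma nm_clamp (z : C) : nm (clamp z) < 1.
Proof.
have := clamp1_le (Re z); have := clamp1_le (Im z) => h1 h2.
rewrite -(ltr_pXn2r (n := 2)) ?nnegrE ?nm_ge0 // expr1n nm_sqr /=.
have : clamp1 (Re z) ^+ 2 <= (6 / 10) ^+ 2 by rewrite -real_normK ?num_real // lerXn2r ?nnegrE //; lra.
have : clamp1 (Im z) ^+ 2 <= (6 / 10) ^+ 2 by rewrite -real_normK ?num_real // lerXn2r ?nnegrE //; lra.
rewrite !expr2; lra.
Qed.

Lemma clamp_cont (z : C) (e : R) : 0 < e ->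
  exists2 d : R, 0 < d & forall h : C, nm h < d -> nm (clamp (z + h) - clamp z) < e.
Proof.
move=> e0; exists (e / 2); first by rewrite divr_gt0.
move=> h hd; apply: le_lt_trans (nm_ReIm _) _; rewrite ReB ImB /=.
have := clamp1_lip (Re (z + h)) (Re z); have := clamp1_lip (Im (z + h)) (Im z).
have -> : Re (z + h) - Re z = Re h by case: z h {hd} => ? ? [? ?] /=; ring.
have -> : Im (z + h) - Im z = Im h by case: z h {hd} => ? ? [? ?] /=; ring.
have [] := ReIm_nm h; lra.
Qed.

Lemma in_square_near (z : C) : in_square z -> nm z < 1 /\
  forall h : C, nm h < 1 / 10 -> clamp (z + h) = z + h.
Proof.
move=> [zx zy]; have cl (h : C) : nm h < 1 / 10 -> clamp (z + h) = z + h.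
  move=> hd; have [h1 h2] := ReIm_nm h; rewrite /clamp.
  have rE : Re (z + h) = Re z + Re h by case: z h {hd h1 h2 zx zy} => ? ? [].
  have iE : Im (z + h) = Im z + Im h by case: z h {hd h1 h2 zx zy rE} => ? ? [].
  rewrite !clamp1_id ?rE ?iE; first by apply: complex_ext.
    by apply: le_trans (ler_normD _ _) _; lra.
  by apply: le_trans (ler_normD _ _) _; lra.
split=> //; have zE : clamp z = z by have := cl 0; rewrite addr0 nm0; apply; lra.
by rewrite -zE nm_clamp.
Qed.

Definition remainder_le f c r (a : nat -> C) (B : R) := forall n (h : C), nm h <= r / 4 ->
  nm (f (c + h) - \sum_(j < n) a j * h ^+ j) <= B * (2 * (nm h / r)) ^+ n.

Definition cauchy_const : R := 32 / nm (winding R).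

Lemma cauchy_const_gt0 : 0 < cauchy_const.
Proof. by rewrite divr_gt0 ?nm_gt0 ?winding_neq0. Qed.

(** The disc is rescaled to the unit disc, and the Taylor formula on the square is applied to the
    clamped function. One sequence of coefficients serves both clauses: the first bound comes from
    continuity on the boundary of the square, with no bound on f assumed; the second is proportional
    to any bound of f, as needed to sum over families of functions. *)
Lemma taylor_ball f c r : 0 < r -> derivable_on_ball f c r ->
  exists a : nat -> C, (exists B, remainder_le f c r a B) /\
    forall M : R, (forall z : C, nm (z - c) < r -> nm (f z) <= M) ->
      remainder_le f c r a (cauchy_const * M).
Proof.
move=> r0 df; pose F (z : C) := f (c + r%:C * z).
have rC : (r%:C : C) != 0 by rewrite -nm_gt0 nm_real gtr0_norm.
have rz (z : C) : nm z < 1 -> nm (c + r%:C * z - c) < r.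
  by move=> z1; rewrite addrC addKr nmM nm_real gtr0_norm // gtr_pMr.
have dF (z : C) : nm z < 1 -> exists l, hasd id F z l.
  move=> /rz/df[l Hl]; exists (l * r%:C).
  apply: (hasd_comp (f := fun z => c + r%:C * z) Hl).
  by apply: hasd_eq (hasdD (hasd_cst _ _ c) (hasdZ _ (hasd_id z))) _; rewrite mulr1 add0r.
pose G (z : C) := F (clamp z).
have cG : ccont G.
  move=> z e e0; have [l Hl] := dF _ (nm_clamp z).
  have [d d0 Hd] := hasd_cont Hl e0; have [d' d'0 Hd'] := clamp_cont z d0.
  exists d' => // h /Hd'/Hd; rewrite /G /=; have -> // : clamp z + (clamp (z + h) - clamp z) = clamp (z + h).
  by ring.
have dG (z : C) : in_square z -> exists l, hasd id G z l.
  move=> /in_square_near[z1 zh]; have [l Hl] := dF z z1; exists l.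
  apply: (hasd_near (r := 1 / 10) _ _ _ Hl); first by rewrite divr_gt0.
    by move=> h /zh; rewrite /G => ->.
  by rewrite /G -[in clamp z](addr0 z) zh ?addr0 // nm0 divr_gt0.
have est M : (forall z, on_square z -> nm (G z) <= M) ->
    remainder_le f c r (fun j => taylor_coef G j / r%:C ^+ j) (cauchy_const * M).
  move=> HM n h hr; have hr' : nm (h / r%:C) <= 1 / 4.
    by rewrite nmM nmV nm_real gtr0_norm // ler_pdivrMr //; lra.
  have := taylor_square cG dG HM n hr'.
  have hs : in_square (h / r%:C).
    by split; (apply: (@le_trans _ _ (1 / 4)); [apply: le_trans hr'; rewrite ReIm_nm|lra]).
  have -> : G (h / r%:C) = f (c + h).
    rewrite /G -[in clamp _](addr0 (h / r%:C)) (in_square_near hs).2 ?addr0 ?nm0 ?divr_gt0 //.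
    by rewrite /F mulrC divfK.
  rewrite nmM nmV nm_real gtr0_norm //.
  have -> // : \sum_(j < n) taylor_coef G j * (h / r%:C) ^+ j = \sum_(j < n) taylor_coef G j / r%:C ^+ j * h ^+ j.
  by apply: eq_bigr => j _; rewrite exprMn exprVn; ring.
exists (fun j => taylor_coef G j / r%:C ^+ j); split; last first.
  by move=> M HM; apply: est => z _; apply: HM; apply: rz; exact: nm_clamp.
have [h1 h2 h3 h4] := ccont_bcont (- (1 / 2)) (1 / 2) (- (1 / 2)) (1 / 2) cG.
have [M1 H1] := rcont_bounded (qq R) h1; have [M2 H2] := rcont_bounded (qq R) h2.
have [M3 H3] := rcont_bounded (qq R) h3; have [M4 H4] := rcont_bounded (qq R) h4.
exists (cauchy_const * Num.max (Num.max M1 M2) (Num.max M3 M4)); apply: est => z [[zx zy] hz].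
have zE : z = (Re z)%:C + 'i%C * (Im z)%:C by exact: complexE.
rewrite ler_norml in zx; rewrite ler_norml in zy; rewrite !le_max.
case: hz => /eqP; rewrite eqr_norml => /andP[/orP[]/eqP hz _].
- by have := H4 _ zy; rewrite /vline -{1}hz -zE => ->; rewrite !orbT.
- by have := H3 _ zy; rewrite /vline -{1}hz -zE => ->; rewrite !orbT.
- by have := H2 _ zx; rewrite /hline -{1}hz -zE => ->; rewrite !orbT.
- by have := H1 _ zx; rewrite /hline -{1}hz -zE => ->.
Qed.

Lemma remainder_ge0 f c r (a : nat -> C) B : 0 < r -> remainder_le f c r a B -> 0 <= B.
Proof.
move=> r0 /(_ 0%N 0); rewrite nm0 expr0 mulr1 big_ord0 subr0 => H.
by apply: le_trans (nm_ge0 _) (H _); rewrite divr_ge0 // ltW.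
Qed.

Lemma remainder_coef0 f c r (a : nat -> C) B : 0 < r -> remainder_le f c r a B -> a 0%N = f c.
Proof.
move=> r0 /(_ 1%N 0); rewrite nm0 mul0r mulr0 expr1 mulr0 big_ord1 expr0 mulr1 addr0 nmB => K.
by apply: nm_small_eq => e e0; apply: le_trans (ltW e0); apply: K; rewrite divr_ge0 // ltW.
Qed.

(** By induction the remainder of order j + 1 reads |a_j| t^j <= B (2 t / r)^(j + 1) for small t >
    0; dividing by t^j and letting t tend to 0 gives a_j = 0. *)
Lemma remainder_zero f c r (a : nat -> C) (B rho : R) : 0 < r -> 0 < rho ->
  (forall h : C, nm h < rho -> f (c + h) = 0) ->
  remainder_le f c r a B -> forall j, a j = 0.
Proof.
move=> r0 rho0 f0 HB; elim/ltn_ind => j IH.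
apply: nm_small_eq => e e0; rewrite subr0.
have B0 := remainder_ge0 r0 HB.
pose K := B * (2 / r) ^+ j.+1 + 1.
have K0 : 0 < K by rewrite ltr_wpDl // mulr_ge0 // exprn_ge0 // divr_ge0 // ltW.
pose t := Num.min (Num.min (rho / 2) (r / 4)) (e / K).
have t0 : 0 < t by rewrite !lt_min !divr_gt0.
have [tr t4 te] : [/\ t <= rho / 2, t <= r / 4 & t <= e / K].
  by rewrite /t !ge_min !lexx ?orbT.
have nt : nm (t%:C : C) = t by rewrite nm_real gtr0_norm.
have := HB j.+1 t%:C; rewrite nt => /(_ t4); rewrite f0 ?nt; last by lra.
rewrite big_ord_recr /= big1 ?add0r; last by move=> i _; rewrite IH ?mul0r //.
rewrite nmN nmM nmX nt => H.
have {}H : nm (a j) <= B * (2 / r) ^+ j.+1 * t.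
  rewrite -(ler_pM2r (exprn_gt0 j t0)); apply: le_trans H _.
  rewrite le_eqVlt; apply/orP; left; apply/eqP.
  by rewrite (_ : 2 * (t / r) = 2 / r * t) ?exprMn ?(exprS t); ring.
apply: le_trans H _; apply: (@le_trans _ _ (K * t)); first by rewrite ler_wpM2r ?ltW // /K; lra.
by rewrite mulrC -ler_pdivlMr.
Qed.

(** All Taylor coefficients vanish, and for |h| <= r / 4 the remainder of order n is at most B /
    2^n. *)
Lemma identity_ball f c r rho : 0 < r -> 0 < rho -> derivable_on_ball f c r ->
  (forall h : C, nm h < rho -> f (c + h) = 0) -> forall h : C, nm h <= r / 4 -> f (c + h) = 0.
Proof.
move=> r0 rho0 df f0 h hr; have [a [[B HB] _]] := taylor_ball r0 df.
have a0 := remainder_zero r0 rho0 f0 HB.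
apply: nm_small_eq => e e0; rewrite subr0.
have [n nB] := pow2_small B e0.
have := HB n h hr; rewrite big1 ?subr0; last by move=> i _; rewrite a0 mul0r.
move/le_trans; apply; apply: le_trans (ltW nB); rewrite -exprVn.
have B0 := remainder_ge0 r0 HB.
apply: ler_wpM2l => //; apply: lerXn2r; rewrite ?nnegrE ?mulr_ge0 ?divr_ge0 ?invr_ge0 ?nm_ge0 ?(ltW r0) //.
by have : nm h / r <= 1 / 4 by [rewrite ler_pdivrMr //; lra]; lra.
Qed.

Lemma identity_halfplane f (s : R) : (forall z, exists l, hasd id f z l) ->
  (forall z : C, s < Re z -> f z = 0) -> forall z, f z = 0.
Proof.
move=> df f0 z; pose c : C := (s + 1)%:C.
have -> : z = c + (z - c) by ring.
(* The radius is chosen so that z lies within a quarter of it from c. As f is entire, one disc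
   reaches z and no chain of discs is needed. *)
apply: (@identity_ball f c (4 * nm (z - c) + 1) 1) => //.
- by have := nm_ge0 (z - c); lra.
- move=> h h1; apply: f0; have [h2 _] := ReIm_nm h.
  have -> : Re (c + h) = s + 1 + Re h by rewrite /c; case: (h).
  by move: h2; rewrite ler_norml => /andP[]; lra.
- by lra.
Qed.

Lemma taylor_quadratic f c r (M : R) : 0 < r -> derivable_on_ball f c r ->
  (forall z : C, nm (z - c) < r -> nm (f z) <= M) ->
  exists d : C, forall h : C, nm h <= r / 4 ->
    nm (f (c + h) - f c - h * d) <= cauchy_const * M * (2 / r) ^+ 2 * nm h ^+ 2.
Proof.
move=> r0 df HM; have [a [_ /(_ M HM) H]] := taylor_ball r0 df.
exists (a 1%N) => h hr.
have := H 2%N h hr; rewrite big_ord_recr big_ord1 /= expr0 mulr1 expr1 (remainder_coef0 r0 H) opprD addrA (mulrC (a 1%N)).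
move/le_trans; apply; rewrite le_eqVlt; apply/orP; left; apply/eqP.
by rewrite !expr2; ring.
Qed.

Lemma hasd_quadratic f c d (K r : R) : 0 < r ->
  (forall h : C, nm h <= r -> nm (f (c + h) - f c - h * d) <= K * nm h ^+ 2) ->
  hasd id f c d.
Proof.
move=> r0 H e e0; pose L := `|K| + 1.
have L0 : 0 < L by rewrite ltr_wpDl.
exists (Num.min r (e / L)); first by rewrite lt_min r0 divr_gt0.
move=> h; rewrite lt_min => /andP[/ltW/H h1 h2]; apply: le_trans h1 _.
rewrite expr2 mulrA ler_wpM2r ?nm_ge0 //.
apply: (@le_trans _ _ (L * nm h)).
  by rewrite ler_wpM2r ?nm_ge0 // /L; have := ler_norm K; lra.
by rewrite mulrC -ler_pdivlMr // ltW.
Qed.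

(* Weierstrass: the Taylor remainders are summable uniformly in h. *)
Lemma has_sum_derivable (I : choiceType) (F : I -> C -> C) (f : C -> C) c r (m : I -> R) (M : R) :
  0 < r -> (forall i, derivable_on_ball (F i) c r) ->
  (forall i (z : C), nm (z - c) < r -> nm (F i z) <= m i) ->
  (forall A : {fset I}, \sum_(i <- A) m i <= M) ->
  (forall z : C, nm (z - c) < r -> has_sum (fun i => F i z) (f z)) ->
  exists d, hasd id f c d.
Proof.
move=> r0 dF Fm HM Hf.
have [d Hd] := choice (fun i => taylor_quadratic r0 (dF i) (Fm i)).
pose k := cauchy_const * (2 / r) ^+ 2.
have r4 : 0 < r / 4 by rewrite divr_gt0.
have r44 : r / 4 < r by rewrite ltr_pdivrMr //; lra.
have k0 : 0 <= k.
  apply: mulr_ge0; first exact: ltW cauchy_const_gt0.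
  by apply: exprn_ge0; apply: divr_ge0 => //; exact: ltW.
have cr : nm (c - c) < r by rewrite subrr nm0.
(* The derivatives d i are bounded by the m i up to a constant: the quadratic estimate at h = r / 4
   is solved for d i. *)
have sd : abs_summable d.
  exists ((k * (r / 4) ^+ 2 + 2) / (r / 4) * M) => A.
  apply: (@le_trans _ _ (\sum_(i <- A) ((k * (r / 4) ^+ 2 + 2) / (r / 4) * m i))); last first.
    by rewrite -mulr_sumr ler_wpM2l // divr_ge0 ?(ltW r4) // addr_ge0 // mulr_ge0 // exprn_ge0 ?(ltW r4).
  apply: ler_sum => i _; pose h : C := (r / 4)%:C.
  have nh : nm h = r / 4 by rewrite nm_real gtr0_norm.
  have hr : nm (c + h - c) < r by rewrite addrC addKr nh.
  have := Hd i h; rewrite nh lexx => /(_ isT) H.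
  rewrite mulrAC ler_pdivlMr // -nh -nmM.
  have -> : d i * h = (F i (c + h) - F i c) - (F i (c + h) - F i c - h * d i) by ring.
  apply: le_trans (nmD _ _) _; rewrite nmN nh.
  have := nmD (F i (c + h)) (- F i c); rewrite nmN.
  have := Fm i _ hr; have := Fm i _ cr.
  have -> : (k * (r / 4) ^+ 2 + 2) * m i = cauchy_const * m i * (2 / r) ^+ 2 * (r / 4) ^+ 2 + 2 * m i by rewrite /k; ring.
  by lra.
have [D HD] := abs_summable_ex sd; exists D.
apply: (@hasd_quadratic f c D (k * M) (r / 4) r4) => h hr.
have hr' : nm (c + h - c) < r by rewrite addrC addKr; lra.
have := has_sumD (has_sumD (Hf _ hr') (has_sumN (Hf _ cr))) (has_sumN (@has_sumZ _ _ h _ _ HD)).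
apply: has_sum_le; apply: (@summable_by_le _ _ _ (fun i => k * nm h ^+ 2 * m i)).
  move=> i; apply: le_trans (Hd i h hr) _; rewrite le_eqVlt; apply/orP; left; apply/eqP.
  by rewrite /k; ring.
move=> A; rewrite -mulr_sumr [k * M * _]mulrAC; apply: ler_wpM2l => //.
by apply: mulr_ge0 => //; apply: exprn_ge0; exact: nm_ge0.
Qed.

End Holomorphic.

(** * Finite differences *)

Section Differences.
Variable R : realType.
Local Notation C := R[i].

Definition diff (V : zmodType) (l : V) (g : V -> C) (x : V) : C := g x - g (x - l).

Section Iterates.
Variables (V : zmodType) (l : V).
Implicit Types (f g : V -> C).

Lemma iter_diffS p g x : iter p.+1 (diff l) g x = iter p (diff l) g x - iter p (diff l) g (x - l).
Proof. by []. Qed.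

Lemma iter_diff_lin p f g (c d : C) x :
  iter p (diff l) (fun x => c * f x + d * g x) x
  = c * iter p (diff l) f x + d * iter p (diff l) g x.
Proof. by elim: p x => [//|p IH] x; rewrite !iter_diffS !IH; ring. Qed.

Lemma iter_diff_le p g x (M : R) :
  (forall j, (j <= p)%N -> nm (g (x - l *+ j)) <= M) -> nm (iter p (diff l) g x) <= 2 ^+ p * M.
Proof.
elim: p x => [|p IH] x H; first by rewrite expr0 mul1r; have := H 0%N isT; rewrite mulr0n subr0.
rewrite iter_diffS exprS -mulrA mulr_natl mulr2n; apply: le_trans (nmD _ _) _; rewrite nmN lerD //.
  by apply: IH => j jp; apply: H; exact: leqW.
by apply: IH => j jp; rewrite -addrA -opprD -mulrS; apply: H.
Qed.

Lemma eq_iter_diff p f g x : f =1 g -> iter p (diff l) f x = iter p (diff l) g x.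
Proof. by move=> fg; elim: p x => [|p IH] x; rewrite ?iter_diffS ?IH //=. Qed.

End Iterates.

Lemma iter_diff_comp (V W : zmodType) (l : V) (m : W) (e : W -> V) p (g : V -> C) x :
  (forall x, e (x - m) = e x - l) ->
  iter p (diff m) (fun y => g (e y)) x = iter p (diff l) g (e x).
Proof.
move=> He; elim: p x => [//|p IH] x.
by rewrite !iter_diffS !IH He.
Qed.

Lemma iter_diff_hasd p (lam : C) (g g' : C -> C) (w : C) (t : R) :
  (forall j, (j <= p)%N ->
     hasd (real_complex R) (fun t => g (w - t%:C * lam)) (t + j%:R) (g' (w - (t + j%:R)%:C * lam))) ->
  hasd (real_complex R) (fun t => iter p (diff lam) g (w - t%:C * lam)) t
    (iter p (diff lam) g' (w - t%:C * lam)).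
Proof.
elim: p t => [|p IH] t H; first by have := H 0%N isT; rewrite addr0.
have S (u : R) : w - u%:C * lam - lam = w - (u + 1)%:C * lam by rewrite rmorphD mulrDl mul1r opprD addrA.
have H1 : hasd (real_complex R) (fun t => iter p (diff lam) g (w - t%:C * lam)) t
    (iter p (diff lam) g' (w - t%:C * lam)).
  by apply: IH => j jp; apply: H; exact: leqW.
have H2 : hasd (real_complex R) (fun t => iter p (diff lam) g (w - t%:C * lam)) (t + 1)
    (iter p (diff lam) g' (w - (t + 1)%:C * lam)).
  by apply: IH => j jp; rewrite -addrA -[1 + j%:R](natrD _ 1 j); apply: H.
rewrite iter_diffS S.
apply: (hasd_ext (f := fun t => iter p (diff lam) g (w - t%:C * lam) - iter p (diff lam) g (w - (t + 1)%:C * lam))).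
  by move=> u; rewrite iter_diffS S.
apply: hasdB => // e e0; have [D D0 HD] := H2 e e0; exists D => // h /HD.
by rewrite (addrAC t 1 h).
Qed.

(** A two-sided bound on r makes the sign of the exponent irrelevant, and the integral exponent X
    keeps the result polynomial in Q. *)
Lemma powR_le (r Q x : R) (X : nat) : 1 <= Q -> 0 < r -> Q^-1 <= r <= Q -> `|x| <= X%:R ->
  r `^ x <= Q ^+ X.
Proof.
move=> Q1 r0 /andP[h1 h2] hx; have Q0 : 0 < Q by exact: lt_le_trans Q1.
have le (u y : R) : 0 < u -> u <= Q -> 0 <= y -> y <= X%:R -> u `^ y <= Q ^+ X.
  move=> u0 uQ y0 yX; apply: (@le_trans _ _ (Q `^ y)).
    by apply: ge0_ler_powR => //; rewrite nnegrE ltW.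
  by rewrite -powR_mulrn ?(ltW Q0) //; exact: ler_powR.
have [x0|x0] := leP 0 x; first by apply: le => //; apply: le_trans hx; exact: ler_norm.
have -> : r `^ x = (r^-1) `^ (- x).
  by rewrite -powR_inv1 ?(ltW r0) // -powRrM mulN1r opprK.
apply: le; rewrite ?invr_gt0 ?oppr_ge0 ?(ltW x0) //.
  by rewrite -[Q]invrK lef_pV2 ?posrE ?invr_gt0.
by rewrite -ler0_norm // ltW.
Qed.

Lemma powR_le_ratio (r1 r2 Q x : R) (X : nat) : 1 <= Q -> 0 < r1 -> 0 < r2 ->
  r2 <= Q * r1 -> r1 <= Q * r2 -> `|x| <= X%:R -> r1 `^ x <= Q ^+ X * r2 `^ x.
Proof.
move=> Q1 h1 h2 h3 h4 hx; rewrite -[r1 in leLHS](divfK (lt0r_neq0 h2)) powRM ?(ltW h2) ?divr_ge0 ?(ltW h1) //.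
rewrite ler_wpM2r ?powR_ge0 //; apply: powR_le => //; first exact: divr_gt0.
  rewrite ler_pdivrMr // h4 andbT ler_pdivlMr // mulrC ler_pdivrMr ?(lt_le_trans _ Q1) //.
  by rewrite mulrC.
exact: ltW.
Qed.

(* w^-a conj(w)^-b |w|^-2s; it vanishes at w = 0 when a > 0, because 0^-1 = 0. *)
Definition ksym (a b : nat) (s w : C) : C :=
  w^-1 ^+ a * (conjc w)^-1 ^+ b * expC (- s * (ln (nm w ^+ 2))%:C).

Lemma nm_ksym a b s w : w != 0 -> nm (ksym a b s w) = nm w `^ (- (a%:R + b%:R + 2 * Re s)).
Proof.
move=> w0; have n0 : 0 < nm w by rewrite nm_gt0.
rewrite /ksym nmM nm_expC nmM !nmX !nmV nmJ ReM /= mulr0 subr0.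
have -> : - (a%:R + b%:R + 2 * Re s) = - a%:R + - b%:R + - (2 * Re s) by ring.
have P (x y : R) : nm w `^ (x + y) = nm w `^ x * nm w `^ y.
  by apply: powRD; rewrite (gt_eqF n0) implybT.
rewrite !P !powR_invn ?nm_ge0 // !exprVn; congr (_ * _).
rewrite /powR gt_eqF //; congr expR; rewrite lnXn //.
have -> : Re (- s) = - Re s by case: (s).
by rewrite mulr2n; ring.
Qed.

Lemma hasd_line (w lam : C) (t : R) : hasd (real_complex R) (fun t => w - t%:C * lam) t (- lam).
Proof.
have := hasdB (hasd_cst (real_complex R) t w) (hasdM (hasd_real t) (hasd_cst _ t lam)).
by move/hasd_eq; apply; ring.
Qed.

Lemma hasd_conj (f : R -> C) t d : hasd (real_complex R) f t d ->
  hasd (real_complex R) (fun t => conjc (f t)) t (conjc d).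
Proof.
move=> H e /H[D D0 HD]; exists D => // h /HD.
have -> // : conjc (f (t + h)) - conjc (f t) - h%:C * conjc d = conjc (f (t + h) - f t - h%:C * d).
  by case: (f (t + h)) (f t) d {H HD} => ? ? [? ?] [? ?]; apply: complex_ext => /=; ring.
by rewrite nmJ.
Qed.

Lemma nm_sqrC (z : C) : (nm z ^+ 2)%:C = z * conjc z.
Proof. by rewrite rmorphXn /= -norm_nm sqr_normc. Qed.

Lemma hasd_lnnm (f : R -> C) t d : f t != 0 -> hasd (real_complex R) f t d ->
  hasd (real_complex R) (fun t => (ln (nm (f t) ^+ 2))%:C) t (d / f t + conjc d / conjc (f t)).
Proof.
move=> f0 H; have n0 : 0 < nm (f t) ^+ 2 by rewrite exprn_gt0 // nm_gt0.
have fJ : conjc (f t) != 0 by rewrite conjc_eq0.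
pose D := d * conjc (f t) + f t * conjc d.
have H1 : hasd (real_complex R) (fun t => (nm (f t) ^+ 2)%:C) t D.
  by apply: hasd_ext (hasdM H (hasd_conj H)) => u; rewrite nm_sqrC.
have DE : D = (Re D)%:C.
  apply: complex_ext => //; rewrite /D; case: (d) (f t) => ? ? [? ?] /=; ring.
rewrite DE in H1; move/rhasdP: H1 => H1.
have H2 := @is_derive1_comp R (@ln R) (fun t => nm (f t) ^+ 2) t _ _ (is_derive1_ln n0) H1.
move/rhasdP: H2 => /hasd_eq; apply.
by rewrite rmorphM /= -DE fmorphV /= nm_sqrC /D; field; rewrite f0 fJ.
Qed.

(** |w|^-2s is not holomorphic in w, so a derivative along a line involves both w and its conjugate;
    the two exponents a and b make the family closed under such derivatives. *)
Lemma hasd_ksym a b s (w lam : C) (t : R) : w - t%:C * lam != 0 ->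
  hasd (real_complex R) (fun t => ksym a b s (w - t%:C * lam)) t
    (lam * (a%:R + s) * ksym a.+1 b s (w - t%:C * lam)
     + conjc lam * (b%:R + s) * ksym a b.+1 s (w - t%:C * lam)).
Proof.
move=> z0; have zJ : conjc (w - t%:C * lam) != 0 by rewrite conjc_eq0.
have L := hasd_line w lam t.
have H1 := hasdX a (hasd_comp (f := fun t => w - t%:C * lam) (hasdV z0) L).
have H2 := hasdX b (hasd_comp (f := fun t => conjc (w - t%:C * lam)) (hasdV zJ) (hasd_conj L)).
have H3 := hasd_comp (f := fun t => - s * (ln (nm (w - t%:C * lam) ^+ 2))%:C) (hasd_expC _)
  (hasdZ (- s) (hasd_lnnm z0 L)).
have := hasdM (hasdM H1 H2) H3; move/hasd_eq; apply.
have P (z : C) n : z != 0 -> n%:R * z^-1 ^+ n.-1 * - z ^- 2 = - (n%:R * z^-1 ^+ n.+1).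
  by case: n => [|n] zn0; [rewrite !mul0r oppr0|rewrite /= mulrN -exprVn -mulrA -exprD addn2].
rewrite /ksym; set z := w - t%:C * lam in z0 zJ *; set E := expC _.
have -> : a%:R * z^-1 ^+ a.-1 * (- z ^- 2 * - lam) = lam * (a%:R * z^-1 ^+ a.+1).
  by rewrite mulrA P //; ring.
have -> : b%:R * (conjc z)^-1 ^+ b.-1 * (- (conjc z) ^- 2 * conjc (- lam)) = conjc lam * (b%:R * (conjc z)^-1 ^+ b.+1).
  by rewrite mulrA P // rmorphN; ring.
by rewrite rmorphN !exprS; ring.
Qed.

(** Each difference is estimated by a derivative along the segment from w to w - lam; this raises a
    or b by one and so gains a factor |lam| / |w|. The condition 2 p |lam| <= |w| keeps all shifted
    points off 0. *)
Lemma diff_ksym_le p (S : nat) a b : exists2 K : R, 0 <= K & forall s w lam : C,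
  nm s <= S%:R -> w != 0 -> (2 * p)%:R * nm lam <= nm w ->
  nm (iter p (diff lam) (ksym a b s) w) <= K * nm lam ^+ p * nm w `^ (- (a%:R + b%:R + 2 * Re s + p%:R)).
Proof.
elim: p a b => [|p IH] a b.
  by exists 1 => // s w lam _ w0 _; rewrite expr0 !mul1r addr0 nm_ksym.
have [K1 K10 H1] := IH a.+1 b; have [K2 K20 H2] := IH a b.+1.
(* It bounds the absolute value of the exponent. As |w - t lam| and |w| differ by a factor at most
   2, replacing one by the other costs 2^X. *)
pose X := (a + b + 2 * S + p.+1)%N.
exists (2 * (((a + S)%:R * K1 + (b + S)%:R * K2) * 2 ^+ X)).
  by rewrite !mulr_ge0 ?addr_ge0 ?mulr_ge0 // exprn_ge0.
move=> s w lam sS w0 lw.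
have n0 : 0 < nm w by rewrite nm_gt0.
have l0 := nm_ge0 lam.
have lw2 : 2 * nm lam <= nm w.
  apply: le_trans lw; rewrite ler_wpM2r // ler_nat; lia.
have lwp : (2 * p)%:R * nm lam + 2 * nm lam <= nm w.
  by rewrite -mulrDl -natrD; have -> : (2 * p + 2 = 2 * p.+1)%N by lia.
have pl0 : 0 <= (2 * p)%:R * nm lam by rewrite mulr_ge0.
have tz (t : R) : 0 <= t <= 1 -> [/\ nm w / 2 <= nm (w - t%:C * lam), nm (w - t%:C * lam) <= 2 * nm w
    & (2 * p)%:R * nm lam <= nm (w - t%:C * lam)].
  move=> /andP[t0 t1]; have tl : nm (t%:C * lam) <= nm lam.
    by rewrite nmM nm_real ger0_norm // ler_piMl.
  have := nm_sub_le w (t%:C * lam); have := nmD w (- (t%:C * lam)); rewrite nmN => k1 k2.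
  by split; lra.
have tj (t : R) j : 0 <= t <= 1 -> (j <= p)%N -> w - (t + j%:R)%:C * lam != 0.
  move=> /andP[t0 t1] jp; have jpR : (j%:R : R) <= p%:R by rewrite ler_nat.
  rewrite -nm_gt0; have := nm_sub_le w ((t + j%:R)%:C * lam).
  rewrite nmM nm_real ger0_norm ?addr_ge0 //.
  have : (t + j%:R) * nm lam <= (1 + p%:R) * nm lam by rewrite ler_wpM2r //; lra.
  move: lwp; rewrite natrM; lra.
pose g' z := lam * (a%:R + s) * ksym a.+1 b s z + conjc lam * (b%:R + s) * ksym a b.+1 s z.
have D (t : R) : 0 <= t <= 1 -> hasd (real_complex R) (fun t => iter p (diff lam) (ksym a b s) (w - t%:C * lam)) t
    (iter p (diff lam) g' (w - t%:C * lam)).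
  by move=> t01; apply: iter_diff_hasd => j jp; apply: hasd_ksym; exact: tj.
pose Y := a%:R + b%:R + 2 * Re s + p.+1%:R.
have Rs : `|Re s| <= S%:R by apply: le_trans sS; rewrite ReIm_nm.
have YX : `|- Y| <= X%:R.
  have -> : X%:R = a%:R + b%:R + 2 * S%:R + p.+1%:R :> R by rewrite -natrM -!natrD.
  rewrite normrN /Y; move: Rs; rewrite !ler_norml => /andP[r1 r2].
  have a0 : 0 <= a%:R :> R by []. have b0 : 0 <= b%:R :> R by []. have p0 : 0 <= p.+1%:R :> R by [].
  by apply/andP; split; lra.
have B (t : R) : 0 <= t <= 1 -> nm (iter p (diff lam) g' (w - t%:C * lam)) <=
   ((a + S)%:R * K1 + (b + S)%:R * K2) * 2 ^+ X * nm lam ^+ p.+1 * nm w `^ (- Y).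
  move=> t01; have [z1 z2 z3] := tz t t01; have z0 : w - t%:C * lam != 0.
    by have := tj t 0%N t01 isT; rewrite addr0.
  have nz : 0 < nm (w - t%:C * lam) by rewrite nm_gt0.
  rewrite iter_diff_lin; have := H1 s _ lam sS z0 z3; have := H2 s _ lam sS z0 z3.
  set z := w - t%:C * lam in z1 z2 z3 z0 nz *.
  have -> : - (a%:R + b.+1%:R + 2 * Re s + p%:R) = - Y by rewrite /Y -!natr1; ring.
  have -> : - (a.+1%:R + b%:R + 2 * Re s + p%:R) = - Y by rewrite /Y -!natr1; ring.
  have zw : nm z `^ (- Y) <= 2 ^+ X * nm w `^ (- Y).
    by apply: powR_le_ratio => //; [lra|lra].
  move=> h2 h1; apply: le_trans (nmD _ _) _; rewrite !nmM nmJ.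
  have sa (c : nat) : nm (c%:R + s) <= (c + S)%:R.
    by apply: le_trans (nmD _ _) _; rewrite nm_nat natrD lerD2l.
  have P (c : nat) (K : R) (v : C) : 0 <= K -> nm v <= K * nm lam ^+ p * nm z `^ (- Y) ->
      nm lam * nm (c%:R + s) * nm v <= (c + S)%:R * K * 2 ^+ X * nm lam ^+ p.+1 * nm w `^ (- Y).
    move=> K0 hv; have -> : (c + S)%:R * K * 2 ^+ X * nm lam ^+ p.+1 * nm w `^ (- Y)
       = nm lam * (c + S)%:R * (K * nm lam ^+ p * (2 ^+ X * nm w `^ (- Y))) by rewrite exprS; ring.
    apply: ler_pM; rewrite ?mulr_ge0 ?nm_ge0 ?ler_wpM2l //.
    apply: le_trans hv _; apply: ler_wpM2l zw; apply: mulr_ge0 => //; exact: exprn_ge0.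
  have := lerD (P a K1 _ K10 h1) (P b K2 _ K20 h2); rewrite !mulrDl; exact.
have := @mvt_le R (fun t => iter p (diff lam) (ksym a b s) (w - t%:C * lam)) _ 0 1 _ ler01 D B.
rewrite rmorph0 rmorph1 mul0r mul1r !subr0 mulr1 nmB iter_diffS -/Y.
move/le_trans; apply; rewrite le_eqVlt; apply/orP; left; apply/eqP; ring.
Qed.

End Differences.

(** * Lattice sums *)

Section LatticeSums.
Variable R : realType.
Local Notation C := R[i].

Lemma sum_powR_le (e : R) (n : nat) : 0 < e ->
  \sum_(i < n) (i.+1%:R : R) `^ (- (1 + e)) <= 1 + e^-1.
Proof.
move=> e0; case: n => [|n]; first by rewrite big_ord0 addr_ge0 // invr_ge0 ltW.
(* The claim is strengthened to a telescoping form: e^-1 (1 - N^-e) is the integral of x^-(1 + e)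
   from 1 to N. *)
suff : \sum_(i < n.+1) (i.+1%:R : R) `^ (- (1 + e)) <= 1 + e^-1 * (1 - n.+1%:R `^ (- e)).
  move/le_trans; apply; have ei : 0 <= e^-1 by rewrite invr_ge0 ltW.
  have := mulr_ge0 ei (powR_ge0 (n.+1%:R : R) (- e)); rewrite mulrBr mulr1; lra.
elim: n => [|n IH]; first by rewrite big_ord1 !powR1 subrr mulr0 addr0.
rewrite big_ord_recr /=; apply: le_trans (lerD IH (lexx _)) _.
set N : R := n.+1%:R; set r : R := n.+2%:R.
have N0 : 0 < N by rewrite ltr0n.
have r0 : 0 < r by rewrite ltr0n.
have rN : r = N + 1 by rewrite /r -natr1.
clear IH; clearbody r N.
have key : r `^ (- e) * (1 + e / r) <= N `^ (- e).
  have -> : N `^ (- e) = r `^ (- e) * (N / r) `^ (- e).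
    by rewrite -powRM ?divr_ge0 ?ltW // mulrC divfK // gt_eqF.
  rewrite ler_wpM2l ?powR_ge0 //.
  have q0 : 0 < N / r by rewrite divr_gt0.
  have l1 : ln (N / r) <= N / r - 1.
    move: q0; generalize (N / r) => q q0.
    by have := expR_ge1Dx (ln q); rewrite lnK ?posrE //; lra.
  rewrite /powR gt_eqF //; apply: le_trans (expR_ge1Dx _).
  have -> : e / r = - e * (N / r - 1) by rewrite rN; field; apply: lt0r_neq0; lra.
  by rewrite lerD2l !mulNr lerN2 ler_wpM2l // ltW.
have rp : r `^ (- (1 + e)) = r `^ (- e) / r.
  have -> : - (1 + e) = - e + (- 1) by ring.
  rewrite powRD; last by rewrite (gt_eqF r0) implybT.
  by rewrite powR_inv1 // ltW.
rewrite rp -lerBrDl.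
have -> : 1 + e^-1 * (1 - r `^ (- e)) - (1 + e^-1 * (1 - N `^ (- e))) = (N `^ (- e) - r `^ (- e)) / e.
  by field; rewrite gt_eqF.
by rewrite ler_pdivlMr //; move: key; rewrite mulrDr mulr1 mulrA -[_ * e / r]mulrAC; lra.
Qed.

Lemma sum_int_le (e : R) (A : {fset int}) : 0 < e ->
  \sum_(m <- A) (1 + `|m%:~R|) `^ (- (1 + e)) <= 2 * (1 + e^-1).
Proof.
move=> e0; pose h (m : int) : R := (1 + `|m%:~R|) `^ (- (1 + e)).
have [n nE] : exists n, n = (\max_(m <- A) `|m|%N).+1 := ex_intro _ _ erefl.
pose s := map Posz (iota 0 n) ++ map Negz (iota 0 n).
have us : uniq s.
  rewrite cat_uniq !map_inj_uniq ?iota_uniq /= ?andbT; try by move=> ? ? [].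
  by apply/hasPn => _ /mapP[i _ ->]; apply/mapP => -[].
have As : {subset A <= s}.
  move=> m mA; have mn : (`|m| < n)%N by rewrite nE ltnS; exact: leq_bigmax_seq.
  rewrite mem_cat; case: m mA mn => i _ mn; apply/orP; [left|right].
    by apply/mapP; exists i => //; rewrite mem_iota.
  by apply/mapP; exists i => //; rewrite mem_iota /= add0n; apply: ltnW.
pose B : {fset int} := seq_fset tt s.
have AB : (A `<=` B)%fset by apply/fsubsetP => m /As; rewrite /B seq_fsetE.
apply: (@le_trans _ _ (\sum_(m <- B) h m)).
  by rewrite (sum_fsetU _ AB) lerDl sumr_ge0 // => m _; exact: powR_ge0.
have -> : \sum_(m <- B) h m = \sum_(m <- s) h m.
  by apply: perm_big; apply: uniq_perm => // m; rewrite seq_fsetE.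
rewrite big_cat !big_map mulr_natl mulr2n; apply: lerD.
  apply: le_trans (sum_powR_le n e0); rewrite -{1}[n]subn0 -/(index_iota 0 n) big_mkord.
  apply: ler_sum => i _; rewrite /h /= -natr1 addrC ger0_norm // .
apply: le_trans (sum_powR_le n.+1 e0); rewrite -{1}[n]subn0 -/(index_iota 0 n) big_mkord.
rewrite [leRHS]big_ord_recl /= -[leLHS]add0r; apply: lerD; first exact: powR_ge0.
apply: ler_sum => i _; rewrite /h NegzE mulrNz normrN ger0_norm //.
Qed.

(** A size of the index that does not involve tau, so that different tau can share a summable
    majorant; the summand 1 keeps its negative powers bounded at the index 0. *)
Definition lsize (x : int * int) : R := 1 + `|x.1%:~R| + `|x.2%:~R|.

Lemma lsize_ge1 x : 1 <= lsize x.
Proof. by rewrite /lsize -addrA lerDl addr_ge0. Qed.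

Lemma lsize_gt0 x : 0 < lsize x. Proof. exact: lt_le_trans (lsize_ge1 x). Qed.

(** Since (1 + |m|)(1 + |n|) <= (1 + |m| + |n|)^2, the sum is dominated by a product of two
    one-variable sums with exponent y / 2 > 1. *)
Lemma lsize_summable (y : R) : 2 < y ->
  exists M : R, forall A : {fset int * int}, \sum_(x <- A) lsize x `^ (- y) <= M.
Proof.
move=> y2; pose e := y / 2 - 1; have e0 : 0 < e by rewrite /e; lra.
pose h (m : int) : R := (1 + `|m%:~R|) `^ (- (1 + e)).
exists ((2 * (1 + e^-1)) * (2 * (1 + e^-1))) => A.
apply: (@le_trans _ _ (\sum_(x <- A) (h x.1 * h x.2))); last first.
  by apply: sum_fset_pair => [?|?|B|B]; rewrite ?powR_ge0 //; exact: sum_int_le.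
apply: ler_sum => -[m n] _; rewrite /h /= -powRM ?addr_ge0 //.
have -> : - y = 2 * - (1 + e) by rewrite /e; field.
rewrite powRrM -[2]/(2%:R) powR_mulrn; last exact: ltW (lsize_gt0 _).
set u : R := 1 + e; have u0 : 0 <= u by rewrite /u; lra.
rewrite !powRN lef_pV2 ?posrE ?powR_gt0 ?exprn_gt0 ?lsize_gt0 ?mulr_gt0 ?ltr_wpDr //.
apply: ge0_ler_powR => //; rewrite ?nnegrE ?mulr_ge0 ?addr_ge0 ?exprn_ge0 ?(ltW (lsize_gt0 _)) //.
rewrite expr2 /lsize /=; apply: ler_pM; rewrite ?addr_ge0 //; first by rewrite lerDl.
by rewrite addrAC lerDl.
Qed.

Definition emb (tau : C) (x : int * int) : C := x.1%:~R * tau + x.2%:~R.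

Lemma embB tau x y : emb tau (x - y) = emb tau x - emb tau y.
Proof. by rewrite /emb /= !rmorphB /=; ring. Qed.

Lemma emb_mulrn tau x n : emb tau (x *+ n) = n%:R * emb tau x.
Proof.
elim: n => [|n IH]; first by rewrite mulr0n /emb /= !mul0r addr0.
rewrite mulrS -natr1 mulrDl mul1r -IH /emb /= !rmorphD /=; ring.
Qed.

Section Bounds.
Variables (T : R) (tau : C).
Hypotheses (T1 : 1 <= T) (tauT : nm tau <= T) (ImT : T^-1 <= Im tau).

Lemma emb_le x : nm (emb tau x) <= T * lsize x.
Proof.
have T0 : 0 <= T by exact: le_trans T1.
apply: le_trans (nmD _ _) _; rewrite nmM !nm_int /lsize !mulrDr mulr1.
have h1 := ler_wpM2l (normr_ge0 (x.1%:~R : R)) tauT.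
have h2 := ler_wpM2r (normr_ge0 (x.2%:~R : R)) T1.
by rewrite mul1r in h2; rewrite (mulrC T); lra.
Qed.

(** The imaginary part of w = m tau + n is m Im tau, which bounds |m| by T |w|; then n = w - m tau
    is bounded by (1 + T^2) |w|. *)
Lemma emb_ge x : `|x.1%:~R| + `|x.2%:~R| <= 3 * T ^+ 2 * nm (emb tau x).
Proof.
have T0 : 0 < T by exact: lt_le_trans T1.
set w := emb tau x; set m : R := x.1%:~R; set n : R := x.2%:~R.
have w0 := nm_ge0 w.
have ReE (a : int) : Re (a%:~R : C) = a%:~R by rewrite -(rmorph_int (real_complex R)).
have ImE (a : int) : Im (a%:~R : C) = 0 by rewrite -(rmorph_int (real_complex R)).
have Iw : Im w = m * Im tau.
  have ImD (a b : C) : Im (a + b) = Im a + Im b by case: a b => ? ? [].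
  by rewrite /w /emb ImD ImM ReE !ImE mul0r !addr0.
have hm : `|m| <= T * nm w.
  have := (ReIm_nm w).2; rewrite Iw normrM => h.
  have : `|m| * T^-1 <= nm w.
    apply: le_trans h; rewrite ler_wpM2l //; apply: le_trans ImT _; exact: ler_norm.
  by rewrite ler_pdivrMr // mulrC.
have hn : `|n| <= nm w + T ^+ 2 * nm w.
  have -> : `|n| = nm (x.2%:~R : C) by rewrite nm_int.
  have -> : x.2%:~R = w - x.1%:~R * tau :> C by rewrite /w /emb; ring.
  apply: le_trans (nmD _ _) _; rewrite nmN lerD2l nmM nm_int -/m.
  have := ler_pM (normr_ge0 m) (nm_ge0 tau) hm tauT; rewrite expr2; lra.
have T2 : T <= T ^+ 2 by rewrite expr2 ler_peMl // ltW.
have T3 : 1 <= T ^+ 2 by exact: le_trans T2.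
have := ler_wpM2r w0 T2; have := ler_wpM2r w0 T3; rewrite mul1r.
lra.
Qed.

Lemma lsize_le_emb1 x : lsize x <= 1 + 3 * T ^+ 2 * nm (emb tau x).
Proof. by rewrite /lsize -addrA lerD2l emb_ge. Qed.

Lemma lsize_le_emb x : x != 0 -> lsize x <= 6 * T ^+ 2 * nm (emb tau x).
Proof.
move=> x0; have := emb_ge x; have : (1 : R) <= `|x.1%:~R| + `|x.2%:~R|.
  have nz (a : int) : a != 0 -> (1 : R) <= `|a%:~R|.
    by move=> a0; rewrite -intr_norm ler1z; move: a0; lia.
  move: x0; case: (x) => m n; rewrite /= -pair_eqE /= negb_and => /orP[/nz h|/nz h].
    by rewrite (le_trans h) // lerDl.
  by rewrite (le_trans h) // lerDr.
rewrite /lsize; lra.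
Qed.

Lemma emb_neq0 x : x != 0 -> emb tau x != 0.
Proof.
move=> /lsize_le_emb h; rewrite -nm_gt0 lt0r nm_ge0 andbT.
by apply: contraTneq h => ->; rewrite mulr0 -ltNge lsize_gt0.
Qed.

End Bounds.

Lemma emb0 tau : emb tau 0 = 0.
Proof. by rewrite /emb /= !mul0r addr0. Qed.

Lemma height_bound tau : 0 < Im tau -> exists T : R, [/\ 1 <= T, nm tau <= T & T^-1 <= Im tau].
Proof.
move=> t0; pose T := Num.max 1 (Num.max (nm tau) (Im tau)^-1).
have [T1 T2 T3] : [/\ 1 <= T, nm tau <= T & (Im tau)^-1 <= T] by rewrite /T !le_max !lexx !orbT.
by exists T; split=> //; rewrite invf_ple ?posrE // (lt_le_trans _ T1).
Qed.

Lemma emb_eq0 tau x : 0 < Im tau -> (emb tau x == 0) = (x == 0).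
Proof.
move=> /height_bound[T [T1 T2 T3]]; apply/idP/idP => [|/eqP ->]; last by rewrite emb0.
by apply: contraTT; exact: (emb_neq0 T1 T2 T3).
Qed.

(** Where w is large compared with the step, [diff_ksym_le] applies, and |w| is comparable with
    [lsize x] up to powers of T. The remaining x have size bounded by a power of T, so a crude bound
    on the values suffices there, at the price of further powers of T. *)
Lemma lattice_diff_le (l : int * int) (p k S : nat) : (0 < k)%N ->
  exists (K : R) (A : nat), 0 <= K /\ forall (T : R) (tau s : C) x,
    1 <= T -> nm tau <= T -> T^-1 <= Im tau -> nm s <= S%:R ->
    nm (iter p (diff l) (fun y => ksym k 0 s (emb tau y)) x) <=
      K * T ^+ A * lsize x `^ (- (k%:R + 2 * Re s + p%:R)).
Proof.
move=> k0; have [K0 K00 HK0] := diff_ksym_le R p S k 0.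
pose X := (k + 2 * S + p)%N; pose L : R := lsize l.
have L1 : 1 <= L by exact: lsize_ge1.
have L0 : 0 <= L by exact: le_trans L1.
have p0 : 0 <= p%:R :> R by [].
have pL0 : 0 <= p%:R * L by rewrite mulr_ge0.
pose K1 := K0 * L ^+ p * 6 ^+ X.
pose K2 := 2 ^+ p * (6 + 3 * p%:R * L) ^+ X * (1 + 6 * p%:R * L) ^+ X.
have K10 : 0 <= K1 by rewrite !mulr_ge0 ?exprn_ge0.
have q1 : 0 <= 6 + 3 * p%:R * L by rewrite -mulrA; lra.
have q2 : 0 <= 1 + 6 * p%:R * L by rewrite -mulrA; lra.
have K20 : 0 <= K2 by rewrite !mulr_ge0 ?exprn_ge0.
exists (K1 + K2), (p + 5 * X)%N; split; first exact: addr_ge0.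
move=> T tau s x T1 tauT ImT sS.
have T0 : 0 < T by exact: lt_le_trans T1.
have powT (i : nat) (c : R) : (i <= p + 5 * X)%N -> 0 <= c -> c * T ^+ i <= c * T ^+ (p + 5 * X).
  by move=> iA c0; rewrite ler_wpM2l // ler_weXn2l.
set Y := k%:R + 2 * Re s + p%:R; set lam := emb tau l; set w := emb tau x.
have lamT : nm lam <= T * L by exact: emb_le.
have Rs : `|Re s| <= S%:R by apply: le_trans sS; rewrite ReIm_nm.
have XE : X%:R = k%:R + 2 * S%:R + p%:R :> R by rewrite -natrM -!natrD.
have k0' : 0 <= k%:R :> R by [].
have YX : `|- Y| <= X%:R.
  by rewrite normrN XE /Y; move: Rs; rewrite !ler_norml => /andP[? ?]; apply/andP; split; lra.
have YX' : `|- (k%:R + 0 + 2 * Re s)| <= X%:R.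
  by rewrite normrN XE; move: Rs; rewrite !ler_norml => /andP[? ?]; apply/andP; split; lra.
have N1 := lsize_ge1 x; have N0 := lsize_gt0 x.
have T2 : 1 <= T ^+ 2 by rewrite exprn_ege1.
have TT2 : T <= T ^+ 2 by rewrite expr2 ler_peMl // ltW.
have N0' := powR_ge0 (lsize x) (- Y).
rewrite (@iter_diff_comp _ _ _ lam l (emb tau) p (ksym k 0 s)); last by move=> y; rewrite embB.
rewrite -/w mulrDl mulrDl.
have [far|near] := boolP ((w != 0) && ((2 * p)%:R * nm lam <= nm w)).
  have [w0 wl] := andP far; have x0 : x != 0 by apply: contraNneq w0 => x0; rewrite /w x0 emb0.
  have n0 : 0 < nm w by rewrite nm_gt0.
  have := HK0 s w lam sS w0 wl; rewrite addr0 -/Y => h.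
  apply: le_trans h _; rewrite -[leLHS]addr0 lerD ?mulr_ge0 ?exprn_ge0 ?(ltW T0) //.
  have h1 : nm w `^ (- Y) <= (6 * T ^+ 2) ^+ X * lsize x `^ (- Y).
    apply: powR_le_ratio => //; first by lra.
      exact: lsize_le_emb.
    apply: le_trans (emb_le T1 tauT x) _; rewrite ler_wpM2r ?(ltW N0) //; lra.
  have h2 : nm lam ^+ p <= T ^+ p * L ^+ p.
    by rewrite -exprMn lerXn2r ?nnegrE ?nm_ge0 // mulr_ge0 // ltW.
  apply: (@le_trans _ _ (K0 * (T ^+ p * L ^+ p) * ((6 * T ^+ 2) ^+ X * lsize x `^ (- Y)))).
    apply: ler_pM; rewrite ?mulr_ge0 ?exprn_ge0 ?nm_ge0 ?powR_ge0 ?ler_wpM2l //.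
  have -> : K0 * (T ^+ p * L ^+ p) * ((6 * T ^+ 2) ^+ X * lsize x `^ (- Y))
    = K1 * T ^+ (p + 2 * X) * lsize x `^ (- Y).
    by rewrite /K1 exprD [T ^+ (2 * X)]exprM exprMn; ring.
  apply: (ler_wpM2r N0'); apply: powT; last exact: K10.
  by rewrite leq_add2l leq_mul2r orbT.
have wl : nm w <= 2 * p%:R * (T * L).
  move: near; rewrite negb_and negbK => /orP[/eqP ->|].
    by rewrite nm0 !mulr_ge0 // ltW.
  rewrite -ltNge natrM => /ltW h; apply: le_trans h _; rewrite ler_wpM2l //.
have TL : T * (p%:R * L) <= T ^+ 2 * (p%:R * L) by rewrite ler_wpM2r.
(* [Q1] bounds |w - j lam| and, when that point is nonzero, its inverse; [Q2] bounds [lsize x]. They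
   grow like T^2 and T^3, whence the exponent 5 X. *)
pose Q1 := (6 + 3 * p%:R * L) * T ^+ 2.
have Q1E : Q1 = 6 * T ^+ 2 + 3 * (T ^+ 2 * (p%:R * L)) by rewrite /Q1; ring.
have TL0 : 0 <= T * (p%:R * L) by rewrite mulr_ge0 // ltW.
have Q11 : 1 <= Q1 by rewrite Q1E; lra.
have Q10 : 0 < Q1 by exact: lt_le_trans Q11.
pose Q2 := (1 + 6 * p%:R * L) * T ^+ 3.
have T3 : T ^+ 2 <= T ^+ 3 by rewrite [T ^+ 3]exprS ler_peMl // exprn_ge0 // ltW.
have NQ : lsize x <= Q2.
  apply: le_trans (lsize_le_emb1 T1 tauT ImT x) _.
  have := ler_wpM2l (_ : 0 <= 3 * T ^+ 2) wl; rewrite mulr_ge0 ?exprn_ge0 ?(ltW T0) // => /(_ isT) h.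
  have -> : Q2 = T ^+ 3 + 3 * T ^+ 2 * (2 * p%:R * (T * L)) by rewrite /Q2 [T ^+ 3]exprS; ring.
  by apply: lerD h; apply: le_trans T3.
have Q21 : 1 <= Q2 by exact: le_trans NQ.
have h1 : nm (iter p (diff lam) (ksym k 0 s) w) <= 2 ^+ p * Q1 ^+ X.
  apply: iter_diff_le => j jp.
  (* A shifted point that hits 0 contributes 0, since k > 0. *)
  have [->|z0] := eqVneq (w - lam *+ j) 0.
    by rewrite /ksym invr0 expr0n gtn_eqF // !mul0r nm0 exprn_ge0 // ltW.
  have zE : w - lam *+ j = emb tau (x - l *+ j) by rewrite embB emb_mulrn mulr_natl.
  have y0 : x - l *+ j != 0 by apply: contraNneq z0; rewrite zE => ->; rewrite emb0.
  rewrite nm_ksym //; apply: powR_le => //; first by rewrite nm_gt0.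
  apply/andP; split.
    have := lsize_le_emb T1 tauT ImT y0; have := lsize_ge1 (x - l *+ j); rewrite -zE => a1 a2.
    have n0 := nm_ge0 (w - lam *+ j).
    rewrite -[Q1^-1]mul1r ler_pdivrMr // mulrC.
    apply: le_trans (le_trans a1 a2) _; rewrite ler_wpM2r // Q1E; lra.
  apply: le_trans (nmD _ _) _; rewrite nmN -mulr_natl nmM nm_nat.
  have : j%:R * nm lam <= p%:R * (T * L) by apply: ler_pM; rewrite ?nm_ge0 // ler_nat.
  rewrite Q1E; lra.
have h2 : 1 <= Q2 ^+ X * lsize x `^ (- Y).
  rewrite powRN ler_pdivlMr ?powR_gt0 // mul1r; apply: powR_le => //; last by rewrite -normrN.
  rewrite NQ andbT; apply: le_trans N1; rewrite invf_le1 //; exact: lt_le_trans Q21.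
apply: le_trans h1 _; rewrite -[leLHS]add0r lerD ?mulr_ge0 ?exprn_ge0 ?(ltW T0) //.
apply: (@le_trans _ _ (2 ^+ p * Q1 ^+ X * (Q2 ^+ X * lsize x `^ (- Y)))).
  by rewrite ler_peMr // mulr_ge0 // exprn_ge0 // ltW.
have -> : 2 ^+ p * Q1 ^+ X * (Q2 ^+ X * lsize x `^ (- Y)) = K2 * T ^+ (5 * X) * lsize x `^ (- Y).
  have E5 : T ^+ (5 * X) = (T ^+ 2) ^+ X * (T ^+ 3) ^+ X by rewrite -!exprM -exprD -mulnDl.
  rewrite /Q1 /Q2 /K2 E5 (exprMn _ (6 + 3 * p%:R * L) (T ^+ 2)) (exprMn _ (1 + 6 * p%:R * L) (T ^+ 3)).
  ring.
apply: (ler_wpM2r N0'); apply: powT; last exact: K20.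
exact: leq_addl.
Qed.

End LatticeSums.

(** * Continuation of the Eisenstein-Kronecker series *)

Section Character.
Variable R : realType.
Local Notation C := R[i].

Lemma exp2piID (x y : C) : exp2piI (x + y) = exp2piI x * exp2piI y.
Proof. by rewrite /exp2piI mulrDr expCD. Qed.

Lemma exp2piI0 : exp2piI (0 : C) = 1.
Proof. by rewrite /exp2piI mulr0 expC0. Qed.

Lemma nm_exp2piI (z : C) : nm (exp2piI z) = expR (- (2 * pi * Im z)).
Proof.
rewrite /exp2piI nm_expC; congr expR; case: z => a b /=; ring.
Qed.

Lemma nm_exp2piI_real (x : R) : nm (exp2piI x%:C) = 1.
Proof. by rewrite nm_exp2piI /= mulr0 oppr0 expR0. Qed.

Definition chr (a b : R) (x : int * int) : C :=
  exp2piI (x.1%:~R * b - x.2%:~R * a)%:C.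

Lemma chrD a b x y : chr a b (x + y) = chr a b x * chr a b y.
Proof.
rewrite /chr -exp2piID -rmorphD; congr (exp2piI _%:C).
by rewrite /= !rmorphD /=; ring.
Qed.

Lemma nm_chr a b x : nm (chr a b x) = 1.
Proof. exact: nm_exp2piI_real. Qed.

Lemma chr0 a b : chr a b 0 = 1.
Proof. by rewrite /chr /= !mul0r subrr exp2piI0. Qed.

End Character.

Lemma has_sum_diff (R : realType) (V : zmodType) (chi : V -> R[i])
  (chiD : forall x y, chi (x + y) = chi x * chi y) (l : V) (h : V -> R[i]) (s : R[i]) :
  has_sum (fun x => chi x * h x) s -> has_sum (fun x => chi x * diff l h x) ((1 - chi l) * s).
Proof.
move=> H; have H1 := @has_sum_reindex R _ _ (fun x : V => x - l) (fun x => x + l) _ _ (subrK l) (addrK l) H.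
have := has_sumD H (has_sumN (@has_sumZ _ _ (chi l) _ _ H1)).
rewrite mulrBl mul1r; congr (has_sum _ _); apply: funext => x.
by rewrite /diff mulrA -chiD subrKC; ring.
Qed.

Section Continuation.
Variable R : realType.
Local Notation C := R[i].
Variables (k : nat) (tau : C) (a b : R) (l : int * int).
Hypotheses (k0 : (0 < k)%N) (tauH : 0 < Im tau).
Local Notation chi := (chr a b).
Hypothesis chil : chi l != 1.

Let G (s : C) (y : int * int) : C := ksym k 0 s (emb tau y).
Let term (p : nat) (s : C) (x : int * int) : C := chi x * iter p (diff l) (G s) x.

Lemma term_bound (p S : nat) : exists K : R, forall s x, nm s <= S%:R ->
  nm (iter p (diff l) (G s) x) <= K * lsize R x `^ (- (k%:R + 2 * Re s + p%:R)).
Proof.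
have [K [A [_ H]]] := lattice_diff_le R l p S k0.
have [T [T1 T2 T3]] := height_bound tauH.
by exists (K * T ^+ A) => s x sS; apply: H.
Qed.

Lemma term_summable p (y : R) (S : nat) : 2 < y -> exists (m : int * int -> R) (M : R),
  (forall A : {fset int * int}, \sum_(x <- A) m x <= M) /\
  forall s x, nm s <= S%:R -> y <= k%:R + 2 * Re s + p%:R -> nm (term p s x) <= m x.
Proof.
move=> y2; have [K HK] := term_bound p S; have [M HM] := lsize_summable y2.
exists (fun x => `|K| * lsize R x `^ (- y)), (`|K| * M); split.
  by move=> A; rewrite -mulr_sumr ler_wpM2l.
move=> s x sS ys; rewrite nmM nm_chr mul1r; apply: le_trans (HK s x sS) _.
apply: (@le_trans _ _ (`|K| * lsize R x `^ (- (k%:R + 2 * Re s + p%:R)))).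
  by rewrite ler_wpM2r ?powR_ge0 // ler_norm.
by rewrite ler_wpM2l // ler_powR ?lsize_ge1 // lerN2.
Qed.

Definition csum (I : choiceType) (x : I -> C) : C := xget 0 [set s | has_sum x s].

Lemma csumP (I : choiceType) (x : I -> C) : abs_summable x -> has_sum x (csum x).
Proof.
move=> /abs_summable_ex[s Hs]; rewrite /csum.
by case: xgetP => [t _ //|/(_ s)]; case.
Qed.

Lemma term_has_sum p s : 2 < k%:R + 2 * Re s + p%:R -> has_sum (term p s) (csum (term p s)).
Proof.
move=> h; apply: csumP; pose S := (Num.truncn (nm s)).+1.
have sS : nm s <= S%:R by apply: ltW; rewrite real_truncnS_gt ?num_real.
have [m [M [HM H]]] := term_summable p S h.
by exists M; apply: summable_by_le HM => x; apply: H.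
Qed.

Let F p s : C := csum (term p s) / (1 - chi l) ^+ p.

Lemma one_sub_chi : 1 - chi l != 0.
Proof. by rewrite subr_eq0 eq_sym. Qed.

(** One more difference multiplies the sum by 1 - chi(l), which the denominator of [F] cancels; so
    all admissible orders give the same value. *)
Lemma term_succ p q s : 2 < k%:R + 2 * Re s + p%:R -> (p <= q)%N -> F q s = F p s.
Proof.
move=> h; elim: q => [|q IH]; first by rewrite leqn0 => /eqP ->.
rewrite leq_eqVlt => /orP[/eqP <- //|]; rewrite ltnS => pq.
rewrite -(IH pq) /F; have hq : 2 < k%:R + 2 * Re s + q%:R.
  by apply: lt_le_trans h _; rewrite lerD2l ler_nat.
have hq1 : 2 < k%:R + 2 * Re s + q.+1%:R.
  by apply: lt_le_trans hq _; rewrite lerD2l ler_nat.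
have H1 := @has_sum_diff R _ _ (@chrD R a b) l _ _ (term_has_sum hq).
rewrite (has_sum_unique (term_has_sum hq1) H1) exprS invfM mulrCA mulrA.
by rewrite mulrA mulVf ?one_sub_chi // mul1r.
Qed.

(** The number of differences must grow as Re s tends to minus infinity, so no single order defines
    the entire function. This one suffices at s; by [term_succ] it may be traded for one that
    suffices on a whole disc. *)
Definition ek_order (s : C) : nat := (Num.truncn `|2 - 2 * Re s|).+1.
Definition ek_cont (s : C) : C := F (ek_order s) s.

Lemma ek_orderP s : 2 < k%:R + 2 * Re s + (ek_order s)%:R.
Proof.
have : `|2 - 2 * Re s| < (ek_order s)%:R by rewrite real_truncnS_gt ?num_real.
have := ler_norm (2 - 2 * Re s); have : 0 <= k%:R :> R by []. lra.
Qed.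

Lemma ek_contE p s : 2 < k%:R + 2 * Re s + p%:R -> ek_cont s = F p s.
Proof.
move=> h; rewrite /ek_cont; have [pq|/ltnW pq] := leqP p (ek_order s).
  exact: term_succ.
by apply/esym; apply: term_succ => //; exact: ek_orderP.
Qed.

Lemma ksym_derivable (x : int * int) p (s : C) :
  exists d, hasd id (fun s => iter p (diff l) (G s) x) s d.
Proof.
elim: p x => [|p IH] x.
  eexists; apply: hasdM; first exact: hasd_cst.
  apply: (hasd_comp (f := fun s => - s * (ln (nm (emb tau x) ^+ 2))%:C) (hasd_expC _)).
  by apply: hasdM; [apply: hasdN; exact: hasd_id|exact: hasd_cst].
have [d1 H1] := IH x; have [d2 H2] := IH (x - l); exists (d1 - d2).
by apply: hasd_ext (hasdB H1 H2) => u; rewrite iter_diffS.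
Qed.

Lemma ek_cont_derivable s0 : exists d, hasd id ek_cont s0 d.
Proof.
(* The threshold 4 in place of 2 leaves room for s to vary in the disc of radius 1 / 2, where 2 Re s
   changes by less than 1; one order and one majorant then serve the whole disc. *)
pose p := (Num.truncn `|4 - 2 * Re s0|).+1.
have hp : 4 < 2 * Re s0 + p%:R.
  have : `|4 - 2 * Re s0| < p%:R by rewrite real_truncnS_gt ?num_real.
  by have := ler_norm (4 - 2 * Re s0); lra.
pose S := (Num.truncn (nm s0 + 1)).+1.
have sS : nm s0 + 1 < S%:R by rewrite real_truncnS_gt ?num_real.
have k0' : 0 <= k%:R :> R by [].
pose y := k%:R + 2 * Re s0 - 1 + p%:R.
have y2 : 2 < y by rewrite /y; lra.
have [m [M [HM H]]] := term_summable p S y2.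
have near (s : C) : nm (s - s0) < 1 / 2 -> nm s <= S%:R /\ y <= k%:R + 2 * Re s + p%:R.
  move=> h; split.
    have := nmD s0 (s - s0); rewrite subrKC; lra.
  have := (ReIm_nm (s - s0)).1; rewrite ReB ler_norml /y => /andP[? ?]; lra.
have [d Hd] : exists d, hasd id (fun s => csum (term p s)) s0 d.
  apply: (@has_sum_derivable R _ (fun x s => term p s x) (fun s => csum (term p s)) s0 (1 / 2) m M).
  - by rewrite divr_gt0.
  - move=> x s _; have [d Hd] := ksym_derivable x p s.
    by exists (chi x * d); exact: hasdZ.
  - by move=> x s /near[h1 h2]; exact: H.
  - exact: HM.
  - by move=> s /near[h1 h2]; apply: term_has_sum; exact: lt_le_trans h2.
exists (d * ((1 - chi l) ^+ p)^-1 + csum (term p s0) * 0).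
apply: (hasd_near (r := 1 / 2) _ _ _ (hasdM Hd (hasd_cst id s0 _))); first by rewrite divr_gt0.
  move=> h hh; have [|h1 h2] := near (s0 + h); first by rewrite addrC addKr.
  by rewrite (@ek_contE p) //; exact: lt_le_trans h2.
rewrite (@ek_contE p) //; have [|h1 h2] := near s0; first by rewrite subrr nm0 divr_gt0.
exact: lt_le_trans h2.
Qed.

End Continuation.

Section Value.
Variable R : realType.
Local Notation C := R[i].
Variables (k : nat) (tau z : C).
Hypotheses (k0 : (0 < k)%N) (tauH : upper_half_plane tau).
Local Notation chi := (chr (coord1 tau z) (coord2 tau z)).

Lemma EK_termE s x : EK_term k tau z s x = chi x * ksym k 0 s (emb tau x).
Proof.
have T1 : 0 < Im tau by exact: tauH.
rewrite /EK_term /chr -/(emb tau x); case: ifP => [/eqP ->|/negbT x0].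
  by rewrite emb0 /ksym invr0 expr0n gtn_eqF // !mul0r mulr0.
congr (_ * _); rewrite /ksym expr0 mulr1 invfM exprVn; congr (_ * _).
have w0 : 0 < nm (emb tau x) by rewrite nm_gt0 (emb_eq0 _ T1).
by rewrite /rpowC -expCN Re_norm lnXn // rmorphMn /=; congr expC; ring.
Qed.

Lemma EK_continuation_cont l : chi l != 1 ->
  EK_continuation k tau z (ek_cont k tau (coord1 tau z) (coord2 tau z) l).
Proof.
move=> chil; split=> [s _|s hs]; first by apply/hasdP; exact: ek_cont_derivable.
have h : 2 < k%:R + 2 * Re s + 0%:R.
  by rewrite addr0; move: hs; lra.
rewrite (ek_contE k0 tauH chil h) expr0 divr1.
rewrite (_ : EK_term k tau z s = fun x => chi x * iter 0 (diff l) (fun y => ksym k 0 s (emb tau y)) x).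
  exact: term_has_sum.
by apply: funext => x; exact: EK_termE.
Qed.

Lemma EK_continuation_unique f g : EK_continuation k tau z f -> EK_continuation k tau z g -> f =1 g.
Proof.
move=> [df Hf] [dg Hg] s; apply/eqP; rewrite -subr_eq0; apply/eqP.
apply: (@identity_halfplane R (fun s => f s - g s) (1 - k%:R / 2)) => [t|t ht].
  have [d Hd] := (hasdP f t).1 (df t I); have [d' Hd'] := (hasdP g t).1 (dg t I).
  by exists (d - d'); exact: hasdB.
by rewrite (has_sum_unique (Hf t ht) (Hg t ht)) subrr.
Qed.

Lemma ksym00 n (w : C) : ksym n 0 0 w = w^-1 ^+ n.
Proof. by rewrite /ksym expr0 oppr0 mul0r expC0 !mulr1. Qed.

Lemma EK0_summable l p : (2 <= p)%N ->
  abs_summable (fun x => chi x * iter p (diff l) (fun y => (emb tau y)^-1 ^+ k) x).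
Proof.
move=> p2; have h : 2 < k%:R + 2 * 0 + p%:R :> R.
  rewrite mulr0 addr0 -natrD -[2]/(2%:R) ltr_nat; lia.
have [m [M [HM H]]] := term_summable (coord1 tau z) (coord2 tau z) l k0 tauH p 0 h.
exists M; apply: summable_by_le HM => x.
rewrite (_ : iter p _ _ _ = iter p (diff l) (fun y => ksym k 0 0 (emb tau y)) x).
  by apply: H; rewrite ?nm0.
by apply: eq_iter_diff => y; rewrite ksym00.
Qed.

Lemma EK0_has_sum l p : chi l != 1 -> (2 <= p)%N ->
  has_sum (fun x => chi x * iter p (diff l) (fun y => (emb tau y)^-1 ^+ k) x)
    ((1 - chi l) ^+ p * EK k tau z 0).
Proof.
move=> chil p2; have Hc := EK_continuation_cont chil.
have -> : EK k tau z 0 = ek_cont k tau (coord1 tau z) (coord2 tau z) l 0.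
  apply: (fun H => EK_continuation_unique H Hc 0); rewrite /EK.
  by case: xgetP => [f _ //|/(_ _ Hc)].
have h : 2 < k%:R + 2 * Re (0 : C) + p%:R.
  rewrite mulr0 addr0 -natrD -[2]/(2%:R) ltr_nat; lia.
rewrite (ek_contE k0 tauH chil h) mulrC divfK; last by rewrite expf_neq0 // one_sub_chi.
have := @term_has_sum R k tau (coord1 tau z) (coord2 tau z) l k0 tauH p 0 h; congr (has_sum _ _).
apply: funext => x; congr (_ * _); apply: eq_iter_diff => y.
by rewrite ksym00.
Qed.

End Value.

(** * Partial fractions *)

Section PartialFractions.
Variable K : fieldType.
Implicit Types (x y t A B : K).

Section Generic.
Variables x y t : K.
Hypothesis xyt : x * y = t * (x - y).

(** To be read with x = 1 / A, y = 1 / B and t = 1 / (B - A), for which x y = t (x - y); [pfx] and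
    [pfy] collect the powers of x and of y in the partial fraction expansion. *)
Definition pfx k1 k2 : K :=
  \sum_(i < k1.+1) (-1) ^+ i * 'C(k2 + i, i)%:R * t ^+ (k2 + i).+1 * x ^+ (k1 - i).+1.
Definition pfy k1 k2 : K :=
  (-1) ^+ k1 * \sum_(i < k2.+1) 'C(k1 + i, i)%:R * y ^+ (k2 - i).+1 * t ^+ (k1 + i).+1.

Lemma pfxS k1 k2 : pfx k1.+1 k2.+1 = t * (pfx k1.+1 k2 - pfx k1 k2.+1).
Proof.
rewrite /pfx (big_ord_recl k1.+1) [in RHS](big_ord_recl k1.+1) /=.
rewrite !addn0 !bin0 !subn0 mulrBr mulrDr !mulr_sumr -addrA -sumrB; congr (_ + _).
  by rewrite !exprS; ring.
apply: eq_bigr => i _; rewrite /bump /= !add1n subSS !addSn !addnS.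
by rewrite binS natrD !exprS; ring.
Qed.

Lemma pfyS k1 k2 : pfy k1.+1 k2.+1 = t * (pfy k1.+1 k2 - pfy k1 k2.+1).
Proof.
rewrite /pfy (big_ord_recl k2.+1) [X in _ - (_ * X)](big_ord_recl k2.+1) /=.
rewrite !addn0 !bin0 !subn0.
have -> : \sum_(i < k2.+1) 'C(k1.+1 + bump 0 i, bump 0 i)%:R * y ^+ (k2.+1 - bump 0 i).+1 * t ^+ (k1.+1 + bump 0 i).+1
  = t * (\sum_(i < k2.+1) 'C(k1.+1 + i, i)%:R * y ^+ (k2 - i).+1 * t ^+ (k1.+1 + i).+1)
   + t * (\sum_(i < k2.+1) 'C(k1 + bump 0 i, bump 0 i)%:R * y ^+ (k2.+1 - bump 0 i).+1 * t ^+ (k1 + bump 0 i).+1).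
  rewrite !mulr_sumr -big_split; apply: eq_bigr => i _; rewrite /bump /= !add1n subSS !addSn !addnS.
  by rewrite binS natrD !exprS; ring.
by rewrite !exprS; ring.
Qed.

(** The monomials and both sums obey one recursion, a(k1 + 1, k2 + 1) = t (a(k1 + 1, k2) - a(k1, k2
    + 1)); for the sums it is Pascal's rule. The induction starts from the two edges k1 = 0 and k2 =
    0. *)
Lemma pf_generic k1 k2 : x ^+ k1.+1 * y ^+ k2.+1 = pfx k1 k2 - pfy k1 k2.
Proof.
have rec m n : x ^+ m.+2 * y ^+ n.+2 = t * (x ^+ m.+2 * y ^+ n.+1 - x ^+ m.+1 * y ^+ n.+2).
  by rewrite (exprS x m.+1) (exprS y n.+1) mulrACA xyt; ring.
elim: k1 k2 => [|k1 IH1]; last first.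
  elim=> [|k2 IH2]; last by rewrite rec IH2 IH1 pfxS pfyS; ring.
  have -> : x ^+ k1.+2 * y ^+ 1 = t * (x ^+ k1.+2 - x ^+ k1.+1 * y ^+ 1).
    by rewrite exprSr !expr1 -mulrA xyt; ring.
  rewrite IH1 /pfx /pfy (big_ord_recl k1.+1) !big_ord1 /= !bin0 !mulrBr mulr_sumr.
  have -> : \sum_(i < k1.+1) (-1) ^+ bump 0 i * 'C(0 + bump 0 i, bump 0 i)%:R * t ^+ (0 + bump 0 i).+1 * x ^+ (k1.+1 - bump 0 i).+1
    = - \sum_(i < k1.+1) t * ((-1) ^+ i * 'C(0 + i, i)%:R * t ^+ (0 + i).+1 * x ^+ (k1 - i).+1).
    rewrite -sumrN; apply: eq_bigr => i _; rewrite /bump /= !add1n subSS !add0n !binn !exprS; ring.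
  by rewrite !addn0 !subn0 !expr0 !expr1 !exprS; ring.
elim=> [|k2 IH].
  by rewrite /pfx /pfy !big_ord1 /= !bin0 !expr0 !expr1 xyt; ring.
have -> : x ^+ 1 * y ^+ k2.+2 = t * (x ^+ 1 * y ^+ k2.+1 - y ^+ k2.+2).
  by rewrite expr1 exprS mulrA xyt exprS; ring.
rewrite IH /pfx /pfy !big_ord1 [in RHS](big_ord_recl k2.+1) /= !bin0 !mulrBr.
have -> : \sum_(i < k2.+1) 'C(0 + bump 0 i, bump 0 i)%:R * y ^+ (k2.+1 - bump 0 i).+1 * t ^+ (0 + bump 0 i).+1
    = t * \sum_(i < k2.+1) 'C(0 + i, i)%:R * y ^+ (k2 - i).+1 * t ^+ (0 + i).+1.
  rewrite mulr_sumr; apply: eq_bigr => i _; rewrite /bump /= !add1n subSS !add0n !binn !exprS; ring.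
by rewrite !addn0 !subn0 !expr0 !expr1 !exprS; ring.
Qed.

End Generic.

(** When A = 0 or B = 0, all terms of the surviving partial fraction sum are the same power, and
    this sum of binomials becomes its coefficient. *)
Lemma hockey_stick k1 k2 : (\sum_(i < k1.+1) 'C(k2 + i, i) = 'C(k1 + k2 + 1, k1))%N.
Proof.
elim: k1 => [|k1 IH]; first by rewrite big_ord1 addn0 !bin0.
rewrite big_ord_recr IH /= addn1 !addSn binS addnC; congr (_ + _)%N.
  by congr 'C(_, _); lia.
by congr 'C(_, _); lia.
Qed.

Lemma signXN (z : K) n : (- z)^-1 ^+ n = (-1) ^+ n * z^-1 ^+ n.
Proof. rewrite invrN; exact: exprNn. Qed.

(* The right-hand side makes up for the convention 0^-1 = 0. *)
Lemma partial_fractions A B k1 k2 :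
  A^-1 ^+ k1.+1 * B^-1 ^+ k2.+1
  + (-1) ^+ k1 * (\sum_(i < k1.+1) 'C(k2 + i, i)%:R * ((B - A)^-1 ^+ (k2 + i).+1 * (- A)^-1 ^+ (k1 - i).+1))
  + (-1) ^+ k2 * (\sum_(i < k2.+1) 'C(k1 + i, i)%:R * ((- B)^-1 ^+ (k2 - i).+1 * (A - B)^-1 ^+ (k1 + i).+1))
  = (-1) ^+ k2 * 'C(k1 + k2 + 1, k1)%:R * (A^-1 ^+ (k1 + k2).+2 * (B == 0)%:R)
    + (-1) ^+ k1 * 'C(k1 + k2 + 1, k2)%:R * ((A == 0)%:R * B^-1 ^+ (k1 + k2).+2)
    + (-1) ^+ (k1 + k2) * ((B - A == 0)%:R * (- A)^-1 ^+ (k1 + k2).+2).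
Proof.
have z0 n : (0 : K)^-1 ^+ n.+1 = 0 by rewrite invr0 expr0n.
have sgn n : (-1) ^+ n * (-1) ^+ n = 1 :> K by rewrite -exprMn mulrNN mulr1 expr1n.
set S1 := \sum_(i < k1.+1) _; set S2 := \sum_(i < k2.+1) _.
have [B0|B0] := eqVneq B 0.
  have -> : S2 = 0 by apply: big1 => i _; rewrite B0 oppr0 z0 mul0r mulr0.
  have [A0|A0] := eqVneq A 0.
    have -> : S1 = 0 by apply: big1 => i _; rewrite A0 oppr0 z0 !mulr0.
    by rewrite A0 B0 oppr0 !z0 !mul0r !mulr0 !addr0.
  have -> : S1 = (-1) ^+ k1 * (-1) ^+ k2 * A^-1 ^+ (k1 + k2).+2 * 'C(k1 + k2 + 1, k1)%:R.
    rewrite -hockey_stick natr_sum mulr_sumr; apply: eq_bigr => i _.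
    have ik : (i <= k1)%N by rewrite -ltnS.
    rewrite B0 sub0r -(exprD (- A)^-1) (_ : (k2 + i).+1 + (k1 - i).+1 = (k1 + k2).+2)%N; last by lia.
    by rewrite signXN -addn2 !exprD sqrrN expr1n; ring.
  rewrite B0 sub0r oppr_eq0 (negbTE A0) z0 mul0r !mulr0 !addr0 add0r mulr1.
  rewrite (_ : (-1) ^+ k1 * _ = ((-1) ^+ k1 * (-1) ^+ k1) * (-1) ^+ k2 * A^-1 ^+ (k1 + k2).+2 * 'C(k1 + k2 + 1, k1)%:R); last by ring.
  by rewrite sgn mul0r mulr0; ring.
rewrite mulr0 mulr0 add0r; have [A0|A0] := eqVneq A 0.
  have -> : S1 = 0 by apply: big1 => i _; rewrite A0 oppr0 z0 !mulr0.
  have -> : S2 = (-1) ^+ k1 * (-1) ^+ k2 * B^-1 ^+ (k1 + k2).+2 * 'C(k1 + k2 + 1, k2)%:R.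
    rewrite (addnC k1 k2) -hockey_stick natr_sum mulr_sumr; apply: eq_bigr => i _.
    have ik : (i <= k2)%N by rewrite -ltnS.
    rewrite A0 sub0r -(exprD (- B)^-1) (_ : (k2 - i).+1 + (k1 + i).+1 = (k2 + k1).+2)%N; last by lia.
    by rewrite signXN -addn2 !exprD sqrrN expr1n; ring.
  rewrite A0 subr0 (negbTE B0) z0 mul0r mul0r !mulr0 !addr0 add0r mul1r.
  rewrite (_ : (-1) ^+ k2 * _ = (-1) ^+ k1 * ((-1) ^+ k2 * (-1) ^+ k2) * B^-1 ^+ (k1 + k2).+2 * 'C(k1 + k2 + 1, k2)%:R); last by ring.
  by rewrite sgn; ring.
(* When A = B both sums contain a factor 0^-1, so only the power A^-(k1 + k2 + 2) is left; the sign
   (-1)^(k1 + k2) matches it with the same power of -A. *)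
rewrite mul0r mulr0 add0r; have [BA|BA] := eqVneq (B - A) 0.
  have AB : A - B = 0 by rewrite -opprB BA oppr0.
  have BE : B = A by apply/eqP; rewrite -subr_eq0 BA.
  have -> : S1 = 0 by apply: big1 => i _; rewrite BA z0 mul0r mulr0.
  have -> : S2 = 0 by apply: big1 => i _; rewrite AB z0 !mulr0.
  by rewrite BE !mulr0 !addr0 mul1r -exprD addSn addnS signXN mulrA 2!(exprS (-1)) !mulN1r opprK sgn mul1r.
rewrite mul0r mulr0.
have xyt : A^-1 * B^-1 = (B - A)^-1 * (A^-1 - B^-1) by field; rewrite A0 BA B0.
rewrite (pf_generic xyt) /pfx /pfy /S1 /S2 !mulr_sumr.
have E1 (i : 'I_k1.+1) : (-1) ^+ k1 * ('C(k2 + i, i)%:R * ((B - A)^-1 ^+ (k2 + i).+1 * (- A)^-1 ^+ (k1 - i).+1))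
   = - ((-1) ^+ i * 'C(k2 + i, i)%:R * (B - A)^-1 ^+ (k2 + i).+1 * A^-1 ^+ (k1 - i).+1).
  have ik : (i <= k1)%N by rewrite -ltnS.
  rewrite signXN [(-1) ^+ (k1 - i).+1]exprS.
  have -> : (-1) ^+ k1 = (-1) ^+ (k1 - i) * (-1) ^+ i :> K by rewrite -exprD subnK.
  move: (sgn (k1 - i)%N) ('C(_, _)%:R) ((B - A)^-1 ^+ _) (A^-1 ^+ _) ((-1) ^+ i).
  move: ((-1) ^+ _) => e ee c f g s.
  by transitivity (- (e * e) * (s * c * f * g)); [ring | rewrite ee mulN1r].
have E2 (i : 'I_k2.+1) : (-1) ^+ k2 * ('C(k1 + i, i)%:R * ((- B)^-1 ^+ (k2 - i).+1 * (A - B)^-1 ^+ (k1 + i).+1))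
   = (-1) ^+ k1 * ('C(k1 + i, i)%:R * B^-1 ^+ (k2 - i).+1 * (B - A)^-1 ^+ (k1 + i).+1).
  have ik : (i <= k2)%N by rewrite -ltnS.
  rewrite -[A - B]opprB !signXN ![(-1) ^+ _.+1]exprS exprD.
  have -> : (-1) ^+ k2 = (-1) ^+ (k2 - i) * (-1) ^+ i :> K by rewrite -exprD subnK.
  move: ('C(_, _)%:R) ((B - A)^-1 ^+ _) (B^-1 ^+ _) ((-1) ^+ k1) (sgn (k2 - i)%N) (sgn i) => c f g t.
  move: ((-1) ^+ (k2 - i)) ((-1) ^+ i) => e s ee ss.
  by transitivity ((e * e) * (s * s) * (t * (c * g * f))); [ring | rewrite ee ss !mul1r].
rewrite (eq_bigr _ (fun i _ => E1 i)) (eq_bigr _ (fun i _ => E2 i)) sumrN; ring.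
Qed.

End PartialFractions.

(** * Regularized sums over pairs of lattice vectors *)

Section RegularizedSums.
Variable R : realType.
Local Notation C := R[i].

(** A list of directions rather than a power of one difference: the factors of a product are
    differenced in different variables, and two regularizations are compared by concatenating their
    lists. *)
Definition diffs (V : zmodType) (s : seq V) (f : V -> C) : V -> C := foldr (@diff R V) f s.

Section Diffs.
Variable V : zmodType.
Implicit Types (s t : seq V) (f g : V -> C).

Lemma diffs_cat s t f : diffs (s ++ t) f = diffs s (diffs t f).
Proof. exact: foldr_cat. Qed.

Lemma diffsD s f g : diffs s (fun x => f x + g x) = fun x => diffs s f x + diffs s g x.
Proof.
by elim: s => //= l s ->; apply: funext => x; rewrite /diff; ring.
Qed.

Lemma diffsZ s (c : C) f : diffs s (fun x => c * f x) = fun x => c * diffs s f x.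
Proof.
by elim: s => //= l s ->; apply: funext => x; rewrite /diff; ring.
Qed.

Lemma diffs_comm l s f : diffs s (diff l f) = diff l (diffs s f).
Proof.
elim: s => //= m s ->; apply: funext => x; rewrite /diff (addrAC x (- l)); ring.
Qed.

Lemma diffs_catC s t f : diffs (s ++ t) f = diffs (t ++ s) f.
Proof. by elim: t => [|l t IH] /=; rewrite ?cats0 // -IH !diffs_cat /= diffs_comm. Qed.

Lemma diffs_comp (W : zmodType) (e : W -> V) (e' : V -> W) s f :
  (forall x y, e (x - y) = e x - e y) -> cancel e' e ->
  diffs (map e' s) (f \o e) = diffs s f \o e.
Proof.
move=> eB e'K; elim: s => //= l s ->.
by apply: funext => x; rewrite /diff /= eB e'K.
Qed.

End Diffs.

Section Regular.
Variable V : zmodType.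
Variable X : V -> C.
Hypotheses (XD : forall x y, X (x + y) = X x * X y).
Implicit Types (s t : seq V) (f g : V -> C) (v w : C).

Definition diff_factor s : C := \prod_(l <- s) (1 - X l).

(* [v] is the sum of [X * f], regularized by applying finite differences to [f];
   for a character X this multiplies the sum by the factors 1 - X l. *)
Definition reg_sum f v := exists s, all (fun l => X l != 1) s /\
  has_sum (fun x => X x * diffs s f x) (diff_factor s * v).

(** Absolute convergence is remembered for the factors of a product, where [has_sum_pair] needs
    it. *)
Definition abs_reg_sum f v := exists s, [/\ all (fun l => X l != 1) s,
  abs_summable (fun x => X x * diffs s f x) &
  has_sum (fun x => X x * diffs s f x) (diff_factor s * v)].

Lemma diff_factor_neq0 s : all (fun l => X l != 1) s -> diff_factor s != 0.
Proof.
move=> /allP H; rewrite /diff_factor prodf_seq_neq0; apply/allP => l /H h.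
by rewrite /= subr_eq0 eq_sym.
Qed.

Lemma has_sum_diffs s f v : has_sum (fun x => X x * f x) v ->
  has_sum (fun x => X x * diffs s f x) (diff_factor s * v).
Proof.
move=> H; elim: s => [|l s IH] /=; first by rewrite /diff_factor big_nil mul1r.
by rewrite /diff_factor big_cons -mulrA; exact: (@has_sum_diff R _ _ XD l _ _ IH).
Qed.

(** The differences of each regularization are applied to the sum of the other. As differences
    commute, both give the sum of one function, and the nonzero factors cancel. *)
Lemma reg_sum_unique f v w : reg_sum f v -> reg_sum f w -> v = w.
Proof.
move=> [s [Hs H]] [t [Ht K]].
have := @has_sum_diffs t _ _ H; have := @has_sum_diffs s _ _ K.
rewrite -!diffs_cat diffs_catC => /has_sum_unique/[apply]/esym.
rewrite mulrCA => /(mulfI (diff_factor_neq0 Hs))/(mulfI (diff_factor_neq0 Ht)) //.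
Qed.

Lemma reg_sumD f g v w : reg_sum f v -> reg_sum g w -> reg_sum (fun x => f x + g x) (v + w).
Proof.
move=> [s [Hs H]] [t [Ht K]]; exists (t ++ s); split; first by rewrite all_cat Ht.
have := @has_sum_diffs t _ _ H; have := @has_sum_diffs s _ _ K.
rewrite -!diffs_cat diffs_catC => H1 H2; have := has_sumD H2 H1.
rewrite /diff_factor big_cat /= mulrDr mulrCA !mulrA diffsD; congr (has_sum _ _).
  by apply: funext => x; rewrite mulrDr.
by rewrite (mulrC (\prod_(l <- s) _)).
Qed.

Lemma reg_sumZ (c : C) f v : reg_sum f v -> reg_sum (fun x => c * f x) (c * v).
Proof.
move=> [s [Hs H]]; exists s; split; first exact: Hs.
have := @has_sumZ _ _ c _ _ H.
rewrite diffsZ mulrCA; congr (has_sum _ _); by apply: funext => x; rewrite mulrCA.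
Qed.

Lemma reg_sum0 : reg_sum (fun=> 0) 0.
Proof.
exists [::]; split; first by [].
rewrite mulr0 /=.
have := @has_sum_fset R V (fun x => X x * 0) fset0; rewrite big_seq_fset0; apply=> x _.
by rewrite mulr0.
Qed.

Lemma reg_sum_sum n (f : 'I_n -> V -> C) (v : 'I_n -> C) :
  (forall i, reg_sum (f i) (v i)) -> reg_sum (fun x => \sum_(i < n) f i x) (\sum_(i < n) v i).
Proof.
elim: n f v => [|n IH] f v H.
  by rewrite big_ord0 (_ : (fun _ => _) = fun=> 0);
    [exact: reg_sum0|apply: funext => x; rewrite big_ord0].
rewrite big_ord_recr (_ : (fun _ => _) = fun x => \sum_(i < n) f (widen_ord (leqnSn n) i) x + f ord_max x).
  by apply: reg_sumD => //; apply: IH.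
by apply: funext => x; rewrite big_ord_recr.
Qed.

Lemma eq_reg_sum f g v : f =1 g -> reg_sum f v -> reg_sum g v.
Proof. by move=> /funext ->. Qed.

Hypothesis X0 : X 0 = 1.

Lemma abs_reg_sum_delta : abs_reg_sum (fun x => (x == 0)%:R) 1.
Proof.
have z x : x != 0 -> X x * (x == 0)%:R = 0 by move=> /negbTE ->; rewrite mulr0.
exists [::]; split=> //=.
  exists 1 => A; have [A0|A0] := boolP (0 \in A).
    rewrite (big_fsetD1 0) //= eqxx mulr1 X0 nm1 big_seq_cond big1 ?addr0 // => i.
    by rewrite andbT !inE => /andP[/z -> _]; rewrite nm0.
  rewrite big_seq_cond big1 // => i; rewrite andbT => iA.
  by rewrite z ?nm0 //; apply: contraNneq A0 => <-.
have := @has_sum_fset R V (fun x => X x * (x == 0)%:R) [fset 0]%fset.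
rewrite big_seq_fset1 eqxx X0 /diff_factor big_nil; apply => i; rewrite inE; exact: z.
Qed.

End Regular.

Lemma diffs_tensor (V W : zmodType) (s : seq V) (t : seq W) f g (p : V * W) :
  diffs (map (fun l => (l, 0)) s ++ map (fun l => (0, l)) t)
    (fun q : V * W => f q.1 * g q.2) p = diffs s f p.1 * diffs t g p.2.
Proof.
elim: s p => [|l s IH] [x y] /=.
  elim: t x y => [//|l t IH] x y /=.
  by rewrite /diff !IH /= subr0; ring.
by rewrite /diff !IH /= subr0; ring.
Qed.

(** Differences in directions (l, 0) act on the first factor only, and in directions (0, l) on the
    second. As both characters are 1 at 0, the conditions X l != 1 and Y l != 1 pass to the product
    character. *)
Lemma reg_sum_tensor (V W : zmodType) (X : V -> C) (Y : W -> C) f g v w :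
  X 0 = 1 -> Y 0 = 1 -> abs_reg_sum X f v -> abs_reg_sum Y g w ->
  reg_sum (fun p : V * W => X p.1 * Y p.2) (fun p => f p.1 * g p.2) (v * w).
Proof.
move=> X0 Y0 [s [Hs As Ss]] [t [Ht At St]].
exists (map (fun l => (l, 0)) s ++ map (fun l => (0, l)) t); split.
  rewrite all_cat !all_map; apply/andP; split.
    by apply: sub_all Hs => l /=; rewrite Y0 mulr1.
  by apply: sub_all Ht => l /=; rewrite X0 mul1r.
have := has_sum_pair As At Ss St.
rewrite /diff_factor big_cat !big_map /=.
rewrite [in X in _ -> X](eq_bigr (fun l => 1 - X l)); last by move=> l _; rewrite Y0 mulr1.
rewrite [\prod_(j <- t) (1 - X 0 * _)](eq_bigr (fun l => 1 - Y l)); last by move=> l _; rewrite X0 mul1r.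
rewrite mulrACA; congr (has_sum _ _); apply: funext => p.
by rewrite diffs_tensor mulrACA.
Qed.

Lemma reg_sum_comp (V W : zmodType) (X : V -> C) (e : W -> V) (e' : V -> W) f v :
  (forall x y, e (x - y) = e x - e y) -> cancel e e' -> cancel e' e ->
  reg_sum X f v -> reg_sum (X \o e) (f \o e) v.
Proof.
move=> eB eK e'K [s [Hs H]]; exists (map e' s); split.
  by rewrite all_map; apply: sub_all Hs => l /=; rewrite e'K.
rewrite (diffs_comp s f eB e'K).
have -> : diff_factor (X \o e) (map e' s) = diff_factor X s.
  by rewrite /diff_factor big_map; apply: eq_bigr => l _ /=; rewrite e'K.
exact: (@has_sum_reindex R _ _ e e' _ _ eK e'K H).
Qed.

End RegularizedSums.

(** * The three-term relation for the values K(tau, 0) *)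

Section ThreeTerm.
Variable R : realType.
Local Notation C := R[i].
Variables (tau : C) (tauH : upper_half_plane tau).
Local Notation L := (int * int)%type.
Local Notation chi z := (chr (coord1 tau z) (coord2 tau z)).
Local Notation K k z := (EK k tau z 0).

Lemma EK_reg_sum k z (l : L) : (0 < k)%N -> chi z l != 1 ->
  abs_reg_sum (chi z) (fun x => (emb tau x)^-1 ^+ k) (K k z).
Proof.
move=> k0 zl; exists [:: l; l]; split; first by rewrite /= zl.
  exact: (EK0_summable z k0 tauH l (leqnn 2)).
rewrite /diff_factor !big_cons big_nil mulr1.
exact: (EK0_has_sum k0 tauH zl (leqnn 2)).
Qed.

Lemma three_term u v w (lu lv lw : L) k1 k2 :
  chi u lu != 1 -> chi v lv != 1 -> chi w lw != 1 ->
  (forall x, chi u x * chi v x * chi w x = 1) ->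
  K k1.+1 u * K k2.+1 v
  + (-1) ^+ k1 * (\sum_(i < k1.+1) 'C(k2 + i, i)%:R * (K (k2 + i).+1 v * K (k1 - i).+1 w))
  + (-1) ^+ k2 * (\sum_(i < k2.+1) 'C(k1 + i, i)%:R * (K (k2 - i).+1 w * K (k1 + i).+1 u))
  = (-1) ^+ k2 * 'C(k1 + k2 + 1, k1)%:R * K (k1 + k2).+2 u
    + (-1) ^+ k1 * 'C(k1 + k2 + 1, k2)%:R * K (k1 + k2).+2 v
    + (-1) ^+ (k1 + k2) * K (k1 + k2).+2 w.
Proof.
move=> Hu Hv Hw uvw.
pose X (p : L * L) : C := chi u p.1 * chi v p.2.
have XD p q : X (p + q) = X p * X q by rewrite /X !chrD mulrACA.
pose E k (x : L) : C := (emb tau x)^-1 ^+ k.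
have Eu k : abs_reg_sum (chi u) (E k.+1) (K k.+1 u) by apply: EK_reg_sum Hu.
have Ev k : abs_reg_sum (chi v) (E k.+1) (K k.+1 v) by apply: EK_reg_sum Hv.
have Ew k : abs_reg_sum (chi w) (E k.+1) (K k.+1 w) by apply: EK_reg_sum Hw.
have del z : abs_reg_sum (chi z) (fun x => (x == 0)%:R) 1.
  by apply: abs_reg_sum_delta; exact: chr0.
have tensor z z' f g a b : abs_reg_sum (chi z) f a -> abs_reg_sum (chi z') g b ->
  reg_sum (fun p : L * L => chi z p.1 * chi z' p.2) (fun p => f p.1 * g p.2) (a * b).
  by apply: reg_sum_tensor; exact: chr0.
have X1 f g a b : abs_reg_sum (chi u) f a -> abs_reg_sum (chi v) g b ->
  reg_sum X (fun p => f p.1 * g p.2) (a * b) by exact: tensor.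
have chiN z x : chi z (- x) * chi z x = 1 by rewrite -chrD addNr chr0.
have wN x : chi w (- x) = chi u x * chi v x.
  have inv (a b d : C) : a * b = 1 -> d * b = 1 -> d = a.
    by move=> h1 h2; rewrite -[LHS]mulr1 -h1 mulrCA h2 mulr1.
  exact: inv (uvw x) (chiN w x).
(* [e] has order three, and [e'] is both its inverse and its square. Since chi_w(-x) = chi_u(x)
   chi_v(x), the character X built from (u, v) is the pullback by [e] of the one built from (v, w),
   and by [e'] of the one built from (w, u). *)
pose e (p : L * L) : L * L := (p.2 - p.1, - p.1).
pose e' (p : L * L) : L * L := (- p.2, p.1 - p.2).
have eK : cancel e e' by move=> [x y]; congr (_, _); rewrite /= opprK ?subrK.
have e'K : cancel e' e by move=> [x y]; congr (_, _); rewrite /= opprK ?subrK.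
have eB p q : e (p - q) = e p - e q.
  by case: p q => [? ?] [? ?]; congr (_, _); rewrite /= ?opprD ?opprK; [rewrite addrACA|].
have e'B p q : e' (p - q) = e' p - e' q.
  by case: p q => [? ?] [? ?]; congr (_, _); rewrite /= ?opprD ?opprK; [|rewrite addrACA].
have X2 f g a b : abs_reg_sum (chi v) f a -> abs_reg_sum (chi w) g b ->
  reg_sum X (fun p => f (p.2 - p.1) * g (- p.1)) (a * b).
  move=> Hf Hg; have := @reg_sum_comp R _ _ _ e e' _ _ eB eK e'K (tensor _ _ _ _ _ _ Hf Hg).
  have -> // : (fun p : L * L => chi v p.1 * chi w p.2) \o e = X.
  apply: funext => -[x y]; rewrite /X /= chrD -[RHS]mul1r -[in RHS](chiN v x) wN; ring.
have X3 f g a b : abs_reg_sum (chi w) f a -> abs_reg_sum (chi u) g b ->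
  reg_sum X (fun p => f (- p.2) * g (p.1 - p.2)) (a * b).
  move=> Hf Hg; have := @reg_sum_comp R _ _ _ e' e _ _ e'B e'K eK (tensor _ _ _ _ _ _ Hf Hg).
  have -> // : (fun p : L * L => chi w p.1 * chi u p.2) \o e' = X.
  apply: funext => -[x y]; rewrite /X /= chrD -[RHS]mulr1 -[in RHS](chiN u y) wN; ring.
set l := LHS; set r := RHS.
(* [F] and [G] are the two sides of [partial_fractions] at the lattice points of a pair; summand by
   summand, [X1], [X2] and [X3] give them the regularized sums l and r. *)
pose F p : C := E k1.+1 p.1 * E k2.+1 p.2
  + (-1) ^+ k1 * (\sum_(i < k1.+1) 'C(k2 + i, i)%:R * (E (k2 + i).+1 (p.2 - p.1) * E (k1 - i).+1 (- p.1)))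
  + (-1) ^+ k2 * (\sum_(i < k2.+1) 'C(k1 + i, i)%:R * (E (k2 - i).+1 (- p.2) * E (k1 + i).+1 (p.1 - p.2))).
have Hl : reg_sum X F l.
  apply: (reg_sumD XD); first apply: (reg_sumD XD); first exact: X1.
    apply: reg_sumZ; apply: (reg_sum_sum XD) => i; apply: reg_sumZ; exact: (X2 (E _) (E _)).
  apply: reg_sumZ; apply: (reg_sum_sum XD) => i; apply: reg_sumZ; exact: (X3 (E _) (E _)).
suff Hr : reg_sum X F r by exact: (reg_sum_unique XD Hl Hr).
pose G p : C := (-1) ^+ k2 * 'C(k1 + k2 + 1, k1)%:R * (E (k1 + k2).+2 p.1 * (p.2 == 0)%:R)
  + (-1) ^+ k1 * 'C(k1 + k2 + 1, k2)%:R * ((p.1 == 0)%:R * E (k1 + k2).+2 p.2)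
  + (-1) ^+ (k1 + k2) * ((p.2 - p.1 == 0)%:R * E (k1 + k2).+2 (- p.1)).
have Hr : reg_sum X G r.
  apply: (reg_sumD XD); first apply: (reg_sumD XD).
  - by apply: reg_sumZ; rewrite -[K _ u]mulr1; exact: (X1 (E _) (fun x => (x == 0)%:R)).
  - by apply: reg_sumZ; rewrite -[K _ v]mul1r; exact: (X1 (fun x => (x == 0)%:R) (E _)).
  - by apply: reg_sumZ; rewrite -[K _ w]mul1r; exact: (X2 (fun x => (x == 0)%:R) (E _)).
apply: eq_reg_sum Hr => -[x y]; apply: esym; rewrite /F /G /E /=.
have NE z : emb tau (- z) = - emb tau z by rewrite -[- z]sub0r embB emb0 sub0r.
rewrite !embB !NE -!(emb_eq0 _ tauH) embB; exact: partial_fractions.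
Qed.

End ThreeTerm.

(** * Brackets *)

Lemma exprNDn (S : comNzRingType) (x y : S) n :
  (- x - y) ^+ n = (-1) ^+ n * \sum_(i < n.+1) x ^+ (n - i) * y ^+ i *+ 'C(n, i).
Proof. by rewrite -opprD (exprNn (x + y)) exprDn. Qed.

Section Bracket.
Variables (K : comNzRingType) (E1 E2 : nat -> K).
Implicit Types P Q : {poly {poly K}}.

(** [bracket] sums over the exact sizes of P, which are not additive; over common larger bounds the
    formula is visibly linear. *)
Lemma bracket_widen m n P : (size P <= m)%N -> (sizeY P <= n)%N ->
  bracket E1 E2 P = \sum_(i < m) \sum_(j < n) P`_i`_j * (E1 i.+1 * E2 j.+1).
Proof.
move=> Pm Pn; rewrite /bracket.
rewrite (big_ord_widen m (fun i => \sum_(j < size P`_i) P`_i`_j * (E1 i.+1 * E2 j.+1)) Pm) big_mkcond.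
apply: eq_bigr => i _; case: ltnP => [_|iP]; last first.
  by rewrite (nth_default _ iP) big1 // => j _; rewrite coef0 mul0r.
have sn : (size (P`_i)%R <= n)%N by apply: leq_trans Pn; exact: max_size_coefXY.
rewrite (big_ord_widen n (fun j => P`_i`_j * (E1 i.+1 * E2 j.+1)) sn) big_mkcond.
by apply: eq_bigr => j _; case: ltnP => // h; rewrite (nth_default _ h) mul0r.
Qed.

Lemma bracketD P Q : bracket E1 E2 (P + Q) = bracket E1 E2 P + bracket E1 E2 Q.
Proof.
pose m := maxn (size (P + Q)) (maxn (size P) (size Q)).
pose n := maxn (sizeY (P + Q)) (maxn (sizeY P) (sizeY Q)).
rewrite !(@bracket_widen m n) ?leq_max ?leqnn ?orbT //.
rewrite -big_split; apply: eq_bigr => i _; rewrite -big_split; apply: eq_bigr => j _.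
by rewrite !coefD mulrDl.
Qed.

Lemma bracketZ (c : K) P : bracket E1 E2 (c%:P%:P * P) = c * bracket E1 E2 P.
Proof.
pose m := maxn (size (c%:P%:P * P)) (size P).
pose n := maxn (sizeY (c%:P%:P * P)) (sizeY P).
rewrite !(@bracket_widen m n) ?leq_max ?leqnn ?orbT //.
rewrite mulr_sumr; apply: eq_bigr => i _; rewrite mulr_sumr; apply: eq_bigr => j _.
by rewrite coefCM coefCM -mulrA.
Qed.

Lemma bracket0 : bracket E1 E2 0 = 0.
Proof. by rewrite /bracket size_poly0 big_ord0. Qed.

Lemma bracket_sum n (c : 'I_n -> K) (p q : 'I_n -> nat) :
  bracket E1 E2 (\sum_(i < n) (c i)%:P%:P * ('X ^+ p i * 'Y ^+ q i))
  = \sum_(i < n) c i * (E1 (p i).+1 * E2 (q i).+1).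
Proof.
rewrite (big_morph (bracket E1 E2) bracketD bracket0).
by apply: eq_bigr => i _; rewrite bracketZ bracketXY.
Qed.

Lemma bracket_XYX k1 k2 : bracket E1 E2 ((- 'X - 'Y) ^+ k1 * 'X ^+ k2)
  = (-1) ^+ k1 * \sum_(i < k1.+1) 'C(k1, i)%:R * (E1 (k2 + i).+1 * E2 (k1 - i).+1).
Proof.
rewrite mulr_sumr; under [RHS]eq_bigr do rewrite (mulrA ((-1) ^+ k1)).
rewrite -(bracket_sum (fun i : 'I_k1.+1 => (-1) ^+ k1 * 'C(k1, i)%:R) (fun i => (k2 + i)%N) (fun i => (k1 - i)%N)).
congr (bracket _ _ _).
rewrite (addrC (- 'X)) exprNDn mulr_sumr mulr_suml.
apply: eq_bigr => i _; rewrite !rmorphM !rmorphXn !rmorphN1 /= !rmorph_nat exprD -mulr_natr; ring.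
Qed.

Lemma bracket_YXY k1 k2 : bracket E1 E2 ('Y ^+ k1 * (- 'X - 'Y) ^+ k2)
  = (-1) ^+ k2 * \sum_(i < k2.+1) 'C(k2, i)%:R * (E1 (k2 - i).+1 * E2 (k1 + i).+1).
Proof.
rewrite mulr_sumr; under [RHS]eq_bigr do rewrite (mulrA ((-1) ^+ k2)).
rewrite -(bracket_sum (fun i : 'I_k2.+1 => (-1) ^+ k2 * 'C(k2, i)%:R) (fun i => (k2 - i)%N) (fun i => (k1 + i)%N)).
congr (bracket _ _ _).
rewrite exprNDn !mulr_sumr.
apply: eq_bigr => i _; rewrite !rmorphM !rmorphXn !rmorphN1 /= !rmorph_nat exprD -mulr_natr; ring.
Qed.

End Bracket.

(** * Nontrivial characters, and the relation for the normalized series *)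

Section Torsion.
Variable R : realType.
Local Notation C := R[i].

Lemma exp2piI_int (n : int) : exp2piI (n%:~R : R)%:C = 1.
Proof. by rewrite -[n%:~R]add0r exp2piID_int exp2piI0. Qed.

(** For the fractional part f of x, the double angle formula turns cos(2 pi f) = 1 into sin(pi f) =
    0, whereas the sine is positive on the open interval from 0 to pi; so f = 0. *)
Lemma exp2piI_eq1 (x : R) : exp2piI x%:C = 1 -> exists n : int, x = n%:~R.
Proof.
move=> H; exists (Num.floor x); pose f := x - (Num.floor x)%:~R.
have f0 : 0 <= f by rewrite subr_ge0 floor_le_tmp.
have f1 : f < 1 by rewrite ltrBlDl; have := lt_succ_floor x; rewrite rmorphD.
suff : f = 0 by move/eqP; rewrite subr_eq0 => /eqP.
apply/eqP; rewrite eq_le f0 andbT leNgt; apply/negP => fp.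
have : exp2piI f%:C = 1.
  by rewrite -H -[in RHS](subrK (Num.floor x)%:~R x) exp2piID_int.
rewrite /exp2piI /expC /= !(mul0r, mulr0, subr0, addr0, oppr0) expR0 mul1r => -[c _].
have sp : 0 < sin (pi * f).
  apply: sin_gt0_pi; rewrite mulr_gt0 ?pi_gt0 //=.
  by rewrite -[ltRHS]mulr1 ltr_pM2l ?pi_gt0.
have := cos2Dsin2 (pi * f); have := cos_mulr2n (pi * f).
rewrite (_ : pi * f *+ 2 = 0 + 2 * pi * 1 * f) ?c; last by ring.
 have : 0 < sin (pi * f) ^+ 2 by rewrite exprn_gt0.
rewrite mulr2n; lra.
Qed.

Variable tau : C.
Hypothesis tauH : upper_half_plane tau.
Local Notation chi z := (chr (coord1 tau z) (coord2 tau z)).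

(** The values at the two basis vectors are exp(2 pi i x), with x the second coordinate of z and
    minus the first; if both are 1, the coordinates are integers. *)
Lemma chr_nontrivial z : z \notin lattice tau -> exists l, chi z l != 1.
Proof.
move=> zL; have [H1|] := eqVneq (chi z (1, 0)) 1; last by exists (1, 0).
have [H2|] := eqVneq (chi z (0, 1)) 1; last by exists (0, 1).
have [n nE] : exists n : int, coord2 tau z = n%:~R.
  by apply: exp2piI_eq1; move: H1; rewrite /chr /= mul1r mul0r subr0.
have [m mE] : exists m : int, - coord1 tau z = m%:~R.
  by apply: exp2piI_eq1; move: H2; rewrite /chr /= mul1r mul0r sub0r.
case/negP: zL; apply/asboolP; exists (- m), n.
rewrite {1}(coordK z tauH) nE -[coord1 tau z]opprK mE -rmorphN.
by rewrite !(rmorph_int (real_complex R)).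
Qed.

Lemma coord1D z w : coord1 tau (z + w) = coord1 tau z + coord1 tau w.
Proof. by rewrite /coord1 raddfD mulrDl. Qed.

Lemma coord2D z w : coord2 tau (z + w) = coord2 tau z + coord2 tau w.
Proof. by rewrite /coord2 coord1D raddfD /=; ring. Qed.

Lemma coord_uniq (a b : R) : coord1 tau (a%:C * tau + b%:C) = a /\ coord2 tau (a%:C * tau + b%:C) = b.
Proof.
have h : coord1 tau (a%:C * tau + b%:C) = a.
  move: tauH; rewrite /coord1 /upper_half_plane; case: (tau) => x y /= y0.
  by rewrite mul0r !addr0 mulfK // gt_eqF.
split=> //; rewrite /coord2 h; case: (tau) => x y /=; ring.
Qed.

Lemma chr_lattice z x : z \in lattice tau -> chi z x = 1.
Proof.
move=> /asboolP[m [n ->]]; rewrite -!(rmorph_int (real_complex R)).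
have [-> ->] := coord_uniq m%:~R n%:~R.
by rewrite /chr -!rmorphM -rmorphB exp2piI_int.
Qed.

Lemma chr_mul3 u v w x : u + v + w \in lattice tau -> chi u x * chi v x * chi w x = 1.
Proof.
move=> /chr_lattice h; rewrite -(h x) /chr -!exp2piID -!rmorphD !coord1D !coord2D.
by congr (exp2piI _%:C); ring.
Qed.

(** The factorials in the normalization of E turn the coefficients C(k1, i) of the expanded power of
    -X - Y into the coefficients C(k2 + i, i) of the partial fractions. *)
Lemma bin_fact3 k1 k2 i : (i <= k1)%N ->
  ('C(k1, i) * ((k2 + i)`! * (k1 - i)`!) = k1`! * k2`! * 'C(k2 + i, i))%N.
Proof.
move=> ik; have := bin_fact ik; have := bin_fact (leq_addl k2 i); rewrite addnK.
move=> <- <-; ring.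
Qed.

Lemma eisenstein_three_term u v w k1 k2 :
  u \notin lattice tau -> v \notin lattice tau -> w \notin lattice tau ->
  u + v + w \in lattice tau ->
  let E z := fun k => eisenstein k tau z in
  bracket (E u) (E v) ('X ^+ k1 * 'Y ^+ k2)
  + bracket (E v) (E w) ((- 'X - 'Y) ^+ k1 * 'X ^+ k2)
  + bracket (E w) (E u) ('Y ^+ k1 * (- 'X - 'Y) ^+ k2)
  = (-1) ^+ (k2 + 1) / (k2 + 1)%:R * E u (k1 + k2 + 2)%N
    + (-1) ^+ (k1 + 1) / (k1 + 1)%:R * E v (k1 + k2 + 2)%N
    + (-1) ^+ (k1 + k2 + 1) * (k1`!%:R * k2`!%:R / (k1 + k2 + 1)`!%:R)
      * E w (k1 + k2 + 2)%N.
Proof.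
move=> /chr_nontrivial[lu Hu] /chr_nontrivial[lv Hv] /chr_nontrivial[lw Hw] uvw E.
have H := three_term tauH k1 k2 Hu Hv Hw (fun x => chr_mul3 x uvw).
pose kap : C := (- ((2 * pi)%:C * 'i%C))^-1.
have EE z k : E z k.+1 = - (k`!%:R * kap ^+ k.+1 * EK k.+1 tau z 0).
  by rewrite /E /eisenstein /kap exprVn mulNr.
(* The relation is [three_term] multiplied by c: each product of two E has total weight k1 + k2 + 2,
   and its two minus signs cancel. *)
pose c : C := k1`!%:R * k2`!%:R * kap ^+ (k1 + k2).+2.
have term z z' m n i a b : (a + b = k1 + k2)%N -> ('C(m, i) * (a`! * b`!) = k1`! * k2`! * 'C(n, i))%N ->
    'C(m, i)%:R * (E z a.+1 * E z' b.+1) = c * ('C(n, i)%:R * (EK a.+1 tau z 0 * EK b.+1 tau z' 0)).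
  move=> ab /(congr1 (fun n => n%:R : C)); rewrite !natrM => h.
  rewrite !EE mulrNN /c -ab -addSn -addnS exprD.
  by rewrite [RHS](_ : _ = (k1`!%:R * k2`!%:R * 'C(n, i)%:R) * (kap ^+ a.+1 * kap ^+ b.+1 * (EK a.+1 tau z 0 * EK b.+1 tau z' 0)));
    [rewrite -h|]; ring.
have fact0 n : n`!%:R != 0 :> C by rewrite pnatr_eq0 -lt0n fact_gt0.
(* A single E keeps its minus sign, hence the exponent k' + 1 of -1; and k1! k2! C(k1 + k2 + 1, k) =
   (k1 + k2 + 1)! / (k' + 1) gives the denominator. *)
have rhs k k' z : (k + k' = k1 + k2)%N -> (k`! * k'`! = k1`! * k2`!)%N -> c * ((-1) ^+ k' * 'C(k1 + k2 + 1, k)%:R * EK (k1 + k2).+2 tau z 0)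
   = (-1) ^+ (k' + 1) / (k' + 1)%:R * E z (k1 + k2).+2.
  move=> kk' /(congr1 (fun n => n%:R : C)); rewrite !natrM => h.
  have hk : (k <= k1 + k2 + 1)%N by lia.
  have := bin_fact hk; rewrite (_ : (k1 + k2 + 1 - k = k'.+1)%N); last by lia.
  move=> /(congr1 (fun n => n%:R : C)); rewrite factS !natrM EE addn1 => h'.
  rewrite -h' /c -h !addn1 (exprS (-1)); have d0 : k'.+1%:R != 0 :> C by rewrite pnatr_eq0.
  move: ('C(_, _)%:R) (k`!%:R) (k'`!%:R) ((-1) ^+ k') (kap ^+ _) (EK _ _ _ _) => a b d e f g.
  by move: (k'.+1%:R) d0 => n d0; field.
have -> : (k1 + k2 + 2 = (k1 + k2).+2)%N by rewrite addn2.
rewrite bracketXY bracket_XYX bracket_YXY -(rhs k1 k2) // -(rhs k2 k1) ?(addnC k2) ?(mulnC k2`!) //.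
have -> : (-1) ^+ (k1 + k2 + 1) * (k1`!%:R * k2`!%:R / (k1 + k2 + 1)`!%:R) * E w (k1 + k2).+2
   = c * ((-1) ^+ (k1 + k2) * EK (k1 + k2).+2 tau w 0).
  rewrite EE /c addn1 exprS; field; exact: fact0.
rewrite -!mulrDr -H !mulrDr; congr (_ + _ + _).
- have := @term u v 0%N 0%N 0%N k1 k2 erefl; rewrite !bin0 !mul1r mul1n muln1; exact.
- rewrite mulrCA; congr (_ * _); rewrite mulr_sumr; apply: eq_bigr => i _.
  have ik : (i <= k1)%N by rewrite -ltnS.
  by apply: term; [lia|exact: bin_fact3].
- rewrite mulrCA; congr (_ * _); rewrite mulr_sumr; apply: eq_bigr => i _.
  have ik : (i <= k2)%N by rewrite -ltnS.
  apply: term; [lia|]; rewrite (mulnC (k2 - i)`!) (mulnC k1`!); exact: bin_fact3.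
Qed.

End Torsion.

(** * Points of the torus *)

Section Points.
Local Open Scope quotient_scope.
Local Open Scope ring_scope.
Variable R : realType.
Local Notation C := R[i].

Lemma torus_notin (tau : C) (u : torus tau) : u != 0 -> repr u \notin lattice tau.
Proof.
apply: contraNN => uL; have : repr u - 0 \in lattice tau by rewrite subr0.
rewrite (Quotient.idealrBE (lattice tau)) reprK => /eqP ->; apply/eqP.
exact: (@pi_zeror _ _ _ _ _ (torus tau)).
Qed.

Lemma torus_sum3 (tau : C) (u v w : torus tau) : u + v + w = 0 ->
  repr u + repr v + repr w \in lattice tau.
Proof.
move=> H; rewrite -[X in X \in _]subr0 (Quotient.idealrBE (lattice tau)).
have piD := @pi_addr _ _ _ _ _ (torus tau).
apply/eqP; apply: etrans (etrans _ (esym (@pi_zeror _ _ _ _ _ (torus tau)))).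
  exact: piD.
by rewrite piD !reprK.
Qed.

Definition level_point N (a : level_vect N) (tau : C) : C :=
  ((a.1 : nat)%:R * tau + (a.2 : nat)%:R) / N%:R.

Section Level.
Variable N : nat.
Hypothesis N0 : (0 < N)%N.

Lemma level_pointE (a : level_vect N) (tau : C) :
  level_point a tau = ((a.1 : nat)%:R / N%:R : R)%:C * tau + ((a.2 : nat)%:R / N%:R : R)%:C.
Proof.
by rewrite /level_point !rmorphM !fmorphV !(rmorph_nat (real_complex R)); ring.
Qed.

Lemma level_vect_lt (a : level_vect N) : ((a.1 : nat) < N)%N /\ ((a.2 : nat) < N)%N.
Proof. by have := ltn_ord a.1; have := ltn_ord a.2; move: (nat_of_ord _) (nat_of_ord _) => x y; rewrite !prednK. Qed.

Lemma level_vect_eq0 (a : level_vect N) : (a == 0) = ((a.1 : nat) == 0%N) && ((a.2 : nat) == 0%N).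
Proof. by case: a => a1 a2. Qed.

Lemma level_notin (a : level_vect N) (tau : C) : upper_half_plane tau -> a != 0 ->
  level_point a tau \notin lattice tau.
Proof.
move=> tauH; apply: contraNN => /asboolP[m [n]].
have N1 : N%:R != 0 :> R by rewrite pnatr_eq0 -lt0n.
rewrite level_pointE -!(rmorph_int (real_complex R)) => E.
have [c1 c2] := coord_uniq tauH ((a.1 : nat)%:R / N%:R) ((a.2 : nat)%:R / N%:R).
have [d1 d2] := coord_uniq tauH m%:~R n%:~R.
have int0 (x : nat) (p : int) : (x < N)%N -> x%:R / N%:R = p%:~R :> R -> x = 0%N.
  move=> xN /(congr1 (fun y => y * N%:R)); rewrite divfK // pmulrn (pmulrn _ N) -intrM.
  clear -xN; move=> /intr_inj; case: p => p; [rewrite -PoszM => -[xE]|rewrite NegzE mulNr -PoszM; lia].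
  by move: xN; rewrite xE; case: p {xE} => // p; rewrite mulSn ltnNge leq_addr.
have [h1 h2] := level_vect_lt a.
rewrite level_vect_eq0; apply/andP; split; apply/eqP.
  by apply: (int0 _ m h1); rewrite -c1 E d1.
by apply: (int0 _ n h2); rewrite -c2 E d2.
Qed.

Lemma level_sum3 (a b c : level_vect N) (tau : C) : a + b + c = 0 ->
  level_point a tau + level_point b tau + level_point c tau \in lattice tau.
Proof.
case: a b c => [a1 a2] [b1 b2] [c1 c2] [] h1 h2; apply/asboolP.
(* Addition in [level_vect] is modulo N, so the three representatives add up to a multiple of N. *)
have ex (x y z : nat) : (((x + y) %% N.-1.+1 + z) %% N.-1.+1 = 0)%N -> exists p : int, (x + y + z)%N%:R = p%:~R * N%:R :> C.
  rewrite prednK // modnDml => /eqP/dvdnP[p ->]; exists p.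
  by rewrite natrM.
have [p hp] := ex _ _ _ h1; have [q hq] := ex _ _ _ h2; exists p, q.
have N1 : N%:R != 0 :> C by rewrite pnatr_eq0 -lt0n.
have -> : p%:~R = (a1 + b1 + c1)%N%:R / N%:R :> C by rewrite hp mulfK.
have -> : q%:~R = (a2 + b2 + c2)%N%:R / N%:R :> C by rewrite hq mulfK.
by rewrite /level_point /= !natrD; field.
Qed.

End Level.
End Points.

(** * Action of SL_2(Z) *)

Section Torsion.
Variable R : realType.
Local Notation C := R[i].
Implicit Types (k : nat) (a b : R) (tau : C).

(* With the torsion coordinates (a, b) fixed, the character [chr a b] does not
   depend on tau. *)
Definition EKt k a b tau : C := EK k tau (a%:C * tau + b%:C) 0.

Lemma EKt_has_sum k a b l tau : (0 < k)%N -> upper_half_plane tau -> chr a b l != 1 ->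
  has_sum (fun x => chr a b x * iter 2 (diff l) (fun y => (emb tau y)^-1 ^+ k) x)
    ((1 - chr a b l) ^+ 2 * EKt k a b tau).
Proof.
move=> k0 tauH; have [c1 c2] := coord_uniq tauH a b.
have := @EK0_has_sum R k tau (a%:C * tau + b%:C) k0 tauH l 2; rewrite c1 c2 => H hl.
exact: H.
Qed.

Lemma EKt_reg_sum k a b l tau : (0 < k)%N -> upper_half_plane tau -> chr a b l != 1 ->
  reg_sum (chr a b) (fun x => (emb tau x)^-1 ^+ k) (EKt k a b tau).
Proof.
move=> k0 tauH hl; exists [:: l; l]; split; first by rewrite /= hl.
by rewrite /diff_factor !big_cons big_nil mulr1; exact: EKt_has_sum.
Qed.

(** The regularized sum determines the value, and a, b enter it only through the character. *)
Lemma eq_EKt k a b a' b' l tau : (0 < k)%N -> upper_half_plane tau -> chr a b l != 1 ->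
  chr a b = chr a' b' -> EKt k a b tau = EKt k a' b' tau.
Proof.
move=> k0 tauH hl E; apply: (reg_sum_unique (@chrD R a b) (EKt_reg_sum k0 tauH hl)).
rewrite E; apply: (@EKt_reg_sum k a' b' l) => //; by rewrite -E.
Qed.

Lemma chr_shift a b (m n : int) : chr (a + m%:~R) (b + n%:~R) = chr a b.
Proof.
apply: funext => -[p q]; rewrite /chr /= -[RHS](exp2piID_int _ (p * n - q * m)).
by congr (exp2piI _%:C); rewrite rmorphB !rmorphM /=; ring.
Qed.

Lemma det2 (g : 'M[int]_2) : \det g = g 0 0 * g 1 1 - g 0 1 * g 1 0.
Proof.
rewrite (expand_det_row _ 0) !big_ord_recl big_ord0 /cofactor !det_mx11 !mxE /=.
have -> : lift ord0 ord0 = 1 :> 'I_2 by apply: val_inj.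
have -> : lift (1 : 'I_2) 0 = 0 :> 'I_2 by apply: val_inj.
by rewrite /bump /= addn0 expr0 expr1; ring.
Qed.

Section Action.
Variable g : 'M[int]_2.
Hypothesis gS : SL2Z g.
Local Notation p := (g 0 0).
Local Notation q := (g 0 1).
Local Notation r := (g 1 0).
Local Notation s := (g 1 1).

Lemma SL2Z_det : p * s - q * r = 1.
Proof. by rewrite -det2; exact: gS. Qed.

Lemma automorphy_neq0 tau : upper_half_plane tau -> automorphy g tau != 0.
Proof.
move=> tauH; rewrite -[automorphy g tau]/(emb tau (r, s)) (emb_eq0 _ tauH).
by apply/eqP => -[r0 s0]; have := SL2Z_det; rewrite r0 s0 !mulr0 subrr.
Qed.

Lemma moebiusH tau : upper_half_plane tau -> upper_half_plane (moebius g tau).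
Proof.
move=> tauH; have j0 := automorphy_neq0 tauH; rewrite /upper_half_plane /=.
set w := moebius g tau; set j := automorphy g tau in j0 *.
have jj : j * conjc j = (nm j ^+ 2)%:C.
  by rewrite nm_sqr; case: (j) => x y; apply: complex_ext => /=; ring.
have n0 : 0 < nm j ^+ 2 by rewrite exprn_gt0 // nm_gt0.
have E : w * (nm j ^+ 2)%:C = (p%:~R * tau + q%:~R) * conjc j.
  by rewrite -jj /w /moebius -/j mulrA divfK.
have : Im w * nm j ^+ 2 = Im tau.
  have := congr1 (fun z : C => Im z) E; rewrite ImM /= mulr0 add0r mulrC => ->.
  rewrite /j /automorphy -!(rmorph_int (real_complex R)) [RHS](_ : _ = (p * s - q * r)%:~R * Im tau).
    by rewrite rmorphB !rmorphM; case: (tau) => x y /=; ring.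
  by rewrite SL2Z_det mul1r.
by move=> h; move: tauH; rewrite /upper_half_plane /= -h pmulr_lgt0.
Qed.

(** Row vectors multiplied by g on the right: the permutation of indices under which a point of the
    lattice of [moebius g tau] is a point of the lattice of tau divided by [automorphy g tau]. *)
Definition lact (x : int * int) : int * int := (x.1 * p + x.2 * r, x.1 * q + x.2 * s).
Definition lact_inv (x : int * int) : int * int := (x.1 * s - x.2 * r, x.2 * p - x.1 * q).

Lemma lactK : cancel lact lact_inv.
Proof.
move=> [x y]; have d := SL2Z_det; rewrite /lact /lact_inv /=; congr (_, _);
  rewrite -[RHS]mulr1 -d; ring.
Qed.

Lemma lact_invK : cancel lact_inv lact.
Proof.
move=> [x y]; have d := SL2Z_det; rewrite /lact /lact_inv /=; congr (_, _);
  rewrite -[RHS]mulr1 -d; ring.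
Qed.

Lemma lactB x y : lact (x - y) = lact x - lact y.
Proof. by case: x y => [x1 x2] [y1 y2]; congr (_, _) => /=; ring. Qed.

Lemma emb_lact tau x : upper_half_plane tau ->
  emb (moebius g tau) x = emb tau (lact x) / automorphy g tau.
Proof.
move=> /automorphy_neq0; rewrite /emb /moebius; set j := automorphy g tau => j0.
apply: (mulIf j0); rewrite mulrDl mulrA !divfK // /lact /j /automorphy /= !rmorphD !rmorphM /=; ring.
Qed.

(** The exponent x.1 b - x.2 a is the determinant with rows x and (a, b); both rows are multiplied
    by g, which has determinant 1. *)
Lemma chr_lact a b x : chr (a * p%:~R + b * r%:~R) (a * q%:~R + b * s%:~R) (lact x) = chr a b x.
Proof.
rewrite /chr /lact /=; congr (exp2piI _%:C); rewrite !rmorphD !rmorphM /=.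
have : p%:~R * s%:~R - q%:~R * r%:~R = 1 :> R by rewrite -!rmorphM -rmorphB SL2Z_det.
move=> d; transitivity ((x.1%:~R * b - x.2%:~R * a) * (p%:~R * s%:~R - q%:~R * r%:~R)); first ring.
by rewrite d mulr1.
Qed.

Lemma slash_EKt k a b l tau : (0 < k)%N -> upper_half_plane tau -> chr a b l != 1 ->
  slash k g (EKt k a b) tau = EKt k (a * p%:~R + b * r%:~R) (a * q%:~R + b * s%:~R) tau.
Proof.
move=> k0 tauH hl; set a' := _ + b * r%:~R; set b' := _ + b * s%:~R.
set j := automorphy g tau; have j0 : j != 0 by exact: automorphy_neq0.
have hl' : chr a' b' (lact l) != 1 by rewrite chr_lact.
have H1 := EKt_reg_sum k0 tauH hl'.
have := reg_sum_comp lactB lactK lact_invK H1.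
have -> : chr a' b' \o lact = chr a b by apply: funext => x; rewrite /= chr_lact.
move=> /(@reg_sumZ R _ (chr a b) (j ^+ k)) H2.
have H3 := EKt_reg_sum k0 (moebiusH tauH) hl.
have := reg_sum_unique (@chrD R a b) H3 (eq_reg_sum _ H2).
rewrite /slash => -> //; first by rewrite -/j mulrC mulKf // expf_neq0.
move=> x /=; rewrite emb_lact // -/j invfM invrK exprMn mulrC //.
Qed.

End Action.

Lemma EKt_term_le k a b l : (0 < k)%N ->
  exists (m : int * int -> R) (M : R) (A : nat), 0 <= M /\
    (forall B : {fset int * int}, \sum_(x <- B) m x <= M) /\
    forall (T : R) tau x, 1 <= T -> nm tau <= T -> T^-1 <= Im tau ->
      nm (chr a b x * iter 2 (diff l) (fun y => (emb tau y)^-1 ^+ k) x) <= T ^+ A * m x.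
Proof.
move=> k0; have [K [A [K0 HK]]] := lattice_diff_le R l 2 0 k0.
have y2 : 2 < k%:R + 2 :> R by rewrite ltrDr ltr0n.
have [M HM] := lsize_summable y2.
exists (fun x => K * lsize R x `^ (- (k%:R + 2))), (K * M), A; split.
  by rewrite mulr_ge0 //; have := HM fset0; rewrite big_seq_fset0.
split=> [B|T tau x T1 tauT ImT]; first by rewrite -mulr_sumr ler_wpM2l.
rewrite nmM nm_chr mul1r mulrA (mulrC (T ^+ A)).
have := HK T tau 0 x T1 tauT ImT; rewrite nm0 mulr0 addr0 => /(_ (lexx _)).
by rewrite (@eq_iter_diff R _ l 2 _ (fun y => (emb tau y)^-1 ^+ k)) // => y; rewrite ksym00.
Qed.

Lemma EKt_bound k a b l : (0 < k)%N -> chr a b l != 1 ->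
  exists (K : R) (A : nat), 0 <= K /\ forall (T : R) tau,
    1 <= T -> nm tau <= T -> T^-1 <= Im tau -> nm (EKt k a b tau) <= K * T ^+ A.
Proof.
move=> k0 hl; have [m [M [A [M0 [HM Hm]]]]] := EKt_term_le a b l k0.
pose c := nm ((1 - chr a b l) ^+ 2).
have c0 : 0 < c by rewrite nm_gt0 expf_neq0 // one_sub_chi.
exists (M / c), A; split; first by rewrite divr_ge0 // ltW.
move=> T tau T1 tauT ImT; have T0 : 0 < T by exact: lt_le_trans T1.
have tauH : upper_half_plane tau by rewrite /upper_half_plane /=; apply: lt_le_trans ImT; rewrite invr_gt0.
rewrite -(ler_pM2l c0) -nmM mulrA (mulrC c) divfK ?gt_eqF // (mulrC M).
apply: has_sum_le (EKt_has_sum k0 tauH hl); apply: (@summable_by_le R _ _ (fun x => T ^+ A * m x)).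
  by move=> x; exact: Hm.
by move=> B; rewrite -mulr_sumr ler_wpM2l // exprn_ge0 // ltW.
Qed.

Lemma EKt_derivable k a b l tau : (0 < k)%N -> upper_half_plane tau -> chr a b l != 1 ->
  exists d, hasd id (EKt k a b) tau d.
Proof.
move=> k0 tauH hl; have [m [M [A [M0 [HM Hm]]]]] := EKt_term_le a b l k0.
have t0 : 0 < Im tau by exact: tauH.
pose r := Im tau / 2; have r0 : 0 < r by rewrite divr_gt0.
(* One T valid on the whole disc of radius Im tau / 2 about tau, so that a single majorant serves
   there. *)
pose T := Num.max 1 (Num.max (nm tau + r) r^-1).
have [T1 T2 T3] : [/\ 1 <= T, nm tau + r <= T & r^-1 <= T] by rewrite /T !le_max !lexx !orbT.
have T0 : 0 < T by exact: lt_le_trans T1.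
have near z : nm (z - tau) < r -> [/\ 0 < Im z, nm z <= T & T^-1 <= Im z].
  move=> h; have h1 : r <= Im z.
    have := (ReIm_nm (z - tau)).2; rewrite ImB ler_norml /r => /andP[? ?]; move: h; rewrite /r; lra.
  split; first by exact: lt_le_trans h1.
    by apply: le_trans T2; have := nmD tau (z - tau); rewrite subrKC; lra.
  by apply: le_trans h1; rewrite invf_ple ?posrE.
pose F x z : C := chr a b x * iter 2 (diff l) (fun y => (emb z y)^-1 ^+ k) x.
pose c := (1 - chr a b l) ^+ 2; have c0 : c != 0 by rewrite expf_neq0 // one_sub_chi.
have [d Hd] : exists d, hasd id (fun z => c * EKt k a b z) tau d.
  apply: (@has_sum_derivable R _ F _ tau r (fun x => T ^+ A * m x) (T ^+ A * M)) => //.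
  - move=> x z /near[zH _ _]; rewrite /F.
    have dV y : exists d, hasd id (fun z => (emb z y)^-1 ^+ k) z d.
      have [->|y0] := eqVneq y 0.
        exists 0; apply: hasd_ext (hasd_cst id z 0) => w.
        by rewrite emb0 invr0 expr0n gtn_eqF.
      eexists; apply: hasdX; apply: (hasd_comp (hasdV _)); first by rewrite emb_eq0.
      by apply: hasdD; [apply: hasdZ; exact: hasd_id|exact: hasd_cst].
    have [d0 H0] := dV x; have [d1 H1] := dV (x - l); have [d2 H2] := dV (x - l - l).
    eexists; apply: hasdZ; exact: (hasdB (hasdB H0 H1) (hasdB H1 H2)).
  - by move=> x z /near[_ z1 z2]; exact: Hm.
  - by move=> B; rewrite -mulr_sumr ler_wpM2l // exprn_ge0 // ltW.
  - by move=> z /near[zH _ _]; exact: EKt_has_sum.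
exists (c^-1 * d); apply: hasd_ext (hasdZ c^-1 Hd) => z.
by rewrite mulKf.
Qed.

End Torsion.

(** * Expansion in q *)

Section Logarithm.
Variable R : realType.
Local Notation C := R[i].

(** The sign of Im w decides between acos and its opposite. The bound on Im t enters the growth
    estimate near q = 0, the formula for its cosine the smallness of the logarithm near 1. *)
Lemma log_exists (w : C) : w != 0 -> exists t : C,
  [/\ expC t = w, Re t = ln (nm w), `|Im t| <= pi & cos (Im t) = Re w / nm w].
Proof.
move=> w0; have n0 : 0 < nm w by rewrite nm_gt0.
pose c := Re w / nm w; have [rw iw] := ReIm_nm w.
have c1 : -1 <= c <= 1.
  by rewrite -ler_norml normrM normfV (gtr0_norm n0) ler_pdivrMr // mul1r.
pose th := if 0 <= Im w then acos c else - acos c.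
have cth : cos th = c by rewrite /th; case: ifP => _; rewrite ?cosN acosK.
have thpi : `|th| <= pi.
  have -> : `|th| = acos c by rewrite /th; case: ifP => _; rewrite ?normrN ger0_norm ?acos_ge0.
  exact: acos_lepi.
have sth : sin th = Im w / nm w.
  have E : sin (acos c) = `|Im w| / nm w.
    rewrite sin_acos // (_ : 1 - c ^+ 2 = (Im w / nm w) ^+ 2); last first.
      apply: (mulIf (expf_neq0 2 (lt0r_neq0 n0))); rewrite mulrBl mul1r /c !exprMn !exprVn.
      by rewrite !divfK ?expf_neq0 ?gt_eqF // nm_sqr; ring.
    by rewrite sqrtr_sqr normrM normfV (gtr0_norm n0).
  rewrite /th; case: ifP => [h|/negbT]; first by rewrite E ger0_norm.
  by rewrite -ltNge => h; rewrite sinN E ltr0_norm // mulNr opprK.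
exists (ln (nm w) +i* th); split=> //; rewrite /expC /= cth sth lnK ?posrE //.
by apply: complex_ext; rewrite ?ReM ?ImM /= ?mul0r ?subr0 ?addr0 mulrC divfK ?gt_eqF.
Qed.

(** Re t = ln |w| is small near w = 1; Im t is small because its cosine Re w / |w| is near 1 while
    |Im t| <= pi, and the cosine decreases from 0 to pi. *)
Lemma log_near1 (e : R) : 0 < e -> exists2 d : R, 0 < d &
  forall w : C, nm (w - 1) < d -> exists2 t, expC t = w & nm t < e.
Proof.
move=> e0; pose s := Num.min (e / 2) 1.
have s0 : 0 < s by rewrite lt_min divr_gt0 // ltr01.
have [se s1] : s <= e / 2 /\ s <= 1 by rewrite /s !ge_min !lexx orbT.
have p2 : 2 <= pi :> R by exact: pi_ge2.
have m0 : 0 < 1 - cos s.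
  rewrite subr_gt0 -(cos0 R) ltr_cos // ?in_itv /= ?lexx ?pi_ge0 // ?(ltW s0) //; lra.
pose d := Num.min (1 / 2) (Num.min (s / 4) ((1 - cos s) / 4)).
have d0 : 0 < d by rewrite !lt_min !divr_gt0.
have [d1 d2 d3] : [/\ d <= 1 / 2, d <= s / 4 & d <= (1 - cos s) / 4].
  by rewrite /d !ge_min !lexx !orbT.
exists d => // w hw.
have h1 := nm_sub_le w 1; have h2 := nm_sub_le 1 w; rewrite nm1 in h1 h2.
rewrite nmB in h2; have [h3 _] := ReIm_nm (w - 1).
move: h3; rewrite ReB ler_norml /= => /andP[h3 _].
have n0 : 0 < nm w by lra.
have w0 : w != 0 by rewrite -nm_gt0.
have [t [tw tR tI tc]] := log_exists w0; exists t => //.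
have Ims : `|Im t| < s.
  rewrite ltNge; apply/negP => h.
  have : cos `|Im t| <= cos s.
    rewrite leNgt ltr_cos ?in_itv /= ?normr_ge0 ?(ltW s0) -?leNgt //; lra.
  have -> : cos `|Im t| = cos (Im t) by case: (ger0P (Im t)); rewrite ?cosN.
  rewrite tc ler_pdivrMr // => k.
  have k1 : cos s <= 1 by lra.
  have [c0|c0] := leP 0 (cos s); last first.
    have : cos s * nm w < 0 by rewrite nmulr_rlt0. lra.
  have : cos s * nm w <= cos s * (1 + d) by rewrite ler_wpM2l //; lra.
  have : cos s * d <= d by rewrite ler_piMl // ltW.
  lra.
have Res : `|Re t| <= s / 2.
  rewrite tR ler_norml; apply/andP; split.
    have i0 : 0 < (nm w)^-1 by rewrite invr_gt0.
    have := @le_ln1Dx R ((nm w)^-1 - 1); rewrite ltrBrDl subrr addrC subrK lnV ?posrE // => /(_ i0).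
    have : (nm w)^-1 - 1 <= 2 * d.
      rewrite lerBlDr -div1r ler_pdivrMr //.
      have : (2 * d + 1) * (1 - d) <= (2 * d + 1) * nm w by rewrite ler_wpM2l //; lra.
      have : 0 <= d * (1 - 2 * d) by rewrite mulr_ge0 //; lra.
      lra.
    lra.
  have := @le_ln1Dx R (nm w - 1); rewrite subrKC => k.
  have : ln (nm w) <= nm w - 1 by apply: k; lra.
  lra.
have := nm_ReIm t; lra.
Qed.

(** With exp t = 1 + h, the numbers h and t agree up to o(t), so f inherits at 1 the derivative of
    its composite with exp at 0. Only small logarithms of points near 1 are used, not a continuous
    branch elsewhere. *)
Lemma hasd_log (f G : C -> C) d (rho : R) : 0 < rho -> hasd id G 0 d ->
  (forall t, nm t < rho -> f (expC t) = G t) -> hasd id f 1 d.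
Proof.
move=> rho0 HG fG e e0; have nd := nm_ge0 d.
have e4 : 0 < e / 4 by rewrite divr_gt0.
have [D1 D10 H1] := HG _ e4.
pose e3 := Num.min (1 / 2) (e / (4 * (nm d + 1))).
have nd1 : 0 < nm d + 1 by lra.
have e30 : 0 < e3 by rewrite lt_min !divr_gt0 // mulr_gt0.
have [e3a e3b] : e3 <= 1 / 2 /\ e3 <= e / (4 * (nm d + 1)) by rewrite /e3 !ge_min !lexx orbT.
have e3d : e3 * nm d <= e / 4.
  have : e3 * (nm d + 1) <= e / 4.
    apply: le_trans (ler_wpM2r (ltW nd1) e3b) _.
    by rewrite le_eqVlt; apply/orP; left; apply/eqP; field; rewrite gt_eqF.
  have := ltW e30; lra.
have [D2 D20 H2] := @hasd_expC R 0 _ e30.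
have [|de de0 Hde] := @log_near1 (Num.min rho (Num.min D1 D2)); first by rewrite !lt_min rho0 D10.
exists de => // h hd; have [|t tw] := Hde (1 + h); first by rewrite addrC addKr.
rewrite !lt_min => /and3P[t1 t2 t3].
have k2 := H2 t t3; rewrite add0r tw expC0 mulr1 (addrC 1) addrK in k2.
have k1 := H1 t t2; rewrite add0r in k1.
have th : nm t <= 2 * nm h.
  have n0 := nm_ge0 t; have := nm_sub_le t h; rewrite nmB.
  have : e3 * nm t <= 1 / 2 * nm t by rewrite ler_wpM2r.
  move: k2 => /=; lra.
rewrite -tw (fG t t1) -expC0 fG ?nm0 //= (_ : _ - _ - _ = (G t - G 0 - t * d) - (h - t) * d); last by ring.
apply: le_trans (nmD _ _) _; rewrite nmN nmM.
have : nm (h - t) * nm d <= (e3 * nm t) * nm d by rewrite ler_wpM2r.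
have : (e3 * nm d) * nm t <= e / 4 * nm t by rewrite ler_wpM2r // nm_ge0.
have : e / 4 * nm t <= e / 4 * (2 * nm h) by rewrite ler_wpM2l // ltW.
move: k1 => /=; lra.
Qed.

Lemma hasd_unique (f : C -> C) z d d' : hasd id f z d -> hasd id f z d' -> d = d'.
Proof.
move=> H H'; apply: nm_small_eq => e e0; have e2 : 0 < e / 2 by rewrite divr_gt0.
have [D D0 HD] := H _ e2; have [D' D'0 HD'] := H' _ e2.
pose r := Num.min D D' / 2; have m0 : 0 < Num.min D D' by rewrite lt_min D0.
have r0 : 0 < r by rewrite divr_gt0.
have nr : nm (r%:C : C) = r by rewrite nm_real gtr0_norm.
have [rD rD'] : r < D /\ r < D'.
  have : Num.min D D' <= D /\ Num.min D D' <= D' by rewrite !ge_min !lexx orbT.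
  by rewrite /r; lra.
have := HD r%:C; have := HD' r%:C; rewrite /= nr => /(_ rD') h1 /(_ rD) h2.
rewrite -(ler_pM2l r0) -{1}nr -nmM.
rewrite (_ : _ * _ = (f (z + r%:C) - f z - r%:C * d') - (f (z + r%:C) - f z - r%:C * d)); last by ring.
by apply: le_trans (nmD _ _) _; rewrite nmN; lra.
Qed.

(** q^2 F(q) is differentiable on the whole disc, and its first two Taylor coefficients vanish; so F
    extends by the coefficient of q^2, with the coefficient of q^3 as derivative. *)
Lemma removable (F : C -> C) :
  (forall q : C, q != 0 -> nm q < 1 -> exists d, hasd id F q d) ->
  (forall e : R, 0 < e -> exists2 D : R, 0 < D &
     forall q : C, q != 0 -> nm q < D -> nm (q * F q) <= e) ->
  exists F', (forall q : C, q != 0 -> F' q = F q) /\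
    forall q : C, nm q < 1 -> exists d, hasd id F' q d.
Proof.
move=> dF small; pose G q := q ^+ 2 * F q.
have G0 : hasd id G 0 0.
  move=> e /small[D D0 HD]; exists D => // h hD; rewrite /= mulr0 subr0 add0r /G.
  rewrite [0 ^+ 2]expr0n mul0r subr0.
  have [->|h0] := eqVneq h 0; first by rewrite expr0n mul0r nm0 mulr0.
  by rewrite expr2 -mulrA nmM mulrC ler_wpM2r ?nm_ge0 // HD.
have dG : derivable_on_ball G 0 1.
  move=> q; rewrite subr0 => q1; have [->|q0] := eqVneq q 0; first by exists 0.
  have [d Hd] := dF q q0 q1; eexists; apply: hasdM Hd; apply: hasdX; exact: hasd_id.
have [a [[B HB] _]] := taylor_ball ltr01 dG.
have HB' n (h : C) : nm h <= 1 / 4 -> nm (G h - \sum_(j < n) a j * h ^+ j) <= B * (2 * nm h) ^+ n.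
  by move=> /(HB n); rewrite add0r divr1.
have G00 : G 0 = 0 by rewrite /G expr0n mul0r.
have a0 : a 0%N = 0 by rewrite (remainder_coef0 ltr01 HB).
have a1 : a 1%N = 0.
  apply: hasd_unique G0; apply: (@hasd_quadratic R G 0 _ (4 * B) (1 / 4)); first lra.
  move=> h /(HB' 2%N); rewrite big_ord_recr big_ord1 /= a0 mul0r add0r expr1.
  by rewrite G00 add0r subr0 (mulrC h) exprMn => H; apply: le_trans H _; lra.
exists (fun q => if q == 0 then a 2%N else F q); split=> [q /negbTE -> //|q q1].
have [->|q0] := eqVneq q 0; last first.
  have [d Hd] := dF q q0 q1; exists d.
  apply: (@hasd_near R _ _ F _ q d (nm q)) Hd; rewrite ?nm_gt0 ?(negbTE q0) //.
  move=> h hq; case: eqP => // E; move: hq.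
  by rewrite (_ : h = - q) ?nmN ?ltxx //; apply/eqP; rewrite -addr_eq0 addrC E.
exists (a 3%N); apply: (@hasd_quadratic R _ 0 _ (16 * B) (1 / 4)); first lra.
move=> h hr; rewrite eqxx add0r; case: eqP => [->|/eqP h0].
  by rewrite subrr mul0r subr0 nm0 expr0n mulr0.
have n0 : 0 < nm h by rewrite nm_gt0.
have := HB' 4%N h hr; rewrite !big_ord_recr big_ord0 /= a0 a1 !mul0r !add0r.
have -> : G h - (a 2%N * h ^+ 2 + a 3%N * h ^+ 3) = h ^+ 2 * (F h - a 2%N - h * a 3%N) by rewrite /G; ring.
rewrite nmM nmX (_ : B * (2 * nm h) ^+ 4 = nm h ^+ 2 * (16 * B * nm h ^+ 2)); last by ring.
by rewrite ler_pM2l // exprn_gt0.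
Qed.

End Logarithm.

(** * Periodic functions of moderate growth as functions of q *)

Section FourierExpansion.
Variable R : realType.
Local Notation C := R[i].

Lemma expC_eq (t t' : C) : expC t = expC t' -> exists n : int,
  t = t' + n%:~R * ((2 * pi)%:C * 'i%C).
Proof.
move=> E; pose u := t - t'.
have u1 : expC u = 1 by rewrite /u expCD expCN E mulfV // expC_neq0.
have Ru : Re u = 0.
  by rewrite -[Re u]expRK -nm_expC u1 nm1 ln1.
have p0 : 2 * pi != 0 :> R by rewrite mulf_neq0 ?pnatr_eq0 ?gt_eqF ?pi_gt0.
have uE : u = (2 * pi)%:C * 'i%C * (Im u / (2 * pi))%:C.
  move: Ru; case: (u) => x y /= ->; apply: complex_ext => /=; first by ring.
  by rewrite !(mulr0, addr0, mulr1, add0r) mulrC divfK.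
have [n nE] : exists n : int, Im u / (2 * pi) = n%:~R.
  by apply: exp2piI_eq1; rewrite /exp2piI -uE.
exists n; rewrite -[LHS](subrKC t') -/u {1}uE nE (rmorph_int (real_complex R)); ring.
Qed.

Lemma pow_expR_decay (A : nat) (x : R) : 0 <= x -> x ^+ A.+1 <= A.+1`!%:R * expR x.
Proof.
move=> x0; have := expR_ge1Dxn A x0.
have f0 : 0 < A.+1`!%:R :> R by rewrite ltr0n fact_gt0.
rewrite -(ler_pM2l f0); apply: le_trans; rewrite mulrDr mulr1 mulrCA divff ?gt_eqF // mulr1.
by rewrite lerDr ltW.
Qed.

Variables (W : C -> C) (N : nat).
Hypothesis N0 : (0 < N)%N.
Hypothesis dW : forall tau : C, upper_half_plane tau -> exists d, hasd id W tau d.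
Hypothesis perW : forall tau : C, upper_half_plane tau -> W (tau + N%:R) = W tau.
Variables (K : R) (A : nat).
Hypothesis K0 : 0 <= K.
Hypothesis boundW : forall (T : R) (tau : C), 1 <= T -> nm tau <= T -> T^-1 <= Im tau ->
  nm (W tau) <= K * T ^+ A.

(** In the variable t = 2 pi i tau / N one has tau = t k and q = exp t, and the upper half-plane
    becomes Re t < 0. *)
Let c : C := (2 * pi)%:C * 'i%C.
Let k : C := N%:R / c.
Let V (t : C) := W (t * k).

Let p2 : 0 < 2 * pi :> R.
Proof. by rewrite mulr_gt0 ?pi_gt0. Qed.

Let c0 : c != 0.
Proof. by rewrite -nm_gt0 nmM nm_i mulr1 nm_real gtr0_norm. Qed.

Let Im_k (t : C) : Im (t * k) = - Re t * N%:R / (2 * pi).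
Proof.
have -> : k = (- (N%:R / (2 * pi)) : R)%:C * 'i%C.
  apply: (mulIf c0); rewrite /k divfK // /c mulrACA -rmorphM -expr2 sqr_i mulrN1 -rmorphN.
  by rewrite mulNr opprK divfK ?gt_eqF // rmorph_nat.
by rewrite ImM ReM ImM /=; ring.
Qed.

Let half_plane_k (t : C) : Re t < 0 -> upper_half_plane (t * k).
Proof.
move=> t0; rewrite /upper_half_plane /= Im_k divr_gt0 // mulr_gt0 ?ltr0n //; lra.
Qed.

Let shiftH (x : R) (z : C) : upper_half_plane z -> upper_half_plane (z + x%:C).
Proof. by rewrite /upper_half_plane; case: z => ? ? /=; rewrite addr0. Qed.

Lemma periodic_int (n : int) tau : upper_half_plane tau -> W (tau + n%:~R * N%:R) = W tau.
Proof.
have H (m : nat) z : upper_half_plane z -> W (z + m%:R * N%:R) = W z.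
  elim: m z => [|m IH] z zH; first by rewrite mul0r addr0.
  rewrite -natr1 mulrDl mul1r addrA perW ?IH //.
  by rewrite -natrM -(rmorph_nat (real_complex R)); exact: shiftH.
move=> tauH; case: n => n; first exact: H.
have E : (Negz n)%:~R * N%:R = (- (n.+1%:R * N%:R) : R)%:C :> C.
  by rewrite NegzE mulrNz mulNr rmorphN rmorphM !rmorph_nat.
rewrite -(H n.+1 (tau + _)); last by rewrite E; exact: shiftH.
by rewrite NegzE mulrNz mulNr subrK.
Qed.

(** W is composed with a logarithm that may jump; periodicity makes the choice irrelevant.
    Differentiability at q is checked at 1 for the function of z / q. Near q = 0, |W| is at most
    polynomial in log(1 / |q|), so q W tends to 0 and the singularity is removable. *)
Lemma fourier_expansion : exists F : C -> C,
  (forall q : C, nm q < 1 -> exists d, hasd id F q d) /\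
  forall tau : C, upper_half_plane tau -> W tau = F (exp2piI (tau / N%:R)).
Proof.
have ex (w : C) : exists t : C, w != 0 -> [/\ expC t = w, Re t = ln (nm w), `|Im t| <= pi & cos (Im t) = Re w / nm w].
  have [->|w0] := eqVneq w 0; first by exists 0.
  by have [t Ht] := log_exists w0; exists t.
have [lg Hlg] := choice ex.
have NC : N%:R != 0 :> C by rewrite pnatr_eq0 -lt0n.
have ck : c * k = N%:R by rewrite /k mulrC divfK.
pose F0 q := V (lg q).
have F0E t : Re t < 0 -> F0 (expC t) = V t.
  move=> t0; have [/expC_eq[n nE] _ _ _] := Hlg _ (expC_neq0 t).
  by rewrite /F0 nE /V mulrDl -mulrA ck periodic_int //; exact: half_plane_k.
have lgneg (q : C) : q != 0 -> nm q < 1 -> Re (lg q) < 0.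
  by move=> q0 q1; have [_ -> _ _] := Hlg _ q0; rewrite -ln1 ltr_ln ?posrE ?nm_gt0.
have [||F [FE dF]] := @removable R F0.
- move=> q q0 q1; have t0 := lgneg q q0 q1; have [lE _ _ _] := Hlg _ q0.
  set t := lg q in t0 lE.
  have [d Hd] := dW (half_plane_k t0).
  have HG : hasd id (fun u => V (t + u)) 0 (d * ((0 + 1) * k + (t + 0) * 0)).
    apply: (hasd_comp (F := W) (f := fun u => (t + u) * k)); first by rewrite addr0.
    by apply: hasdM; [apply: hasdD; [exact: hasd_cst|exact: hasd_id]|exact: hasd_cst].
  have Hf : hasd id (fun w => F0 (q * w)) 1 (d * ((0 + 1) * k + (t + 0) * 0)).
    apply: (@hasd_log R _ _ _ (- Re t)) HG _; first by rewrite oppr_gt0.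
    move=> u hu; rewrite -lE -expCD F0E //.
    have [h _] := ReIm_nm u; have -> : Re (t + u) = Re t + Re u by case: (t) (u) => ? ? [].
    by have := ler_norm (Re u); lra.
  have Hc : hasd id (fun z => q^-1 * z) q (q^-1 * 1) by apply: hasdZ; exact: hasd_id.
  eexists; apply: hasd_ext (hasd_comp (F := fun w => F0 (q * w)) (f := fun z => q^-1 * z) _ Hc).
    by move=> z; rewrite mulVKf.
  by rewrite mulVf //; exact: Hf.
- move=> e e0.
  pose B := K * N%:R ^+ A * (A.+1`!%:R * expR pi).
  have B0 : 0 <= B by rewrite !mulr_ge0 ?exprn_ge0 ?expR_ge0.
  (* With u = -log |q| > Y >= 2 pi, the point tau = t k has imaginary part at least 1, and T = N (u
     + pi) is admissible in the growth bound. Then |q F0(q)| (u + pi) <= B by [pow_expR_decay], and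
     Y >= B / e gives B <= e u. *)
  pose Y := Num.max (2 * pi) (B / e).
  exists (expR (- Y)); first exact: expR_gt0.
  move=> q q0 qY; have [lE lR lI _] := Hlg _ q0; set t := lg q in lE lR lI.
  have nq0 : 0 < nm q by rewrite nm_gt0.
  pose u := - Re t.
  have qE : nm q = expR (- u) by rewrite /u opprK lR lnK.
  have uY : Y < u by move: qY; rewrite qE ltr_expR ltrN2.
  have [Y1 Y2] : 2 * pi <= Y /\ B / e <= Y by rewrite /Y !le_max !lexx orbT.
  have u0 : 0 < u by apply: lt_trans uY; apply: lt_le_trans Y1.
  have pg := pi_ge2 R.
  have N1 : (1 : R) <= N%:R by rewrite ler1n.
  pose x := u + pi; have x1 : 1 <= x by rewrite /x; lra.
  pose T := N%:R * x.
  have T1 : 1 <= T by rewrite -[1]mulr1 /T ler_pM.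
  have tT : nm (t * k) <= T.
    rewrite nmM /T mulrC; apply: ler_pM; rewrite ?nm_ge0 //.
      rewrite /k nmM nm_nat nmV ler_pdivrMr ?nm_gt0 // ler_peMr //.
      by rewrite /c nmM nm_i mulr1 nm_real gtr0_norm //; lra.
    apply: le_trans (nm_ReIm _) _; rewrite lerD // /u ltr0_norm //.
    by move: u0; rewrite /u oppr_gt0.
  have IT : T^-1 <= Im (t * k).
    apply: (@le_trans _ _ 1); first by rewrite invf_le1 // (lt_le_trans _ T1).
    rewrite Im_k -/u ler_pdivlMr // mul1r.
    have : u <= u * N%:R by rewrite ler_peMr // ltW.
    lra.
  have hb := boundW T1 tT IT.
  rewrite nmM /F0 -/t /V qE.
  have x0 : 0 < x by lra.
  have eu0 := expR_gt0 (- u).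
  apply: (@le_trans _ _ (expR (- u) * (K * T ^+ A))); first by rewrite ler_wpM2l // ltW.
  rewrite -(ler_pM2r x0) (_ : expR (- u) * (K * T ^+ A) * x = (K * N%:R ^+ A) * expR (- u) * x ^+ A.+1);
    last by rewrite /T exprMn exprSr; ring.
  apply: (@le_trans _ _ ((K * N%:R ^+ A) * expR (- u) * (A.+1`!%:R * expR x))).
    by rewrite ler_wpM2l ?pow_expR_decay ?(ltW x0) // !mulr_ge0 ?exprn_ge0 // ltW.
  have -> : (K * N%:R ^+ A) * expR (- u) * (A.+1`!%:R * expR x) = B.
    rewrite /B /x expRD.
    rewrite (_ : _ * _ = K * N%:R ^+ A * (A.+1`!%:R * expR pi) * (expR (- u) * expR u)); last by ring.
    by rewrite -expRD addNr expR0 mulr1.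
  have : B <= e * u by rewrite mulrC -ler_pdivrMr //; apply: ltW; exact: le_lt_trans uY.
  by rewrite /x; have := ltW e0; nra.
exists F; split=> // tau tauH.
have tE : c * (tau / N%:R) * k = tau by rewrite /k; field; rewrite NC c0.
rewrite /exp2piI -/c FE ?expC_neq0 // F0E /V ?tE //.
have := Im_k (c * (tau / N%:R)); rewrite tE; move: tauH; rewrite /upper_half_plane /= => h E.
move: h; rewrite E pmulr_lgt0 ?invr_gt0 // pmulr_lgt0 ?ltr0n // oppr_gt0 //.
Qed.

End FourierExpansion.

(** * Modular forms *)

Section ModularForms.
Variable R : realType.
Local Notation C := R[i].
Variable N : nat.
Implicit Types (k l : nat) (f h : C -> C) (tau : C).

Lemma disc_nm (q : C) : [set q : C | `|q| < 1] q = (nm q < 1).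
Proof. by rewrite /= ltC_nm. Qed.

Lemma modular_forms_prod k l f h : modular_forms R k N f -> modular_forms R l N h ->
  modular_forms R (k + l) N (fun tau => f tau * h tau).
Proof.
have holoM U f' h' : holomorphic_on U f' -> holomorphic_on U h' ->
    holomorphic_on U (fun z : C => f' z * h' z).
  move=> Hf Hh z Uz; have [d Hd] := (hasdP f' z).1 (Hf z Uz).
  have [d' Hd'] := (hasdP h' z).1 (Hh z Uz).
  by apply/hasdP; eexists; exact: hasdM Hd Hd'.
have slashM g tau : slash (k + l) g (fun tau => f tau * h tau) tau = slash k g f tau * slash l g h tau.
  by rewrite /slash exprD invfM; ring.
move=> [f1 f2 f3] [h1 h2 h3]; split; first exact: holoM.
- by move=> g tau gG tauH; rewrite slashM f2 ?h2.
- move=> g gS; have [F F1 F2] := f3 g gS; have [H H1 H2] := h3 g gS.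
  by exists (fun q => F q * H q); [exact: holoM|move=> tau tauH; rewrite slashM F2 ?H2].
Qed.

Lemma modular_forms_lin k f h (c : C) : modular_forms R k N f -> modular_forms R k N h ->
  modular_forms R k N (fun tau => f tau + c * h tau).
Proof.
have holoL U f' h' : holomorphic_on U f' -> holomorphic_on U h' ->
    holomorphic_on U (fun z : C => f' z + c * h' z).
  move=> Hf Hh z Uz; have [d Hd] := (hasdP f' z).1 (Hf z Uz).
  have [d' Hd'] := (hasdP h' z).1 (Hh z Uz).
  by apply/hasdP; eexists; exact: (hasdD Hd (hasdZ c Hd')).
have slashL g tau : slash k g (fun tau => f tau + c * h tau) tau = slash k g f tau + c * slash k g h tau.
  by rewrite /slash; ring.
move=> [f1 f2 f3] [h1 h2 h3]; split; first exact: holoL.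
- by move=> g tau gG tauH; rewrite slashL f2 ?h2.
- move=> g gS; have [F F1 F2] := f3 g gS; have [H H1 H2] := h3 g gS.
  by exists (fun q => F q + c * H q); [exact: holoL|move=> tau tauH; rewrite slashL F2 ?H2].
Qed.

Lemma eq_modular_forms k f h : f =1 h -> modular_forms R k N f -> modular_forms R k N h.
Proof. by move=> /funext ->. Qed.

Lemma modular_forms_0 k : modular_forms R k N (fun=> 0).
Proof.
have H0 z : derivable ((fun=> 0) : C^o -> C^o) (z : C) 1.
  by apply/hasdP; exists 0; exact: hasd_cst.
split=> [z _|g tau _ _|g _]; first exact: H0.
  by rewrite /slash mul0r.
by exists (fun=> 0) => [q _|tau _]; [exact: H0|rewrite /slash mul0r].
Qed.

Lemma modular_forms_sum k n (c : 'I_n -> C) (f : 'I_n -> C -> C) :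
  (forall i, modular_forms R k N (f i)) ->
  modular_forms R k N (fun tau => \sum_(i < n) c i * f i tau).
Proof.
elim: n c f => [|n IH] c f H.
  by rewrite (_ : (fun _ => _) = fun=> 0); [exact: modular_forms_0|apply: funext => t; rewrite big_ord0].
rewrite (_ : (fun _ => _) = fun tau => \sum_(i < n) c (widen_ord (leqnSn n) i) * f (widen_ord (leqnSn n) i) tau
  + c ord_max * f ord_max tau); last by apply: funext => t; rewrite big_ord_recr.
by apply: modular_forms_lin => //; exact: IH.
Qed.

Hypothesis N0 : (0 < N)%N.

Let NR : N%:R != 0 :> R.
Proof. by rewrite pnatr_eq0 -lt0n. Qed.

Lemma EKt_shift k (a b : R) (m n : int) (l : int * int) tau : (0 < k)%N -> upper_half_plane tau ->
  chr a b l != 1 -> EKt k (a + m%:~R) (b + n%:~R) tau = EKt k a b tau.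
Proof. by move=> k0 tauH hl; apply/esym/(eq_EKt k0 tauH hl); rewrite chr_shift. Qed.

(** Translation by N is the action of the matrix with rows (1, N) and (0, 1), which adds (m / N) N =
    m to the second coordinate; an integral shift does not change the value. *)
Lemma EKt_periodic k (m : int) (b : R) (l : int * int) tau : (0 < k)%N -> upper_half_plane tau ->
  chr (m%:~R / N%:R) b l != 1 -> EKt k (m%:~R / N%:R) b (tau + N%:R) = EKt k (m%:~R / N%:R) b tau.
Proof.
move=> k0 tauH hl.
pose g : 'M[int]_2 := \matrix_(i, j) (if i == 0 then (if j == 0 then 1 else N%:Z) else (if j == 0 then 0 else 1)).
have gS : SL2Z g by rewrite /SL2Z /= det2 !mxE /=; ring.
have := slash_EKt gS k0 tauH hl; rewrite /slash /moebius /automorphy !mxE /=.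
rewrite mul0r add0r !mul1r expr1n !divr1 !mulr1 mulr0 addr0 -pmulrn => ->.
rewrite (_ : m%:~R / N%:R * N%:Z%:~R + b = b + m%:~R); last by rewrite -pmulrn divfK // addrC.
by rewrite -[X in EKt k X _ _](addr0 (m%:~R / N%:R)) -[X in _ + X](mulr0z 1) (EKt_shift _ _ k0 tauH hl).
Qed.

(** Slashing by any element of SL_2(Z) leads to another torsion point of level N, so the growth and
    the period at that point settle every cusp, without a choice of representatives. *)
Lemma EKt_modular k (p q : int) (l : int * int) : (0 < k)%N ->
  chr (p%:~R / N%:R : R) (q%:~R / N%:R) l != 1 ->
  modular_forms R k N (EKt k (p%:~R / N%:R) (q%:~R / N%:R)).
Proof.
move=> k0 hl; split.
- by move=> z zH; apply/hasdP; exact: (EKt_derivable k0 zH hl).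
- move=> g tau [gS gN] tauH; rewrite (slash_EKt gS k0 tauH hl).
  have ex i j : exists r : int, (g i j)%:~R = (1%:M i j : int)%:~R + r%:~R * N%:R :> R.
    have /eqP := gN i j; rewrite eqz_mod_dvd => /dvdzP[r rE]; exists r.
    by rewrite -[g i j](subrK (1%:M i j : int)) rE rmorphD rmorphM addrC.
  have [r0 E0] := ex 0 0; have [r1 E1] := ex 0 1.
  have [r2 E2] := ex 1 0; have [r3 E3] := ex 1 1.
  (* An element of Gamma(N) changes the coordinates p / N and q / N by integers. *)
  have arith (x y u v : R) : x / N%:R * (1 + u * N%:R) + y / N%:R * (0 + v * N%:R) = x / N%:R + (x * u + y * v).
    by field; exact: NR.
  have arith' (x y u v : R) : x / N%:R * (0 + u * N%:R) + y / N%:R * (1 + v * N%:R) = y / N%:R + (x * u + y * v).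
    by field; exact: NR.
  rewrite E0 E1 E2 E3 !mxE /= !mulr1n !mulr0n !rmorph1 !rmorph0 arith arith' -!rmorphM -!rmorphD.
  exact: (EKt_shift _ _ k0 tauH hl).
- move=> g gS.
  pose p' := p * g 0 0 + q * g 1 0; pose q' := p * g 0 1 + q * g 1 1.
  have pE : (p%:~R / N%:R) * (g 0 0)%:~R + (q%:~R / N%:R) * (g 1 0)%:~R = p'%:~R / N%:R :> R.
    by rewrite /p' rmorphD !rmorphM /=; field; exact: NR.
  have qE : (p%:~R / N%:R) * (g 0 1)%:~R + (q%:~R / N%:R) * (g 1 1)%:~R = q'%:~R / N%:R :> R.
    by rewrite /q' rmorphD !rmorphM /=; field; exact: NR.
  have hl' : chr (p'%:~R / N%:R : R) (q'%:~R / N%:R) (lact g l) != 1.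
    by rewrite -pE -qE chr_lact.
  have [K [A [K0 HK]]] := EKt_bound k0 hl'.
  have [F [dF FE]] := fourier_expansion N0 (fun tau tauH => EKt_derivable k0 tauH hl')
    (fun tau tauH => EKt_periodic k0 tauH hl') K0 HK.
  exists F; first by move=> z zD; apply/hasdP; apply: dF; rewrite -disc_nm.
  by move=> tau tauH; rewrite (slash_EKt gS k0 tauH hl) pE qE FE.
Qed.

(** The character does not involve tau, so the torsion point may be tested at tau = i. *)
Lemma level_chr_nontrivial (a : level_vect N) : a != 0 ->
  exists l : int * int, chr (((a.1 : nat) : int)%:~R / N%:R : R) (((a.2 : nat) : int)%:~R / N%:R) l != 1.
Proof.
move=> a0; have iH : upper_half_plane ('i%C : C) by rewrite /upper_half_plane /= ltr01.
have [l hl] := chr_nontrivial iH (level_notin N0 iH a0); exists l.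
move: hl; rewrite level_pointE.
by have [-> ->] := coord_uniq iH ((a.1 : nat)%:R / N%:R) ((a.2 : nat)%:R / N%:R).
Qed.

Lemma eisenstein_level_modular k (a : level_vect N) : (0 < k)%N -> a != 0 ->
  modular_forms R k N (eisenstein_level k a).
Proof.
move=> k0 /level_chr_nontrivial[l hl].
have := @modular_forms_lin k (fun=> 0) _ (- ((k.-1)`!%:R / (- ((2 * pi)%:C * 'i%C)) ^+ k))
  (modular_forms_0 k) (EKt_modular k0 hl).
congr (modular_forms R k N _); apply: funext => tau.
by rewrite add0r /eisenstein_level -/(level_point a tau) level_pointE.
Qed.

Lemma level_bracket_modular k1 k2 (a b : level_vect N) : a != 0 -> b != 0 ->
  [/\ modular_forms R (k1 + k2 + 2) N (level_bracket ('X ^+ k1 * 'Y ^+ k2) a b),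
    modular_forms R (k1 + k2 + 2) N (level_bracket ((- 'X - 'Y) ^+ k1 * 'X ^+ k2) a b)
  & modular_forms R (k1 + k2 + 2) N (level_bracket ('Y ^+ k1 * (- 'X - 'Y) ^+ k2) a b)].
Proof.
move=> a0 b0.
have prod i j : (i + j = k1 + k2)%N -> modular_forms R (k1 + k2 + 2) N
    (fun tau => eisenstein_level i.+1 a tau * eisenstein_level j.+1 b tau).
  move=> <-; rewrite addn2 -addSn -addnS.
  by apply: modular_forms_prod; apply: eisenstein_level_modular.
split.
- by apply: eq_modular_forms (prod k1 k2 erefl) => tau; rewrite /level_bracket bracketXY.
- apply: eq_modular_forms (modular_forms_sum (fun i : 'I_k1.+1 => (-1) ^+ k1 * 'C(k1, i)%:R)
    (fun i => prod (k2 + i)%N (k1 - i)%N _)) => [tau|i]; last by have := ltn_ord i; lia.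
  by rewrite /level_bracket bracket_XYX mulr_sumr; apply: eq_bigr => i _; rewrite -mulrA.
- apply: eq_modular_forms (modular_forms_sum (fun i : 'I_k2.+1 => (-1) ^+ k2 * 'C(k2, i)%:R)
    (fun i => prod (k2 - i)%N (k1 + i)%N _)) => [tau|i]; last by have := ltn_ord i; lia.
  by rewrite /level_bracket bracket_YXY mulr_sumr; apply: eq_bigr => i _; rewrite -mulrA.
Qed.

End ModularForms.
Theorem theorem1p1 (R : realType) :
  (forall (tau : R[i]) (k k1 k2 : nat) (u v w : torus tau),
      upper_half_plane tau ->
      (2 <= k)%N -> k = (k1 + k2 + 2)%N ->
      u + v + w = 0 -> u != 0 -> v != 0 -> w != 0 ->
      torus_bracket ('X ^+ k1 * 'Y ^+ k2) u v
      + torus_bracket ((- 'X - 'Y) ^+ k1 * 'X ^+ k2) v w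
      + torus_bracket ('Y ^+ k1 * (- 'X - 'Y) ^+ k2) w u
      = (-1) ^+ (k2 + 1) / (k2 + 1)%:R * eisenstein_torus k u
        + (-1) ^+ (k1 + 1) / (k1 + 1)%:R * eisenstein_torus k v
        + (-1) ^+ (k1 + k2 + 1) * (k1`!%:R * k2`!%:R / (k1 + k2 + 1)`!%:R)
          * eisenstein_torus k w)
  /\
  (forall (k k1 k2 N : nat) (a b c : level_vect N),
      (2 <= k)%N -> k = (k1 + k2 + 2)%N -> (1 <= N)%N ->
      a + b + c = 0 -> a != 0 -> b != 0 -> c != 0 ->
      [/\ modular_forms R k N (level_bracket ('X ^+ k1 * 'Y ^+ k2) a b),
          modular_forms R k N
            (level_bracket ((- 'X - 'Y) ^+ k1 * 'X ^+ k2) b c)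
        & modular_forms R k N
            (level_bracket ('Y ^+ k1 * (- 'X - 'Y) ^+ k2) c a)]
      /\ [/\ modular_forms R k N (eisenstein_level k a),
             modular_forms R k N (eisenstein_level k b)
           & modular_forms R k N (eisenstein_level k c)]
      /\ forall tau : R[i], upper_half_plane tau ->
           level_bracket ('X ^+ k1 * 'Y ^+ k2) a b tau
           + level_bracket ((- 'X - 'Y) ^+ k1 * 'X ^+ k2) b c tau
           + level_bracket ('Y ^+ k1 * (- 'X - 'Y) ^+ k2) c a tau
           = (-1) ^+ (k2 + 1) / (k2 + 1)%:R * eisenstein_level k a tau
             + (-1) ^+ (k1 + 1) / (k1 + 1)%:R * eisenstein_level k b tau
             + (-1) ^+ (k1 + k2 + 1)
               * (k1`!%:R * k2`!%:R / (k1 + k2 + 1)`!%:R)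
               * eisenstein_level k c tau).
Proof.
split.
  move=> tau k k1 k2 u v w tauH _ -> uvw u0 v0 w0.
  exact: (eisenstein_three_term tauH k1 k2 (torus_notin u0) (torus_notin v0) (torus_notin w0)
    (torus_sum3 uvw)).
move=> k k1 k2 N a b c _ -> N0 abc a0 b0 c0; split; last split.
- have [m1 _ _] := level_bracket_modular R N0 k1 k2 a0 b0.
  have [_ m2 _] := level_bracket_modular R N0 k1 k2 b0 c0.
  by have [_ _ m3] := level_bracket_modular R N0 k1 k2 c0 a0.
- by split; apply: eisenstein_level_modular => //; rewrite addn2.
- move=> tau tauH; apply: (eisenstein_three_term tauH k1 k2).
  + exact: level_notin.
  + exact: level_notin.
  + exact: level_notin.
  + exact: level_sum3.
Qed.
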